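(* Let $s\in(0,1)$ and $p>1$ satisfy $2<sp<p$. Let $\Omega\subset\mathbb{R}^2$ be the Koch snowflake domain with boundary measure $\mu$ on $\partial\Omega$. Let $f\in L^1(\Omega)$, let $b\in C(\overline\Omega)$ with $b(x)>0$ for all $x\in\overline\Omega$, let $\varphi_1,\varphi_2\in W^{s,p}(\Omega)$ with $\varphi_1\le\varphi_2$ in $\Omega$, and assume that $\mathcal{K}=\{v\in W^{s,p}(\Omega):\varphi_1\le v\le\varphi_2\text{ in }\Omega\}\neq\emptyset$. Then the problem $$\min_{v\in\mathcal{K}}J_p(v),\qquad J_p(v)=\frac1p\iint_{\Omega\times\Omega}\frac{|v(x)-v(y)|^p}{|x-y|^{2+sp}}\,dx\,dy-\int_\Omega f(x)v(x)\,dx+\frac1p\int_{\partial\Omega}b(x)|v(x)|^p\,d\mu,$$ admits a unique solution.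
   Context: The Koch snowflake $K\subset\mathbb{R}^2$ is the closed curve which is the union of three coplanar Koch curves $K^1,K^2,K^3$ (built on the sides of an equilateral triangle), of Hausdorff dimension $d_f=\ln4/\ln3$; $\Omega$ is the bounded open domain with $\partial\Omega=K$; $\mu=\mu_1+\mu_2+\mu_3$, where $\mu_i$ is the normalized $d_f$-dimensional Hausdorff measure restricted to $K^i$. $W^{s,p}(\Omega)$ is the fractional Sobolev space with norm $\|u\|^p_{W^{s,p}(\Omega)}=\|u\|^p_{L^p(\Omega)}+\iint_{\Omega\times\Omega}\frac{|u(x)-u(y)|^p}{|x-y|^{2+sp}}dx\,dy$. Values on $\partial\Omega$ are understood as traces, $u(x)=\lim_{r\to0}\frac{1}{|B(x,r)\cap\Omega|}\int_{B(x,r)\cap\Omega}u(y)\,dy$ (since $sp>2$ these functions have continuous representatives). *)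

(* Defs.v *)
From HB Require Import structures.
From mathcomp Require Import all_boot all_order all_algebra.
From mathcomp Require Import all_classical all_reals all_analysis.
Set Implicit Arguments.
Unset Strict Implicit.
Unset Printing Implicit Defensive.
Import Order.TTheory GRing.Theory Num.Theory.
Import numFieldNormedType.Exports.
Local Open Scope classical_set_scope.
Local Open Scope ring_scope.

Section Plane.
Context {R : realType}.

(* The norm `|x| that the library puts on R * R is the sup norm, hence this
   separate Euclidean norm. The two norms induce the same topology, the product
   topology, and the same bounded sets, so that open, closure, connected,
   continuous and bounded_set below are the library's notions on R * R. *)
Definition enorm (x : R * R) : R := Num.sqrt (x.1 ^+ 2 + x.2 ^+ 2).

Definition eball (x : R * R) (r : R) : set (R * R) :=
  [set y | enorm (x - y) < r].

Definition boundary (A : set (R * R)) : set (R * R) :=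
  closure A `\` interior A.

End Plane.

(* The library puts its Lebesgue measure on measurableTypeR R, an alias of R
   equipped with the Borel sigma-algebra; mplane R is R * R accordingly. *)
Notation mplane R := (measurableTypeR R * measurableTypeR R)%type.

Definition lebesgue2 {R : realType} : set (mplane R) -> \bar R :=
  ((@lebesgue_measure R) \x (@lebesgue_measure R))%E.

HB.instance Definition _ (R : realType) := Measure.on (@lebesgue2 R).

Lemma lebesgue2_sigma_finite (R : realType) :
  sigma_finite setT (@lebesgue2 R).
Proof.
have /sigma_finiteP[F [TF ndF Foo]] := sigma_finiteT (@lebesgue_measure R).
exists (fun n => F n `*` F n).
  rewrite -setXTT TF predeqE => -[x y]; split.
    move=> [/= [n _ Fnx] [k _ Fky]]; exists (maxn n k) => //; split.
    - by move: x Fnx; exact/subsetPset/ndF/leq_maxl.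
    - by move: y Fky; exact/subsetPset/ndF/leq_maxr.
  by move=> [n _ []/= ? ?]; split; exists n.
move=> k; have [? ?] := Foo k.
split; first exact: measurableX.
by rewrite /lebesgue2 product_measure1E// lte_mul_pinfty// ge0_fin_numE.
Qed.

HB.instance Definition _ (R : realType) :=
  Measure_isSigmaFinite.Build _ _ _ (@lebesgue2 R) (@lebesgue2_sigma_finite R).

Section HausdorffMeasure.
Context {R : realType}.
Local Open Scope ereal_scope.

(* 0 is added to the set of distances so that the diameter of set0 is 0. *)
Definition diam (A : set (R * R)) : \bar R :=
  ereal_sup (0 |` [set (enorm (xy.1 - xy.2))%:E | xy in A `*` A]).

Definition hausdorff_content (d delta : R) (A : set (R * R)) : \bar R :=
  ereal_inf [set \sum_(k <oo) poweR (diam (F k)) d |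
    F in [set F : nat -> set (R * R) |
      A `<=` \bigcup_k F k /\ forall k, diam (F k) <= delta%:E]].

(* Dimensional constants are omitted: only the normalized restriction of this
   measure is used. It is an outer measure, and a measure on the Borel sets. *)
Definition hausdorff (d : R) (A : set (R * R)) : \bar R :=
  ereal_sup [set hausdorff_content d delta A |
    delta in [set delta : R | (0 < delta)%R]].

Definition normalized_hausdorff (d : R) (K A : set (R * R)) : \bar R :=
  hausdorff d (A `&` K) * (hausdorff d K)^-1.

End HausdorffMeasure.

Section KochSnowflake.
Context {R : realType}.

(* Rotations of angle pi/3, counterclockwise and clockwise. *)
Definition rot60 (v : R * R) : R * R :=
  (2^-1 * v.1 - Num.sqrt 3 / 2 * v.2, Num.sqrt 3 / 2 * v.1 + 2^-1 * v.2).

Definition rotN60 (v : R * R) : R * R :=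
  (2^-1 * v.1 + Num.sqrt 3 / 2 * v.2, - (Num.sqrt 3 / 2) * v.1 + 2^-1 * v.2).

(* The vertices of the n-th polygonal approximation of the Koch curve from a
   to b. At each step the middle third of every edge is replaced by the other
   two sides of an equilateral triangle lying to the right of the edge. *)
Fixpoint koch_vertices (n : nat) (a b : R * R) : set (R * R) :=
  if n is n'.+1 then
    let h := 3^-1 *: (b - a) in
    let p := a + h in
    let q := p + rotN60 h in
    let r := p + h in
    koch_vertices n' a p `|` koch_vertices n' p q `|`
    koch_vertices n' q r `|` koch_vertices n' r b
  else [set a; b].

Definition koch_curve (a b : R * R) : set (R * R) :=
  closure (\bigcup_n koch_vertices n a b).

(* (a, b, apex a b) is the counterclockwise equilateral triangle on the
   edge from a to b: its interior lies to the left of its edges, so the Koch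
   curves built on them point outwards. *)
Definition apex (a b : R * R) : R * R := a + rot60 (b - a).

Definition snowflake_arc (a b : R * R) (i : 'I_3) : set (R * R) :=
  nth set0 [:: koch_curve a b; koch_curve b (apex a b);
               koch_curve (apex a b) a] i.

Definition snowflake (a b : R * R) : set (R * R) :=
  \bigcup_i snowflake_arc a b i.

Definition snowflake_domain (a b : R * R) (Om : set (R * R)) : Prop :=
  [/\ open Om, bounded_set Om, connected Om &
      boundary Om = snowflake a b].

Definition koch_dim : R := ln 4 / ln 3.

Definition snowflake_measure (a b : R * R) (A : set (R * R)) : \bar R :=
  (\sum_(i < 3) normalized_hausdorff koch_dim (snowflake_arc a b i) A)%E.

End KochSnowflake.

(* Elements of W^{s,p}(Om) are represented by functions on the whole plane, of
   which only the restriction to Om, up to almost everywhere equality,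
   matters. *)
Section Sobolev.
Context {R : realType}.
Implicit Types (Om : set (R * R)) (u v : R * R -> R) (s p : R).

Definition gagliardo Om s p u : \bar R :=
  (\int[lebesgue2 \x lebesgue2]_(z in Om `*` Om)
    (`|u z.1 - u z.2| `^ p / enorm (z.1 - z.2) `^ (2 + s * p))%:E)%E.

Definition sobolev Om s p : set (R * R -> R) :=
  [set u : R * R -> R | [/\ measurable_fun (Om : set (mplane R)) u,
    (\int[lebesgue2]_(x in Om) (`|u x| `^ p)%:E < +oo)%E &
    (gagliardo Om s p u < +oo)%E]].

Definition trace Om u (x : R * R) : R :=
  lim ((\int[lebesgue2]_(y in eball x r `&` Om) u y /
        fine (lebesgue2 (eball x r `&` Om))) @[r --> 0^'+]).

Definition le_in Om u v : Prop :=
  {ae lebesgue2, forall x, Om x -> u x <= v x}.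

Definition eq_in Om u v : Prop :=
  {ae lebesgue2, forall x, Om x -> u x = v x}.

Definition admissible Om s p (phi1 phi2 : R * R -> R) : set (R * R -> R) :=
  [set v | [/\ sobolev Om s p v, le_in Om phi1 v & le_in Om v phi2]].

Definition energy Om (mu : set (mplane R) -> \bar R) s p (f b : R * R -> R) v
    : \bar R :=
  (p^-1%:E * gagliardo Om s p v
   - \int[lebesgue2]_(x in Om) (f x * v x)%:E
   + p^-1%:E *
     \int[mu]_(x in boundary Om) (b x * `|trace Om v x| `^ p)%:E)%E.

End Sobolev.

(* Main.v *)
Require Import Defs.
From HB Require Import structures.
From mathcomp Require Import all_boot all_order all_algebra.
From mathcomp Require Import all_classical all_reals all_analysis.
From mathcomp Require Import measurable_realfun.
From mathcomp Require Import ring lra zify.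
Set Implicit Arguments.
Unset Strict Implicit.
Unset Printing Implicit Defensive.
Import Order.TTheory GRing.Theory Num.Theory.
Import numFieldNormedType.Exports.
Local Open Scope classical_set_scope.
Local Open Scope ring_scope.

(** The direct method of the calculus of variations, with uniform convexity in
    place of weak compactness. Since s < 1 and 2 < s p, the exponent p is larger
    than 2, and the inequality of Clarkson

      |(a + b) / 2|^p + |(a - b) / 2|^p <= (|a|^p + |b|^p) / 2

    holds pointwise. Integrating it against the kernel of the seminorm and against
    the boundary measure, with the load being linear, shows that the energy at
    the midpoint of u and v is smaller than the mean of the energies of u and v by
    at least 1 / p times the seminorm plus the boundary term of (u - v) / 2
    ([clarkson_integral], [gagliardo_midpoint], [boundary_midpoint]). Two minimizers
    hence have a difference of zero seminorm and zero boundary term, and a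
    minimizing sequence is a Cauchy sequence for these two quantities.

    What makes this usable is a uniform bound: if the seminorm and the boundary
    term of w are at most rho^p, then the trace of w is at most a constant times
    rho on the closure of the domain ([poincare]). So the traces of a minimizing
    sequence converge uniformly, the load and the boundary term pass to the limit,
    the lemma of Fatou handles the seminorm, and the limit is a minimizer.
    Nothing is lost in working with traces, because a Sobolev function is almost
    everywhere equal to its trace ([trace_ae]).

    The uniform bound comes from a Morrey inequality ([trace_cvg_rho]): the averages
    of w over B(x, r) /\ Om and B(x, r') /\ Om, with r / 2 <= r' <= r, differ by at
    most a constant times rho r^(s - 2 / p), so that they converge, and the limit is
    at a distance from the mean of w at most a constant times rho. The only
    property of the domain that this uses is that Om fills a fixed proportion of
    each small ball centered on its closure ([domain_density]). For the snowflake
    domain each point of the boundary is close to a Koch arc of length comparable to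
    r, and the triangle under the bump of this arc is in Om. Proving that it is in Om
    and not outside requires following the polygonal approximations: outer gaps
    are connected to infinity and the other ones to the center of the snowflake
    ([side_not_domain], [base_domain], [center_domain]).

    The boundary term controls the trace at some point because b is bounded below by
    a positive constant on the boundary, which is compact and of positive finite
    measure. The Hausdorff measure of a Koch arc is finite by
    subdivision, and positive because the natural parametrization has a Hoelder
    continuous inverse ([koch_param_two]). That the normalized restrictions are
    measures on the Borel sets is the criterion of Caratheodory for outer measures
    that add up on separated sets ([hausdorff_separated],
    [hausdorff_caratheodory]). *)

(** * Borel sets are measurable for the Hausdorff measure *)

Section SeparatedOuterMeasure.
Context {R : realType} (T : Type) (mu : {outer_measure set T -> \bar R}).
Variable g : T -> R.
Hypothesis mu_sep : forall (X Y : set T) (e : R), 0 < e ->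
  (forall x y, X x -> Y y -> g x + e <= g y) ->
  (mu X + mu Y <= mu (X `|` Y))%E.

Section Strips.
Variables (c : R) (X : set T).

Let h (n : nat) : R := c + n.+1%:R^-1.

Let hS n : h n.+1 < h n.
Proof. by rewrite /h ltrD2l ltf_pV2 ?posrE ?ltr0n// ltr_nat. Qed.

Let h_le m n : (m <= n)%N -> h n <= h m.
Proof. by move=> mn; rewrite /h lerD2l lef_pV2 ?posrE ?ltr0n// ler_nat ltnS. Qed.

Let strip (n : nat) := X `&` [set x | h n.+1 <= g x < h n].

Let sum_strips e n :
  (\sum_(j < n) mu (strip (j.*2 + e)) <=
   mu (\big[setU/set0]_(j < n) strip (j.*2 + e)))%E.
Proof.
elim: n => [|n IHn]; first by rewrite !big_ord0 outer_measure0.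
rewrite !big_ord_recr/= (le_trans (leeD2r _ IHn))// addeC setUC.
case: n {IHn} => [|n]; first by rewrite !big_ord0 outer_measure0 adde0 setU0.
apply: (@mu_sep _ _ (h (n.*2 + e).+1 - h (n.+1.*2 + e))).
  by rewrite subr_gt0 addSn; exact: hS.
move=> x y [_ /= /andP[_ xh]].
rewrite -(bigcup_mkord _ (fun j => strip (j.*2 + e))).
move=> [j /= jn [_ /= /andP[hy _]]].
have /h_le : ((j.*2 + e).+1 <= (n.*2 + e).+1)%N by lia.
by move: xh hy; lra.
Qed.

Let sum_strips_le n : (\sum_(j < n) mu (strip j) <= mu X + mu X)%E.
Proof.
have le_muX e m : (\sum_(j < m) mu (strip (j.*2 + e)) <= mu X)%E.
  apply: le_trans (sum_strips e m) _; apply: le_outer_measure.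
  by rewrite -(bigcup_mkord _ (fun j => strip (j.*2 + e))) => x [j _ []].
apply: (@le_trans _ _ (\sum_(j < n.*2) mu (strip j))%E).
  rewrite -!(big_mkord xpredT (fun j => mu (strip j))).
  by apply: lee_sum_nneg_natr; [move=> *; exact: outer_measure_ge0|lia].
apply: le_trans (leeD (le_muX 0%N n) (le_muX 1%N n)).
rewrite -big_split/=; elim: n => [|n IHn]; first by rewrite !big_ord0.
by rewrite doubleS !big_ord_recr/= addn0 addn1 -addeA leeD2r.
Qed.

(** Between the levels h n of g the set X is cut into strips accumulating at the
    level c. Two strips of the same parity are separated, so the measures of the
    strips have a finite sum; its tails tend to 0, and they bound the measure of
    the part of X just above the level c, whose removal separates the rest of
    that side from the other side. *)
Lemma le_caratheodory_separated :
  (mu (X `&` [set x | (c < g x)%R]) + mu (X `&` ~` [set x | (c < g x)%R]) <= mu X)%E.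
Proof.
have [->|muX] := eqVneq (mu X) +oo%E; first by rewrite leey.
set P := X `&` _; set Q := X `&` _.
pose tail n := (\sum_(n <= k <oo) mu (strip k))%E.
have tail0 : tail @ \oo --> 0%E.
  apply: nneseries_tail_cvg => //.
    apply: (@le_lt_trans _ _ (mu X + mu X)%E).
      apply: lime_le; first by apply: is_cvg_nneseries => *; exact: outer_measure_ge0.
      by apply: nearW => n; rewrite big_mkord.
    by rewrite lte_add_pinfty// ltey.
  by move=> *; exact: outer_measure_ge0.
have PQ n : (mu P + mu Q <= mu X + tail n)%E.
  pose Pn := X `&` [set x | h n <= g x].
  have P_sub : P `<=` Pn `|` \bigcup_(k in ~` `I_n) strip k.
    move=> x [Xx /= cx]; have [hx|xh] := leP (h n) (g x); first by left.
    right; have [k Pk] : exists k, (n <= k)%N && (h k.+1 <= g x).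
      exists (maxn n (Num.truncn (g x - c)^-1)).
      have gc : 0 < g x - c by rewrite subr_gt0.
      rewrite leq_maxl/= /h -lerBrDl -[leRHS]invrK lef_pV2 ?posrE ?invr_gt0 ?ltr0n//.
      apply: le_trans (ltW (truncnS_gt _)) _.
      by rewrite ler_nat; move: (Num.trunc _) => t; lia.
    have ex : exists k, (n <= k)%N && (h k.+1 <= g x) by exists k.
    case: (ex_minnP ex) => {Pk ex}k /andP[nk hk] kmin; exists k.
      by move=> /=; lia.
    split => //=; rewrite hk/=; case: k => [|k] in nk hk kmin *.
      by move: nk xh; rewrite leqn0 => /eqP ->.
    rewrite ltNge; apply/negP => hk1; case: (leqP n k) => nk'.
        by have := kmin k; rewrite nk' hk1 ltnn => /(_ isT).
    have nE : n = k.+1 by lia.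
    by move: xh; rewrite nE ltNge hk1.
  have := le_outer_measure mu _ _ P_sub.
  move=> /le_trans/(_ (outer_measureU2 mu _ _)) muP.
  apply: (le_trans (leeD2r _ muP)).
  rewrite addeAC; apply: leeD; last exact: outer_measure_sigma_subadditive_tail.
  rewrite addeC; apply: (@le_trans _ _ (mu (Q `|` Pn))).
    apply: (@mu_sep _ _ n.+1%:R^-1); first by rewrite invr_gt0 ltr0n.
    move=> x y [_ /= /negP]; rewrite -leNgt => xc [_ /= hy].
    by apply: le_trans hy; rewrite /h lerD2r.
  by apply: le_outer_measure => x [] [].
have : (fun n => mu X + tail n)%E @ \oo --> (mu X + 0)%E.
  by apply: cvgeD => //; [rewrite fin_num_adde_defl|exact: cvg_cst].
rewrite adde0 => /cvg_lim <-//; apply: lime_ge; last exact: nearW.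
apply/cvg_ex; exists (mu X + 0)%E.
by apply: cvgeD => //; [rewrite fin_num_adde_defl|exact: cvg_cst].
Qed.

End Strips.

Lemma caratheodory_separated c : mu.-caratheodory [set x | c < g x].
Proof. by apply: le_caratheodory_measurable => X; exact: le_caratheodory_separated. Qed.

End SeparatedOuterMeasure.

Section EuclideanNorm.
Context {R : realType}.
Implicit Types x y z : R * R.

Lemma enorm_ge0 x : 0 <= enorm x.
Proof. exact: sqrtr_ge0. Qed.

Lemma enorm0 : enorm (0 : R * R) = 0.
Proof. by rewrite /enorm /= expr0n addr0 sqrtr0. Qed.

Lemma enormN x : enorm (- x) = enorm x.
Proof. by rewrite /enorm /= !sqrrN. Qed.

Lemma enormC x y : enorm (x - y) = enorm (y - x).
Proof. by rewrite -enormN opprB. Qed.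

Lemma sqr_enorm x : enorm x ^+ 2 = x.1 ^+ 2 + x.2 ^+ 2.
Proof. by rewrite sqr_sqrtr// addr_ge0// sqr_ge0. Qed.

Lemma enorm_le x (r : R) : 0 <= r -> (enorm x <= r) = (x.1 ^+ 2 + x.2 ^+ 2 <= r ^+ 2).
Proof. by move=> r0; rewrite -(@ler_pXn2r _ 2)// ?nnegrE ?enorm_ge0// sqr_enorm. Qed.

Lemma le_enorm1 x : `|x.1| <= enorm x.
Proof. by rewrite -sqrtr_sqr ler_wsqrtr// lerDl sqr_ge0. Qed.

Lemma le_enorm2 x : `|x.2| <= enorm x.
Proof. by rewrite -sqrtr_sqr ler_wsqrtr// lerDr sqr_ge0. Qed.

Lemma enorm_le_sum x : enorm x <= `|x.1| + `|x.2|.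
Proof.
rewrite enorm_le ?addr_ge0// sqrrD !real_normK ?num_real// lerD2r lerDl.
by rewrite mulrn_wge0// mulr_ge0.
Qed.

Lemma ler_enormD x y : enorm (x + y) <= enorm x + enorm y.
Proof.
rewrite enorm_le ?addr_ge0 ?enorm_ge0// [in leRHS]sqrrD !sqr_enorm /=.
(* The Cauchy-Schwarz inequality, by the identity of Lagrange. *)
suff : x.1 * y.1 + x.2 * y.2 <= enorm x * enorm y by lra.
apply: le_trans (ler_norm _) _; rewrite -(@ler_pXn2r _ 2)// ?nnegrE ?normr_ge0 ?mulr_ge0 ?enorm_ge0//.
rewrite real_normK ?num_real// exprMn !sqr_enorm -subr_ge0.
have -> : (x.1 ^+ 2 + x.2 ^+ 2) * (y.1 ^+ 2 + y.2 ^+ 2) -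
  (x.1 * y.1 + x.2 * y.2) ^+ 2 = (x.1 * y.2 - x.2 * y.1) ^+ 2 by ring.
exact: sqr_ge0.
Qed.

Lemma enormB_triangle y x z : enorm (x - z) <= enorm (x - y) + enorm (y - z).
Proof. by rewrite -[in leLHS](subrK y x) -addrA ler_enormD. Qed.

Lemma enorm_eq0 x : (enorm x == 0) = (x == 0).
Proof.
rewrite sqrtr_eq0; case: x => x1 x2 /=; apply/idP/eqP => [|[-> ->]].
  rewrite le_eqVlt ltNge addr_ge0 ?sqr_ge0//= orbF paddr_eq0 ?sqr_ge0//.
  by rewrite !sqrf_eq0 => /andP[/eqP -> /eqP ->].
by rewrite expr0n addr0.
Qed.

Lemma enormZ (k : R) x : enorm (k *: x) = `|k| * enorm x.
Proof.
have -> : k *: x = (k * x.1, k * x.2) by case: x.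
by rewrite /enorm /= !exprMn -mulrDr sqrtrM ?sqr_ge0// sqrtr_sqr.
Qed.

End EuclideanNorm.

Section Hausdorff.
Context {R : realType}.
Implicit Types (A B F K : set (R * R)) (d delta : R).
Local Open Scope ereal_scope.

Lemma diam_ge0 A : 0 <= diam A.
Proof. by apply: ereal_sup_ubound; left. Qed.

Lemma le_diam A B : A `<=` B -> diam A <= diam B.
Proof.
move=> AB; apply: ereal_sup_le => _ [->|[[x y] [Ax Ay] <-]]; first by left.
by right; exists (x, y) => //; split; exact: AB.
Qed.

Lemma diam0 : diam (set0 : set (R * R)) = 0.
Proof.
apply/eqP; rewrite eq_le diam_ge0 andbT; apply: ge_ereal_sup.
by move=> _ [->|[x [[]]]].
Qed.

Lemma enorm_le_diam A x y : A x -> A y -> (enorm (x - y))%:E <= diam A.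
Proof. by move=> Ax Ay; apply: ereal_sup_ubound; right; exists (x, y). Qed.

Lemma diam_le A (r : R) : (0 <= r)%R ->
  (forall x y, A x -> A y -> (enorm (x - y) <= r)%R) -> diam A <= r%:E.
Proof.
move=> r0 Ar; apply: ge_ereal_sup => _ [->|[[x y] [/= Ax Ay] <-]].
  by rewrite lee_fin.
by rewrite lee_fin; exact: Ar.
Qed.

(** Giving infinite weight to the sets of diameter larger than delta turns the
    Hausdorff content into the outer measure generated by a set function, hence
    its countable subadditivity. *)
Let weight d delta F : \bar R :=
  if diam F <= delta%:E then poweR (diam F) d else +oo.

Let weight_ge0 d delta F : 0 <= weight d delta F.
Proof. by rewrite /weight; case: ifP => // _; exact: poweR_ge0. Qed.

Let weight0 d delta : (0 < d)%R -> (0 < delta)%R -> weight d delta set0 = 0.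
Proof.
by move=> d0 delta0; rewrite /weight diam0 lee_fin ltW// poweR0r// gt_eqF.
Qed.

Let discrete := g_sigma_algebraType [set: set (R * R)].

Let hausdorff_contentE d delta A : (0 < d)%R ->
  hausdorff_content d delta A = mu_ext (weight d delta : set discrete -> _) A.
Proof.
move=> d0; apply/eqP; rewrite eq_le; apply/andP; split.
  apply: le_ereal_inf_tmp => _ [F [_ AF] <-].
  have [Fdelta|/existsNP[k /negP]] := pselect (forall k, diam (F k) <= delta%:E).
    apply: ereal_inf_lbound; exists F => //.
    by apply: eq_eseriesr => k _; rewrite /weight Fdelta.
  move=> /negbTE Fk; rewrite (@eseries_pinfty _ (fun k => weight d delta (F k)) _ k)//.
  - exact: leey.
  - by move=> n _; rewrite -ltNye; exact: lt_le_trans (weight_ge0 _ _ _).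
  - by rewrite /weight Fk.
apply: le_ereal_inf_tmp => _ [F [AF Fdelta] <-].
apply: ereal_inf_lbound; exists F.
  by split => // k; exact: sub_sigma_algebra.
by apply: eq_eseriesr => k _; rewrite /weight Fdelta.
Qed.

Let hausdorff_content_ge0 d delta A : (0 < d)%R -> 0 <= hausdorff_content d delta A.
Proof. by move=> d0; rewrite hausdorff_contentE//; exact: mu_ext_ge0. Qed.

Let le_hausdorff_content_delta d delta delta' A : (delta <= delta')%R ->
  hausdorff_content d delta' A <= hausdorff_content d delta A.
Proof.
move=> dd'; apply: ereal_inf_le_tmp => _ [F [AF Fd] <-]; exists F => //.
by split=> // k; apply: le_trans (Fd k) _; rewrite lee_fin.
Qed.

Let hausdorff_content_le d delta A : (0 < delta)%R ->
  hausdorff_content d delta A <= hausdorff d A.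
Proof. by move=> delta0; apply: ereal_sup_ubound; exists delta. Qed.

Let hausdorff_content0 d delta : (0 < d)%R -> (0 < delta)%R ->
  hausdorff_content d delta set0 = 0 :> \bar R.
Proof. by move=> d0 delta0; rewrite hausdorff_contentE// mu_ext0// weight0. Qed.

Let le_hausdorff_content d delta :
  {homo @hausdorff_content R d delta : A B / A `<=` B >-> A <= B}.
Proof.
move=> A B AB; apply: ereal_inf_le_tmp => _ [F [BF Fd] <-]; exists F => //.
by split => //; exact: subset_trans BF.
Qed.

Let hausdorff_content_sigma_subadditive d delta : (0 < d)%R -> (0 < delta)%R ->
  sigma_subadditive (@hausdorff_content R d delta).
Proof.
move=> d0 delta0 F; rewrite hausdorff_contentE//.
apply: le_trans (mu_ext_sigma_subadditive _ _) _ => //.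
by under eq_eseriesr do rewrite -hausdorff_contentE//.
Qed.

Lemma hausdorff_contentU d delta A B : (0 < d)%R -> (0 < delta)%R ->
  hausdorff_content d delta (A `|` B) <=
  hausdorff_content d delta A + hausdorff_content d delta B.
Proof.
move=> d0 delta0; pose m : {outer_measure set (R * R) -> \bar R} :=
  HB.pack (@hausdorff_content R d delta)
    (isOuterMeasure.Build R (R * R)%type (@hausdorff_content R d delta)
      (hausdorff_content0 d0 delta0) (fun A => hausdorff_content_ge0 delta A d0)
      (@le_hausdorff_content d delta)
      (hausdorff_content_sigma_subadditive d0 delta0)).
exact: (outer_measureU2 m).
Qed.

Lemma hausdorff_content_le_diam d delta A : (0 < d)%R -> diam A <= delta%:E ->
  hausdorff_content d delta A <= poweR (diam A) d.
Proof.
move=> d0 Adelta.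
have pow0 : poweR (diam (set0 : set (R * R))) d = 0.
  by rewrite diam0 poweR0r// gt_eqF.
apply: ereal_inf_lbound; exists (fun k => if k is 0%N then A else set0).
  split; first by move=> x Ax; exists 0%N.
  by case=> //= k; rewrite diam0; apply: le_trans Adelta; exact: diam_ge0.
rewrite nneseries_recl//=; last by move=> *; exact: poweR_ge0.
rewrite -[RHS]adde0; congr (_ + _).
by rewrite eseries_cond/= eseries0// => -[|k] _ _ //; rewrite pow0.
Qed.

Let hausdorff_ge0 d A : (0 < d)%R -> 0 <= hausdorff d A.
Proof.
move=> d0; apply: le_trans (hausdorff_content_le d A (@ltr01 R)).
exact: hausdorff_content_ge0.
Qed.

Let hausdorff0 d : (0 < d)%R -> hausdorff d set0 = 0 :> \bar R.
Proof.
move=> d0; apply/eqP; rewrite eq_le hausdorff_ge0// andbT.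
apply: ge_ereal_sup => _ [delta /= delta0 <-].
by rewrite hausdorff_content0.
Qed.

Let le_hausdorff d : {homo @hausdorff R d : A B / A `<=` B >-> A <= B}.
Proof.
move=> A B AB; apply: ge_ereal_sup => _ [delta /= delta0 <-].
apply: le_trans (hausdorff_content_le d B delta0).
exact: le_hausdorff_content.
Qed.

Let hausdorff_sigma_subadditive d : (0 < d)%R -> sigma_subadditive (@hausdorff R d).
Proof.
move=> d0 F; apply: ge_ereal_sup => _ [delta /= delta0 <-].
apply: le_trans (hausdorff_content_sigma_subadditive d0 delta0 F) _.
apply: lee_nneseries => [n _ _|n _]; first exact: hausdorff_content_ge0.
exact: hausdorff_content_le.
Qed.

Definition hausdorff_outer d (d0 : (0 < d)%R) : {outer_measure set (R * R) -> \bar R} :=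
  HB.pack (@hausdorff R d)
    (isOuterMeasure.Build R (R * R)%type (@hausdorff R d) (hausdorff0 d0)
      (fun A => hausdorff_ge0 A d0) (@le_hausdorff d)
      (hausdorff_sigma_subadditive d0)).

(** Sets of diameter smaller than the distance from A to B meet at most one
    of them, so a fine cover of the union splits into a cover of each. *)
Lemma hausdorff_separated d A B (e : R) : (0 < d)%R -> (0 < e)%R ->
  (forall x y, A x -> B y -> (e <= enorm (x - y))%R) ->
  hausdorff d A + hausdorff d B <= hausdorff d (A `|` B).
Proof.
move=> d0 e0 ABe.
have split delta : (delta < e)%R -> hausdorff_content d delta A +
    hausdorff_content d delta B <= hausdorff_content d delta (A `|` B).
  move=> delta_e; apply: le_ereal_inf_tmp => _ [F [ABF Fd] <-].
  pose FA k := F k `&` A; pose FB k := F k `&` B.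
  have subF C : C `<=` A `|` B -> hausdorff_content d delta C <=
      \sum_(k <oo) poweR (diam (F k `&` C)) d.
    move=> CAB; apply: ereal_inf_lbound; exists (fun k => F k `&` C) => //; split.
      by move=> x Cx; have [k _ Fkx] := ABF x (CAB x Cx); exists k.
    by move=> k; apply: le_trans (Fd k); apply: le_diam; exact: subIsetl.
  apply: le_trans (leeD (subF A _) (subF B _)) _ => //.
  rewrite -nneseriesD; try by move=> *; exact: poweR_ge0.
  apply: lee_nneseries => k _; first by rewrite adde_ge0// poweR_ge0.
  have lepow C : poweR (diam (F k `&` C)) d <= poweR (diam (F k)) d.
    apply: gt0_ler_poweR; first exact: ltW.
    - by rewrite in_itv/= diam_ge0 leey.
    - by rewrite in_itv/= diam_ge0 leey.
    - by apply: le_diam; exact: subIsetl.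
  have pow0 : poweR (diam (set0 : set (R * R))) d = 0.
    by rewrite diam0 poweR0r// gt_eqF.
  have [->|/set0P[x [Fx Ax]]] := eqVneq (F k `&` A) set0; first by rewrite pow0 add0e.
  have [->|/set0P[y [Fy By]]] := eqVneq (F k `&` B) set0; first by rewrite pow0 adde0.
  have := le_trans (enorm_le_diam Fx Fy) (Fd k).
  by rewrite lee_fin leNgt (lt_le_trans delta_e)// ABe.
have [->|ABoo] := eqVneq (hausdorff d (A `|` B)) +oo; first by rewrite leey.
have fin C : C `<=` A `|` B -> hausdorff d C \is a fin_num.
  move=> CAB; rewrite ge0_fin_numE ?hausdorff_ge0//.
  by apply: le_lt_trans (@le_hausdorff d _ _ CAB) _; rewrite ltey.
have finA : hausdorff d A \is a fin_num by exact: fin.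
have finB : hausdorff d B \is a fin_num by exact: fin.
rewrite -leeBrDr//; apply: ge_ereal_sup => _ [dA /= dA0 <-].
rewrite leeBrDr// addeC -leeBrDr; last first.
  rewrite ge0_fin_numE ?hausdorff_content_ge0//.
  by apply: le_lt_trans (hausdorff_content_le _ _ dA0) _; rewrite ltey_eq finA.
apply: ge_ereal_sup => _ [dB /= dB0 <-].
rewrite leeBrDr; last first.
  rewrite ge0_fin_numE ?hausdorff_content_ge0//.
  by apply: le_lt_trans (hausdorff_content_le _ _ dA0) _; rewrite ltey_eq finA.
(* Contents increase when delta decreases, so one scale serves both sets. *)
pose delta := Num.min (Num.min dA dB) (e / 2)%R.
have delta0 : (0 < delta)%R by rewrite !lt_min dA0 dB0 divr_gt0.
apply: le_trans (hausdorff_content_le _ _ delta0).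
rewrite addeC; apply: le_trans (split delta _).
  by apply: leeD; apply: le_hausdorff_content_delta; rewrite /delta !ge_min lexx ?orbT.
by rewrite /delta gt_min ltr_pdivrMr// ltr_pMr// ltr1n orbT.
Qed.

(** The coordinates are 1-Lipschitz, hence points on the two sides of a strip are
    separated and half-planes are measurable; they generate the product
    sigma-algebra. *)
Lemma hausdorff_caratheodory d (d0 : (0 < d)%R) (A : set (mplane R)) :
  measurable A -> (hausdorff_outer d0).-caratheodory A.
Proof.
have half (g : R * R -> R) : (forall x y, (`|g x - g y| <= enorm (x - y))%R) -> forall c,
    (hausdorff_outer d0).-caratheodory [set x | (c < g x)%R].
  move=> g_lip; apply: caratheodory_separated => X Y e e0 XYe.
  apply: (hausdorff_separated d0 e0) => x y Xx Yy.
  apply: le_trans (g_lip x y); rewrite distrC (le_trans _ (ler_norm _))//.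
  by rewrite lerBrDl; exact: XYe.
have preim (g : R * R -> R) : (forall x y, (`|g x - g y| <= enorm (x - y))%R) ->
    forall C : set (measurableTypeR R), measurable C ->
    (hausdorff_outer d0).-caratheodory (g @^-1` C).
  move=> g_lip.
  have -> : (measurable : set (set (measurableTypeR R))) =
      <<s @measurable_realfun.RGenOInfty.G R >>.
    exact: measurable_realfun.RGenOInfty.measurableE.
  apply: smallest_sub => [|_ [c ->]]; last by rewrite set_itvE; exact: half.
  split => [|C mC|F mF].
  - rewrite /mkset preimage_set0.
    exact: caratheodory_measurable_set0.
  - rewrite /mkset setTD preimage_setC.
    exact: caratheodory_measurable_setC.
  - rewrite /mkset preimage_bigcup.
    exact: caratheodory_measurable_bigcup.
apply: smallest_sub.
  split.
  - exact: caratheodory_measurable_set0.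
  - move=> B mB.
    rewrite setTD.
    exact: caratheodory_measurable_setC.
  - move=> F mF.
    exact: caratheodory_measurable_bigcup.
move=> B [|] [C mC <-]; rewrite setTI; apply: preim => // x y.
  exact: (le_enorm1 (x - y)%R).
exact: (le_enorm2 (x - y)%R).
Qed.

Lemma normalized_hausdorff_sigma_additive d K : (0 < d)%R -> hausdorff d K != 0 ->
  semi_sigma_additive (normalized_hausdorff d K : set (mplane R) -> \bar R).
Proof.
move=> d0 K0 F mF tF _.
(* The inverse of +oo is 0, so the normalizing factor is finite in any case. *)
have [c cE] : exists c : R, (hausdorff d K)^-1 = c%:E.
  have : 0 <= hausdorff d K := hausdorff_ge0 K d0.
  by case: inveP K0 => [|||r]; [rewrite eqxx|exists 0%R|rewrite leeNy_eq|exists r^-1%R].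
have m0 B : 0 <= hausdorff d (B `&` K) := hausdorff_ge0 _ d0.
have HE : hausdorff d (\bigcup_n F n `&` K) = \sum_(n <oo) hausdorff d (F n `&` K).
  apply/eqP; rewrite eq_le; apply/andP; split.
    by rewrite setI_bigcupl; exact: (outer_measure_sigma_subadditive (hausdorff_outer d0)).
  have := @caratheodory_lime_le _ _ (hausdorff_outer d0) F
    (fun n => hausdorff_caratheodory d0 (mF n)) tF (\bigcup_n F n `&` K).
  rewrite [X in _ + X](_ : _ = 0); last first.
    rewrite (_ : _ `&` _ = set0) ?outer_measure0// -subset0.
    by move=> x [[]].
  rewrite adde0; apply: le_trans; apply: lee_nneseries => [n _ _|n _]; first exact: m0.
  by apply: le_hausdorff => x [Fx Kx]; split => //; split => //; exists n.
have nE B : normalized_hausdorff d K B = c%:E * hausdorff d (B `&` K).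
  by rewrite /normalized_hausdorff cE muleC.
rewrite nE HE; under eq_cvg do under eq_bigr do rewrite nE.
have c0 : (0 <= c)%R by rewrite -lee_fin -cE inve_ge0 hausdorff_ge0.
rewrite -nneseriesZl//; apply: is_cvg_nneseries => n _ _.
by rewrite mule_ge0.
Qed.

Lemma normalized_hausdorff_ge0 d K A : (0 < d)%R -> 0 <= normalized_hausdorff d K A.
Proof. by move=> d0; rewrite mule_ge0 ?inve_ge0 ?hausdorff_ge0. Qed.

Lemma normalized_hausdorff0 d K : (0 < d)%R -> normalized_hausdorff d K set0 = 0.
Proof. by move=> d0; rewrite /normalized_hausdorff set0I hausdorff0 ?mul0e. Qed.

Lemma normalized_hausdorff_self d K A : (0 < d)%R -> K `<=` A ->
  hausdorff d K != 0 -> (hausdorff d K < +oo)%E -> normalized_hausdorff d K A = 1.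
Proof.
move=> d0 KA K0 Koo; rewrite /normalized_hausdorff (setIidr KA) divee//.
by rewrite ge0_fin_numE ?hausdorff_ge0.
Qed.

End Hausdorff.

(** * Lattice coordinates *)

Section KochCurve.
Context {R : realType}.
Implicit Types (u v z : R * R) (e : (R * R) * (R * R)) (c : R * R) (i : nat).

Lemma scale_fst (k : R) z : (k *: z).1 = k * z.1. Proof. by []. Qed.
Lemma scale_snd (k : R) z : (k *: z).2 = k * z.2. Proof. by []. Qed.

Lemma add_fst u v : (u + v).1 = u.1 + v.1. Proof. by []. Qed.
Lemma add_snd u v : (u + v).2 = u.2 + v.2. Proof. by []. Qed.
Lemma opp_fst u : (- u).1 = - u.1. Proof. by []. Qed.
Lemma opp_snd u : (- u).2 = - u.2. Proof. by []. Qed.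
Lemma rotN60_fst u : (rotN60 u).1 = 2^-1 * u.1 + Num.sqrt 3 / 2 * u.2.
Proof. by []. Qed.
Lemma rotN60_snd u : (rotN60 u).2 = - (Num.sqrt 3 / 2) * u.1 + 2^-1 * u.2.
Proof. by []. Qed.
Definition planeE := (add_fst, add_snd, opp_fst, opp_snd, scale_fst, scale_snd).

Lemma plane_ext z z' : z.1 = z'.1 -> z.2 = z'.2 -> z = z'.
Proof. by case: z z' => ? ? [? ?] /= -> ->. Qed.

Lemma sqr_sqrt3 : (Num.sqrt 3 / 2 : R) ^+ 2 = 3 / 4.
Proof. by rewrite expr_div_n sqr_sqrtr; [field|lra]. Qed.

Lemma rotN60B u v : rotN60 (u - v) = rotN60 u - rotN60 v.
Proof. by apply: plane_ext; rewrite /rotN60 /=; ring. Qed.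

Lemma rotN60Z (k : R) u : rotN60 (k *: u) = k *: rotN60 u.
Proof. by apply: plane_ext; rewrite !(planeE, rotN60_fst, rotN60_snd); ring. Qed.

Lemma rotN60_rotN60 u : rotN60 (rotN60 u) = rotN60 u - u.
Proof.
apply: plane_ext; rewrite /rotN60 /=; move: sqr_sqrt3;
  move: (Num.sqrt 3 / 2) => t t2.
- have -> : 2^-1 * (2^-1 * u.1 + t * u.2) + t * (- t * u.1 + 2^-1 * u.2) =
    4^-1 * u.1 - t ^+ 2 * u.1 + t * u.2 by field.
  by rewrite t2; field.
- have -> : - t * (2^-1 * u.1 + t * u.2) + 2^-1 * (- t * u.1 + 2^-1 * u.2) =
    4^-1 * u.2 - t ^+ 2 * u.2 - t * u.1 by field.
  by rewrite t2; field.
Qed.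

Lemma rot60E u : rot60 u = u - rotN60 u.
Proof. by apply: plane_ext; rewrite /rot60 /rotN60 /=; field. Qed.

(** Coordinates in the basis (u, rotN60 u), where u is the vector of the edge:
    the vertices of the triangular lattice have integral coordinates, and the
    squared Euclidean norm becomes a rational quadratic form. *)
Definition frame e c : R * R :=
  e.1 + c.1 *: (e.2 - e.1) + c.2 *: rotN60 (e.2 - e.1).

Definition elen e : R := enorm (e.2 - e.1).

Lemma elen_ge0 e : 0 <= elen e. Proof. exact: enorm_ge0. Qed.

Definition qform c : R := c.1 ^+ 2 + c.1 * c.2 + c.2 ^+ 2.

Lemma qform_ge0 c : 0 <= qform c.
Proof. by rewrite /qform; nra. Qed.

Lemma qform_ge_fst c : 3 / 4 * c.1 ^+ 2 <= qform c.
Proof. by rewrite -subr_ge0 /qform; have := sqr_ge0 (c.1 / 2 + c.2); lra. Qed.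

Lemma qform_ge_snd c : 3 / 4 * c.2 ^+ 2 <= qform c.
Proof. by rewrite -subr_ge0 /qform; have := sqr_ge0 (c.1 + c.2 / 2); lra. Qed.

Lemma qform_eq0 c : qform c = 0 -> c = 0.
Proof.
move=> c0; have := qform_ge_fst c; have := qform_ge_snd c; rewrite c0.
have := sqr_ge0 c.1; have := sqr_ge0 c.2 => p1 p2 q1 q2.
by apply: plane_ext; apply/eqP; rewrite -sqrf_eq0; apply/eqP; lra.
Qed.

Lemma sqr_enorm_frame e c c' :
  enorm (frame e c - frame e c') ^+ 2 = elen e ^+ 2 * qform (c - c').
Proof.
rewrite !sqr_enorm /frame /qform; move: (e.2 - e.1) => u.
rewrite !(planeE, rotN60_fst, rotN60_snd); move: sqr_sqrt3.
move: (Num.sqrt 3 / 2) => t t2.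
set x := c.1; set y := c.2; set x' := c'.1; set y' := c'.2.
have -> : (e.1.1 + x * u.1 + y * (2^-1 * u.1 + t * u.2) -
 (e.1.1 + x' * u.1 + y' * (2^-1 * u.1 + t * u.2))) ^+ 2 +
 (e.1.2 + x * u.2 + y * (- t * u.1 + 2^-1 * u.2) -
 (e.1.2 + x' * u.2 + y' * (- t * u.1 + 2^-1 * u.2))) ^+ 2 =
 (u.1 ^+ 2 + u.2 ^+ 2) * ((x - x') ^+ 2 + (x - x') * (y - y') +
   (4^-1 + t ^+ 2) * (y - y') ^+ 2) by field.
by rewrite t2; field.
Qed.

Lemma enorm_frame e c c' :
  enorm (frame e c - frame e c') = elen e * Num.sqrt (qform (c - c')).
Proof.
apply/eqP; rewrite -(@eqrXn2 _ 2)// ?enorm_ge0 ?mulr_ge0 ?enorm_ge0 ?sqrtr_ge0//.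
by rewrite sqr_enorm_frame exprMn (sqr_sqrtr (qform_ge0 _)).
Qed.

Lemma enorm_frame_le e c c' (k : R) : 0 <= k -> qform (c - c') <= k ^+ 2 ->
  enorm (frame e c - frame e c') <= elen e * k.
Proof.
move=> k0 ck; rewrite enorm_frame ler_wpM2l ?enorm_ge0// -(ger0_norm k0).
by rewrite -sqrtr_sqr ler_wsqrtr.
Qed.

Lemma enorm_frame_ge e c c' (k : R) : 0 <= k -> k ^+ 2 <= qform (c - c') ->
  elen e * k <= enorm (frame e c - frame e c').
Proof.
move=> k0 ck; rewrite enorm_frame ler_wpM2l ?enorm_ge0// -{1}(ger0_norm k0).
by rewrite -sqrtr_sqr ler_wsqrtr.
Qed.

Lemma frame_inj e c c' : elen e != 0 -> frame e c = frame e c' -> c = c'.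
Proof.
move=> e0 cc'; have /esym/eqP := sqr_enorm_frame e c c'.
rewrite cc' subrr enorm0 expr0n mulf_eq0 sqrf_eq0 (negbTE e0)/=.
by move=> /eqP/qform_eq0/eqP; rewrite subr_eq0 => /eqP.
Qed.

Lemma frame_surj e z : elen e != 0 -> exists c, z = frame e c.
Proof.
move=> e0; have := sqr_enorm (e.2 - e.1); move: e0; rewrite -sqrf_eq0 -/(elen e).
rewrite /frame; move: (e.2 - e.1) (elen e ^+ 2) => u l l0 lE.
move: (sqr_sqrt3); rewrite /rotN60; set t := Num.sqrt 3 / 2 => t2.
have t0 : t != 0 by apply/eqP => t0; move: t2; rewrite t0; lra.
set w1 := 2^-1 * u.1 + t * u.2; set w2 := - t * u.1 + 2^-1 * u.2.
have detE : u.1 * w2 - u.2 * w1 = - t * l by rewrite lE /w1 /w2; ring.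
have d0 : u.1 * w2 - u.2 * w1 != 0 by rewrite detE mulf_neq0// oppr_eq0.
pose v := z - e.1.
exists ((v.1 * w2 - v.2 * w1) / (u.1 * w2 - u.2 * w1),
        (u.1 * v.2 - u.2 * v.1) / (u.1 * w2 - u.2 * w1)).
apply: plane_ext; rewrite !planeE /=.
  have -> : z.1 = e.1.1 + v.1 by rewrite /v /=; ring.
  by field.
have -> : z.2 = e.1.2 + v.2 by rewrite /v /=; ring.
by field.
Qed.

(** All indices from 3 on stand for the last child, which spares a bound on i. *)
Definition koch_child i e : (R * R) * (R * R) :=
  let h := 3^-1 *: (e.2 - e.1) in
  let p := e.1 + h in
  let q := p + rotN60 h in
  let r := p + h in
  match i with
  | 0%N => (e.1, p) | 1%N => (p, q) | 2%N => (q, r) | _ => (r, e.2)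
  end.

Definition child_coord i c : R * R :=
  match i with
  | 0%N => (c.1 / 3, c.2 / 3)
  | 1%N => ((1 - c.2) / 3, (c.1 + c.2) / 3)
  | 2%N => ((1 + c.1 + c.2) / 3, (1 - c.1) / 3)
  | _ => ((2 + c.1) / 3, c.2 / 3)
  end.

Lemma koch_child_vec i e : let u := e.2 - e.1 in
  (koch_child i e).2 - (koch_child i e).1 =
  3^-1 *: match i with 1%N => rotN60 u | 2%N => u - rotN60 u | _ => u end.
Proof.
case: i => [|[|[|i]]] /=; rewrite ?rotN60Z; apply: plane_ext;
  rewrite !planeE; move: (rotN60 (e.2 - e.1)) => w; by field.
Qed.

Lemma frame_child i e c : frame (koch_child i e) c = frame e (child_coord i c).
Proof.
rewrite {1}/frame koch_child_vec /= rotN60Z /frame.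
case: i => [|[|[|i]]] /=; move: (e.2 - e.1) => u;
  rewrite ?rotN60Z ?rotN60B ?rotN60_rotN60; move: (rotN60 u) => w; apply: plane_ext;
  rewrite !planeE /= ?planeE; by field.
Qed.

(** The points with coordinates (1, 0) and (0, 1) are at the same distance from
    the origin of the frame. *)
Lemma enorm_rotN60 u : enorm (rotN60 u) = enorm u.
Proof.
have := @sqr_enorm_frame (0, u) (0, 1) (0, 0).
rewrite /frame /elen /qform /= !subr0 !scale0r !scale1r !addr0 !add0r.
rewrite expr0n mul0r !add0r expr1n mulr1 => /eqP.
by rewrite subr0 eqrXn2 ?enorm_ge0// => /eqP.
Qed.

Lemma elen_child i e : elen (koch_child i e) = elen e / 3.
Proof.
rewrite /elen koch_child_vec enormZ ger0_norm ?invr_ge0// mulrC.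
congr (_ / _); case: i => [|[|[|i]]] //; first exact: enorm_rotN60.
by rewrite -enormN opprB -rotN60_rotN60 !enorm_rotN60.
Qed.

(** The isosceles triangle, with angles pi/6 at the ends of its base, whose
    image under the frame of an edge is the convex hull of the Koch curve. *)
Definition htri : set (R * R) :=
  [set c | [/\ 0 <= c.2, c.2 <= c.1 & c.1 + 2 * c.2 <= 1]].

Definition hat e : set (R * R) := [set z | exists2 c, htri c & z = frame e c].

Definition koch e : set (R * R) := koch_curve e.1 e.2.

Lemma frame_00 e : frame e (0, 0) = e.1.
Proof. by rewrite /frame !scale0r !addr0. Qed.

Lemma frame_10 e : frame e (1, 0) = e.2.
Proof. by rewrite /frame scale0r scale1r addr0 addrC subrK. Qed.

Lemma hat_fst e : hat e e.1.
Proof. by exists (0, 0); rewrite ?frame_00//; split => /=; lra. Qed.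

Lemma hat_snd e : hat e e.2.
Proof. by exists (1, 0); rewrite ?frame_10//; split => /=; lra. Qed.

Lemma child_coord_htri i c : htri c -> htri (child_coord i c).
Proof. by case: c => x y [/= ? ? ?]; case: i => [|[|[|i]]]; split => /=; lra. Qed.

Lemma hat_child i e : hat (koch_child i e) `<=` hat e.
Proof.
move=> _ [c Tc ->]; exists (child_coord i c); last exact: frame_child.
exact: child_coord_htri.
Qed.

Lemma htri_qform c c' : htri c -> htri c' -> qform (c - c') <= 1.
Proof.
case: c c' => x y [x' y'] [/= ? ? ?] [/= ? ? ?]; rewrite /qform /=.
(* The square of the distance is completed; S is extremal on the two equal sides. *)
pose m := y + y'; pose S := x - x' + (y - y') / 2; pose Y := y - y'.
have -> : (x - x') ^+ 2 + (x - x') * (y - y') + (y - y') ^+ 2 =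
  S ^+ 2 + 3 / 4 * Y ^+ 2 by rewrite /S /Y; field.
have sqr_le (a r : R) : - r <= a -> a <= r -> a ^+ 2 <= r ^+ 2.
  by move=> ar ra; rewrite -subr_ge0 subr_sqr mulr_ge0//; lra.
have S_le : S ^+ 2 <= (1 - 3 / 2 * m) ^+ 2 by apply: sqr_le; rewrite /S /m; lra.
have Y_le : Y ^+ 2 <= m ^+ 2 by apply: sqr_le; rewrite /Y /m; lra.
have m_ge0 : 0 <= m * (1 - m) by rewrite mulr_ge0// /m; lra.
by move: S_le Y_le m_ge0; lra.
Qed.

Lemma hat_diam e z z' : hat e z -> hat e z' -> enorm (z - z') <= elen e.
Proof.
move=> [c Tc ->] [c' Tc' ->]; rewrite -[leRHS]mulr1; apply: enorm_frame_le => //.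
by rewrite expr1n; exact: htri_qform.
Qed.

End KochCurve.

Section PlaneTopology.
Context {R : realType}.
Implicit Types (x y z : R * R) (A B : set (R * R)).

Lemma nbhs_eball z (r : R) : 0 < r -> nbhs z (eball z r).
Proof.
move=> r0; apply/nbhs_ballP; exists (r / 2); first by rewrite /= divr_gt0.
move=> y [/= y1 y2]; rewrite /eball /=; apply: le_lt_trans (enorm_le_sum _) _.
by rewrite [ltRHS]splitr; apply: ltrD.
Qed.

Lemma nbhs_eballP z A : nbhs z A <-> exists2 r : R, 0 < r & eball z r `<=` A.
Proof.
split=> [/nbhs_ballP[r /= r0 rA]|[r r0 /filterS]]; last by apply; exact: nbhs_eball.
exists r => // y; rewrite /eball /= => zy; apply: rA; split => /=.
  by apply: le_lt_trans zy; exact: (le_enorm1 (z - y)).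
by apply: le_lt_trans zy; exact: (le_enorm2 (z - y)).
Qed.

Lemma open_eballP A : open A <-> forall z, A z -> exists2 r : R, 0 < r & eball z r `<=` A.
Proof.
rewrite openE; split => H z Az; first by apply/nbhs_eballP; exact: H.
by apply/nbhs_eballP; exact: H.
Qed.

Lemma closure_eballP A z :
  closure A z <-> forall r : R, 0 < r -> exists2 y, A y & enorm (z - y) < r.
Proof.
split=> [zA r r0|H B /nbhs_eballP[r r0 rB]].
  by have [y [Ay zy]] := zA _ (nbhs_eball z r0); exists y.
by have [y Ay zy] := H r r0; exists y; split => //; exact: rB.
Qed.

Lemma bounded_enormP A :
  bounded_set A <-> exists2 M : R, 0 < M & forall z, A z -> enorm z <= M.
Proof.
split=> [[M [_ HM]]|[M M0 HM]].
  exists (2 * (`|M| + 1)); first by rewrite mulr_gt0// ltr_wpDl.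
  move=> z Az; apply: le_trans (enorm_le_sum z) _.
  have := HM (`|M| + 1) _ z Az; rewrite (le_lt_trans (ler_norm M)) ?ltrDl// => /(_ isT).
  by rewrite /= prod_normE ge_max => /andP[]; lra.
exists M; split; first exact: num_real.
move=> N MN z Az; have zM := HM z Az.
rewrite /= prod_normE ge_max; apply/andP; split.
  by apply: le_trans (ltW MN); exact: le_trans (le_enorm1 z) zM.
by apply: le_trans (ltW MN); exact: le_trans (le_enorm2 z) zM.
Qed.

Lemma bounded_closed_compact_plane A : bounded_set A -> closed A -> compact A.
Proof.
move=> /bounded_enormP[M M0 AM] cA.
apply: (@subclosed_compact _ _ (`[- M, M]%classic `*` `[- M, M]%classic)) => //.
  by apply: compact_setX; exact: segment_compact.
move=> z Az; have zM := AM z Az; split; rewrite /= in_itv/= -ler_norml.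
  exact: le_trans (le_enorm1 z) zM.
exact: le_trans (le_enorm2 z) zM.
Qed.

(** The part of the segment in A is open and closed in the segment, which is
    connected. *)
Lemma segment_avoid_boundary A x y : open A ->
  (forall t, 0 <= t <= 1 -> ~ boundary A (x + t *: (y - x))) -> A x -> A y.
Proof.
move=> oA xyA Ax; pose g (t : R) := x + t *: (y - x).
have cg : continuous g.
  move=> t; apply: cvgD; first exact: cvg_cst.
  by apply: cvgZr_tmp; exact: cvg_id.
have cI : connected (g @` `[0, 1]%classic).
  apply: connected_continuous_connected; last exact: continuous_subspaceT.
  exact/connected_intervalP/interval_is_interval.
have g0 : g 0 = x by rewrite /g scale0r addr0.
have g1 : g 1 = y by rewrite /g scale1r addrC subrK.
have gA : g @` `[0, 1] `&` A = g @` `[0, 1].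
  apply: cI; first by exists x; split => //; exists 0; rewrite //= in_itv/= lexx ler01.
    by exists A.
  exists (closure A); first exact: closed_closure.
  apply/seteqP; split=> z [Iz Az]; split=> //; first exact: subset_closure.
  case: Iz => t; rewrite /= in_itv/= => t01 gtz; apply: contrapT => nAz.
  by apply: (xyA t t01); rewrite -/(g t) gtz; split=> // /interior_subset.
have : (g @` `[0, 1]) y by exists 1; rewrite //= in_itv/= ler01 lexx.
by rewrite -gA => -[].
Qed.

End PlaneTopology.

(** * Self-similarity of the Koch curve *)

Section KochSelfSimilarity.
Context {R : realType}.
Implicit Types (u v z : R * R) (e : (R * R) * (R * R)) (c : R * R) (i : nat).

Lemma continuous_frame e : continuous (frame e).
Proof.
move=> c; apply: cvgD; first apply: cvgD; first exact: cvg_cst.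
  by apply: cvgZr_tmp; exact: cvg_fst.
by apply: cvgZr_tmp; exact: cvg_snd.
Qed.

Lemma closed_htri : closed (@htri R).
Proof.
have -> : @htri R = [set c | 0 <= c.2] `&` [set c | 0 <= c.1 - c.2] `&`
    [set c | 0 <= 1 - (c.1 + 2 * c.2)].
  apply/seteqP; split => c /=; first by move=> [? ? ?]; split; [split|]; lra.
  by move=> [[? ?] ?]; split; lra.
have cge (g : R * R -> R) : continuous g -> closed [set c | 0 <= g c].
  move=> cg; rewrite [X in closed X](_ : _ = g @^-1` [set x | 0 <= x])//.
  by apply: closed_comp => [x _|]; [exact: cg|exact: closed_ge].
have cfst : continuous (fst : R * R -> R) by move=> x; exact: cvg_fst.
have csnd : continuous (snd : R * R -> R) by move=> x; exact: cvg_snd.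
apply: closedI; first apply: closedI; apply: cge => //.
  by move=> x; apply: cvgB; [exact: cfst|exact: csnd].
move=> x; apply: cvgB; first exact: cvg_cst.
apply: cvgD; first exact: cfst.
by apply: cvgM; [exact: cvg_cst|exact: csnd].
Qed.

Lemma compact_htri : compact (@htri R).
Proof.
apply: bounded_closed_compact_plane closed_htri; apply/bounded_enormP.
exists 2 => // c [c2 c12 c1]; apply: le_trans (enorm_le_sum c) _.
by rewrite !ger0_norm//; lra.
Qed.

Lemma compact_hat e : compact (hat e).
Proof.
have -> : hat e = frame e @` @htri R.
  by apply/seteqP; split=> z [c Tc]; [move=> ->; exists c|move=> <-; exists c].
apply: continuous_compact compact_htri.
by apply: continuous_subspaceT; exact: continuous_frame.
Qed.

Lemma closed_hat e : closed (hat e).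
Proof.
apply: compact_closed; last exact: compact_hat.
exact: (@norm_hausdorff R (R * R)%type).
Qed.

Definition koch_points e : set (R * R) := \bigcup_n koch_vertices n e.1 e.2.

Lemma koch_vertices_child n e z : koch_vertices n.+1 e.1 e.2 z <->
  exists i, koch_vertices n (koch_child i e).1 (koch_child i e).2 z.
Proof.
split=> [[[[]|]|]|[[|[|[|i]]]]] /= Vz.
- by exists 0%N.
- by exists 1%N.
- by exists 2.
- by exists 3.
- by do 3 left.
- by do 2 left; right.
- by left; right.
- by right.
Qed.

Lemma koch_pointsE e z :
  koch_points e z <-> exists i, koch_points (koch_child i e) z.
Proof.
split=> [[[|n] _]|[i [n _ Vz]]].
- move=> [->|->]; first by exists 0%N, 0%N => //; left.
  by exists 3, 0%N => //; right.
- by move=> /koch_vertices_child[i Vz]; exists i, n.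
- by exists n.+1 => //; apply/koch_vertices_child; exists i.
Qed.

Lemma koch_points_hat e : koch_points e `<=` hat e.
Proof.
move=> z [n _]; elim: n e => [|n IHn] e.
  by move=> [->|->]; [exact: hat_fst|exact: hat_snd].
by move=> /koch_vertices_child[i /IHn]; exact: hat_child.
Qed.

Lemma koch_hat e : koch e `<=` hat e.
Proof.
rewrite [X in _ `<=` X](closure_id _).1; last exact: closed_hat.
exact: closure_subset (@koch_points_hat e).
Qed.

Lemma closed_koch e : closed (koch e).
Proof. exact: closed_closure. Qed.

Lemma koch_fst e : koch e e.1.
Proof. by apply: subset_closure; exists 0%N => //; left. Qed.

Lemma koch_snd e : koch e e.2.
Proof. by apply: subset_closure; exists 0%N => //; right. Qed.

(** The vertices of all levels satisfy the same equation, and closure commutes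
    with the finite union over the four children. *)
Lemma koch_childP e z : koch e z <-> exists i, koch (koch_child i e) z.
Proof.
split; last first.
  move=> [i]; apply: closure_subset => {}z ez.
  by apply/koch_pointsE; exists i.
have ch n : koch_child (minn n 3) e = koch_child n e.
  by case: n => [|[|[|[|n]]]].
suff : koch e `<=` \bigcup_(i in `I_4) koch (koch_child i e).
  by move=> /[apply] -[i _ ?]; exists i.
rewrite [X in _ `<=` X](closure_id _).1; last first.
  apply: closed_bigcup => // i _; exact: closed_koch.
apply: closure_subset => {}z /koch_pointsE[i iz].
exists (minn i 3); first by rewrite /=; lia.
by rewrite ch; exact: subset_closure.
Qed.

End KochSelfSimilarity.

(** * The Koch curve has finite and positive Hausdorff measure *)

Section KochDimension.
Context {R : realType}.
Implicit Types (u v z : R * R) (e : (R * R) * (R * R)) (c : R * R) (i : nat).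

Lemma koch_dim_gt0 : 0 < @koch_dim R.
Proof. by rewrite divr_gt0// ln_gt0//; lra. Qed.

Lemma powR3_koch_dim : 3 `^ koch_dim = 4 :> R.
Proof.
have ln3 : ln 3 != 0 :> R by rewrite gt_eqF// ln_gt0//; lra.
have -> : 3 `^ koch_dim = expR (koch_dim * ln 3) :> R.
  by rewrite /powR pnatr_eq0.
by rewrite /koch_dim divfK// lnK// posrE; lra.
Qed.

Lemma powR_div3_koch_dim (x : R) : 0 <= x -> (x / 3) `^ koch_dim = x `^ koch_dim / 4.
Proof.
move=> x0; have {2}-> : x = x / 3 * 3 by field.
by rewrite [in RHS]powRM ?divr_ge0// powR3_koch_dim mulfK// pnatr_eq0.
Qed.

Local Notation d := (@koch_dim R).

(** A curve is covered by its four children, which are three times shorter, and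
    4 * 3^(-d) = 1: subdivision does not change the sum of the powers, and after
    n steps all the pieces are shorter than delta. *)
Lemma hausdorff_content_koch n e (delta : R) : 0 < delta ->
  elen e <= 3 ^+ n * delta ->
  (hausdorff_content d delta (koch e) <= (elen e `^ d)%:E)%E.
Proof.
move=> delta0; elim: n e => [|n IHn] e.
  rewrite expr0 mul1r => edelta.
  have diam_e : (diam (koch e) <= (elen e)%:E)%E.
    apply: diam_le => [|z z' ez ez']; first exact: enorm_ge0.
    exact: hat_diam (koch_hat ez) (koch_hat ez').
  apply: le_trans (hausdorff_content_le_diam koch_dim_gt0 _) _.
    by apply: le_trans diam_e _; rewrite lee_fin.
  rewrite -poweR_EFin; apply: gt0_ler_poweR diam_e; first exact: ltW koch_dim_gt0.
    by rewrite in_itv/= diam_ge0 leey.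
  by rewrite in_itv/= lee_fin enorm_ge0 leey.
rewrite exprS -mulrA => en.
have child i : (hausdorff_content d delta (koch (koch_child i e)) <=
    (elen e `^ d / 4)%:E)%E.
  rewrite -powR_div3_koch_dim ?enorm_ge0// -(elen_child i); apply: IHn.
  by rewrite elen_child ler_pdivrMr//; lra.
have -> : koch e = koch (koch_child 0 e) `|` koch (koch_child 1 e) `|`
    koch (koch_child 2 e) `|` koch (koch_child 3 e).
  apply/seteqP; split=> [z /koch_childP[[|[|[|i]]] iz]|].
  - by do 3 left.
  - by do 2 left; right.
  - by left; right.
  - by right.
  - by move=> z ez; apply/koch_childP; case: ez => [[[]|]|]; by [exists 0%N|exists 1%N|exists 2|exists 3].
have contentU A B x y : (hausdorff_content d delta A <= x)%E ->
    (hausdorff_content d delta B <= y)%E ->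
    (hausdorff_content d delta (A `|` B) <= x + y)%E.
  move=> Ax By; apply: le_trans (hausdorff_contentU _ _ koch_dim_gt0 delta0) _.
  exact: leeD.
apply: le_trans (contentU _ _ _ _ (contentU _ _ _ _ (contentU _ _ _ _
  (child 0%N) (child 1%N)) (child 2)) (child 3)) _.
by rewrite -!EFinD lee_fin; lra.
Qed.

Definition digit (t : R) : nat :=
  if t < 1 / 4 then 0 else if t < 1 / 2 then 1 else if t < 3 / 4 then 2 else 3.

Fixpoint locate n e (t : R) :=
  if n is n'.+1 then locate n' (koch_child (digit t) e) (4 * t - (digit t)%:R)
  else e.

(** The point z has parameter t on the Koch curve of e, for the
    parametrization sending the n-th quarters of [0, 1] to the n-th children. *)
Definition koch_param e t z := forall n, hat (locate n e t) z.

Lemma digit_bounds (t : R) : 0 <= t <= 1 -> 0 <= 4 * t - (digit t)%:R <= 1.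
Proof. by move=> t01; rewrite /digit; do ![case: ltP => ?]; lra. Qed.

Lemma le_digit (t t' : R) : t <= t' -> (digit t <= digit t')%N.
Proof. by move=> tt'; rewrite /digit; do ![case: ltP => //= ?]; lra. Qed.

Lemma koch_child_sub i e : koch (koch_child i e) `<=` koch e.
Proof. by move=> z iz; apply/koch_childP; exists i. Qed.

Lemma koch_locate n e t : koch (locate n e t) `<=` koch e.
Proof.
elim: n e t => [e t z //|n IHn e t z /IHn]; exact: koch_child_sub.
Qed.

Lemma hat_locate m n e t : hat (locate (m + n) e t) `<=` hat (locate m e t).
Proof.
elim: m e t => [|m IHm] e t; last exact: IHm.
elim: n e t => [e t z //|n IHn e t z /IHn]; exact: hat_child.
Qed.

Lemma compact_koch e : compact (koch e).
Proof.
exact: subclosed_compact (@closed_koch _ e) (@compact_hat _ e) (@koch_hat _ e).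
Qed.

(** The hats located by t are nested and compact. *)
Lemma koch_param_exists e t : exists2 z, koch e z & koch_param e t z.
Proof.
pose s n := (locate n e t).1.
have [|z [ez sz]] := @compact_koch e (s @ \oo) _.
  exists 0%N => // n _; rewrite /preimage /=.
  exact: (@koch_locate n e t _ (@koch_fst _ _)).
exists z => // m; rewrite (closure_id (hat (locate m e t))).1; last exact: closed_hat.
move=> B zB; apply: sz => //; exists m => // n /= /subnKC <-.
exact: (@hat_locate m _ e t _ (hat_fst _)).
Qed.

Lemma koch_param_child e t z :
  koch_param e t z -> koch_param (koch_child (digit t) e) (4 * t - (digit t)%:R) z.
Proof. by move=> etz n; exact: etz n.+1. Qed.

Lemma koch_param_coord e t z : koch_param e t z ->
  exists2 c, htri c & z = frame e (child_coord (digit t) c).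
Proof. by move=> /(_ 1%N)[c Tc ->]; exists c => //; rewrite /= frame_child. Qed.

(** Removes the error term left by N steps of a recursion over the children. *)
Lemma le_geometric4 (x y D : R) : (forall N, x <= y + 4 ^- N * D) -> x <= y.
Proof.
move=> H; apply/ler_addgt0Pr => eps eps0.
have [D0|D0] := leP D 0.
  apply: le_trans (H 0%N) _; rewrite expr0 invr1 mul1r; lra.
apply: le_trans (H (Num.bound (D / eps))) _; rewrite lerD2l mulrC ler_pdivrMr ?exprn_gt0//.
rewrite -ler_pdivrMl// mulrC; apply: le_trans (ltW (archi_boundP _)) _.
  by rewrite divr_ge0// ltW.
by rewrite -natrX ler_nat ltnW// ltn_expl.
Qed.

Lemma le_powR_scaled e (x k : R) : 0 <= k -> 0 <= x -> elen e <= k * x ->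
  elen e `^ d <= (k * x) `^ d.
Proof.
move=> k0 x0; apply: ge0_ler_powR; rewrite ?nnegrE ?elen_ge0 ?(ltW koch_dim_gt0)//.
exact: mulr_ge0.
Qed.

(** By recursion along the first children, until the point leaves them: it is then
    at a distance from e.1 comparable to the length of the edge. *)
Lemma koch_param_fst e (t : R) z : 0 <= t <= 1 -> koch_param e t z ->
  t * elen e `^ d <= (5 * enorm (z - e.1)) `^ d.
Proof.
move=> t01 etz; apply: (@le_geometric4 _ _ (elen e `^ d)) => N.
elim: N e t t01 etz => [|N IHN] e t t01 etz.
  rewrite expr0 invr1 mul1r ler_wpDl ?powR_ge0//.
  by rewrite ler_piMl ?powR_ge0//; lra.
have D0 := powR_ge0 (elen e) d.
have [digit0|digit0] := eqVneq (digit t) 0%N.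
  have := IHN _ _ (digit_bounds t01) (koch_param_child etz).
  rewrite digit0 elen_child powR_div3_koch_dim ?enorm_ge0//= subr0 exprS invfM.
  by set u := _ `^ _; move: (4 ^- N) => q; lra.
have [c Tc zE] := koch_param_coord etz.
apply: (@le_trans _ _ (elen e `^ d)); first by rewrite ler_piMl//; lra.
rewrite ler_wpDr ?mulr_ge0 ?invr_ge0 ?exprn_ge0//.
apply: le_powR_scaled; rewrite ?enorm_ge0//.
suff : elen e * 5^-1 <= enorm (z - e.1) by lra.
rewrite zE -(frame_00 e); apply: enorm_frame_ge => //.
case: c Tc {zE} => x y [/= ? ? ?]; rewrite /qform.
by move: digit0; case: (digit t) => [|[|[|i]]] //= _; nra.
Qed.

Lemma koch_param_snd e (t : R) z : 0 <= t <= 1 -> koch_param e t z ->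
  (1 - t) * elen e `^ d <= (5 * enorm (z - e.2)) `^ d.
Proof.
move=> t01 etz; apply: (@le_geometric4 _ _ (elen e `^ d)) => N.
elim: N e t t01 etz => [|N IHN] e t t01 etz.
  rewrite expr0 invr1 mul1r ler_wpDl ?powR_ge0//.
  by rewrite ler_piMl ?powR_ge0//; lra.
have D0 := powR_ge0 (elen e) d.
have [digit3|digit3] := eqVneq (digit t) 3.
  have := IHN _ _ (digit_bounds t01) (koch_param_child etz).
  rewrite digit3 elen_child powR_div3_koch_dim ?enorm_ge0//= exprS invfM.
  by set u := _ `^ _; move: (4 ^- N) => q; lra.
have [c Tc zE] := koch_param_coord etz.
apply: (@le_trans _ _ (elen e `^ d)); first by rewrite ler_piMl//; lra.
rewrite ler_wpDr ?mulr_ge0 ?invr_ge0 ?exprn_ge0//.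
apply: le_powR_scaled; rewrite ?enorm_ge0//.
suff : elen e * 5^-1 <= enorm (z - e.2) by lra.
rewrite zE -(frame_10 e); apply: enorm_frame_ge => //.
case: c Tc {zE} => x y [/= ? ? ?]; apply: le_trans (qform_ge_fst _) => /=.
have : (digit t < 4)%N by rewrite /digit; do ![case: ifP].
by move: digit3; case: (digit t) => [|[|[|[|i]]]] //= _ _; nra.
Qed.

Lemma qformB_le u v : qform (u - v) <= 3 / 2 * qform u + 3 * qform v.
Proof.
have := qform_ge0 (u.1 / 2 + v.1, u.2 / 2 + v.2); rewrite /qform /=; lra.
Qed.

(** The Cauchy-Schwarz inequality for the quadratic form: the dual form is
    4/3 (a^2 - a b + b^2). *)
Lemma qform_ge_linear (a b : R) v : a ^+ 2 - a * b + b ^+ 2 <= 3 ->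
  (a * v.1 + b * v.2) ^+ 2 <= 4 * qform v.
Proof.
move=> ab; have cs : 3 / 4 * (a * v.1 + b * v.2) ^+ 2 <=
    (a ^+ 2 - a * b + b ^+ 2) * qform v.
  rewrite -subr_ge0 /qform.
  have -> : (a ^+ 2 - a * b + b ^+ 2) * (v.1 ^+ 2 + v.1 * v.2 + v.2 ^+ 2) -
    3 / 4 * (a * v.1 + b * v.2) ^+ 2 =
    (v.1 * (a / 2 - b) + v.2 * (a - b / 2)) ^+ 2 by field.
  exact: sqr_ge0.
have := ler_wpM2r (qform_ge0 v) ab; lra.
Qed.

(** The two points are on different sides of a line through the origin, and v is in
    a sector away from that line, so v - v' is not much smaller than v. *)
Lemma qform_separated (a b : R) v v' : a ^+ 2 - a * b + b ^+ 2 <= 3 ->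
  0 <= a * v.1 + b * v.2 -> a * v'.1 + b * v'.2 <= 0 ->
  qform v <= (a * v.1 + b * v.2) ^+ 2 ->
  qform v <= 3 ^+ 2 * qform (v - v') /\ qform v' <= 3 ^+ 2 * qform (v - v').
Proof.
move=> ab v_ge0 v'_le0 qv; have := qform_ge_linear (v - v') ab.
have : (a * v.1 + b * v.2) ^+ 2 <= (a * (v - v').1 + b * (v - v').2) ^+ 2.
  by rewrite ler_pXn2r ?nnegrE//= ; lra.
have := qformB_le v (v - v'); rewrite opprB addrC subrK.
have := qform_ge0 (v - v').
by split; lra.
Qed.

(** Consecutive children meet at an angle of pi/3 at least, and the other pairs
    of children are disjoint, so the distance between two points bounds their
    distances to the vertex separating them. *)
Lemma child_coord_separated i j c c' : htri c -> htri c' -> (i < j < 4)%N ->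
  6^-1 ^+ 2 <= qform (child_coord i c - child_coord j c') \/
  [/\ j = i.+1,
   qform (child_coord i c - child_coord i (1, 0)) <=
     3 ^+ 2 * qform (child_coord i c - child_coord j c') &
   qform (child_coord j c' - child_coord j (0, 0)) <=
     3 ^+ 2 * qform (child_coord i c - child_coord j c')].
Proof.
have far v : v.1 + v.2 / 2 <= - 6^-1 -> 6^-1 ^+ 2 <= qform v.
  move=> v6; have -> : qform v = (v.1 + v.2 / 2) ^+ 2 + 3 / 4 * v.2 ^+ 2.
    by rewrite /qform; field.
  have := sqr_ge0 v.2; set m := v.1 + v.2 / 2 in v6 *.
  have : 0 <= (- m - 6^-1) * (- m + 6^-1) by rewrite mulr_ge0//; lra.
  by lra.
case: c c' => x y [x' y'] [/= ? ? ?] [/= ? ? ?].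
have near a b v v' w : v - v' = w -> a ^+ 2 - a * b + b ^+ 2 <= 3 ->
  0 <= a * v.1 + b * v.2 -> a * v'.1 + b * v'.2 <= 0 ->
  qform v <= (a * v.1 + b * v.2) ^+ 2 ->
  qform v <= 3 ^+ 2 * qform w /\ qform v' <= 3 ^+ 2 * qform w.
  by move=> <-; exact: qform_separated.
(* The separating lines are orthogonal to the first child, along the base of the
   third one, and orthogonal to the last one. *)
case: i => [|[|[|i]]] /=; case: j => [|[|[|[|j]]]] //= ij;
  try by left; apply: far => /=; lra.
- right; case: (@near (-2) (-1)
    ((x / 3, y / 3) - (1 / 3, 0 / 3)) (((1 - y') / 3, (x' + y') / 3) - (1 / 3, 0 / 3))
    ((x / 3, y / 3) - ((1 - y') / 3, (x' + y') / 3))).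
  + by rewrite opprB addrA subrK.
  + by lra.
  + by move=> /=; lra.
  + by move=> /=; lra.
  + by rewrite /qform /=; nra.
  + by rewrite subr0 addr0.
- right; case: (@near (-1) (-1)
    (((1 - y) / 3, (x + y) / 3) - (1 / 3, 1 / 3))
    (((1 + x' + y') / 3, (1 - x') / 3) - (1 / 3, 1 / 3))
    (((1 - y) / 3, (x + y) / 3) - ((1 + x' + y') / 3, (1 - x') / 3))).
  + by rewrite opprB addrA subrK.
  + by lra.
  + by move=> /=; lra.
  + by move=> /=; lra.
  + by rewrite /qform /=; nra.
  + by rewrite !subr0 !addr0.
- right; case: (@near 2 1
    (((2 + x') / 3, y' / 3) - (2 / 3, 0 / 3))
    (((1 + x + y) / 3, (1 - x) / 3) - (2 / 3, 0 / 3))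
    (((2 + x') / 3, y' / 3) - ((1 + x + y) / 3, (1 - x) / 3))).
  + by rewrite opprB addrA subrK.
  + by lra.
  + by move=> /=; lra.
  + by move=> /=; lra.
  + by rewrite /qform /=; nra.
  + have qC v v' : qform (v - v') = qform (v' - v) by rewrite /qform /=; ring.
    have -> : (1 + 1 + 0) / 3 = 2 / 3 :> R by field.
    have -> : (1 - 1) / 3 = 0 / 3 :> R by field.
    by move=> ? ?; split=> //; rewrite [X in _ <= _ * X]qC.
- by move: ij; lia.
Qed.

(** The inverse of the parametrization is Hoelder continuous of exponent d. As
    long as both parameters have the same first digit the estimate is inherited
    from the child; at the first difference it follows from the separation of
    the children. *)
Lemma koch_param_two e (t t' : R) z z' : 0 <= t -> t <= t' -> t' <= 1 ->
  koch_param e t z -> koch_param e t' z' ->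
  (t' - t) * elen e `^ d <= 2 * (15 * enorm (z - z')) `^ d.
Proof.
move=> t0 tt' t1 etz et'z'; apply: (@le_geometric4 _ _ (elen e `^ d)) => N.
elim: N e t t' t0 tt' t1 etz et'z' => [|N IHN] e t t' t0 tt' t1 etz et'z'.
  rewrite expr0 invr1 mul1r ler_wpDl ?mulr_ge0 ?powR_ge0//.
  by rewrite ler_piMl ?powR_ge0//; lra.
have t01 : 0 <= t <= 1 by lra.
have t'01 : 0 <= t' <= 1 by lra.
have := digit_bounds t01; have := digit_bounds t'01.
have := koch_param_child etz; have := koch_param_child et'z'.
have D0 := powR_ge0 (elen e) d.
have dt4 s : (digit s < 4)%N by rewrite /digit; do ![case: ifP].
have := le_digit tt'; rewrite leq_eqVlt => /predU1P[<-|dtt'] et' et s' s.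
  have := IHN _ _ _ _ _ _ et et'; rewrite !elen_child.
  rewrite powR_div3_koch_dim ?enorm_ge0// exprS invfM.
  set u := _ `^ _; move: (4 ^- N) => q; lra.
apply: ler_wpDr; first by rewrite mulr_ge0 ?invr_ge0 ?exprn_ge0.
have [c Tc zE] := koch_param_coord etz.
have [c' Tc' z'E] := koch_param_coord et'z'.
have ijP : (digit t < digit t' < 4)%N by rewrite dtt' dt4.
have [far|[jE near near']] := child_coord_separated Tc Tc' ijP.
  have /le_powR_scaled : elen e <= 15 * enorm (z - z').
    suff : elen e * 6^-1 <= enorm (z - z').
      by have := elen_ge0 e; lra.
    by rewrite zE z'E; apply: enorm_frame_ge.
  move=> /(_ (ler0n _ _) (enorm_ge0 _)) Dle.
  have : (t' - t) * elen e `^ d <= elen e `^ d by rewrite ler_piMl//; lra.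
  by move=> /le_trans; apply; have := powR_ge0 (15 * enorm (z - z')) d; lra.
have pow_le v : enorm v <= 3 * enorm (z - z') ->
    (5 * enorm v) `^ d <= (15 * enorm (z - z')) `^ d.
  move=> v3; apply: ge0_ler_powR; rewrite ?(ltW koch_dim_gt0)// ?nnegrE ?mulr_ge0 ?enorm_ge0//.
  by lra.
have sq v v' : enorm v ^+ 2 <= 3 ^+ 2 * enorm v' ^+ 2 -> enorm v <= 3 * enorm v'.
  by rewrite -exprMn ler_pXn2r ?nnegrE ?mulr_ge0 ?enorm_ge0.
have scaled (x y : R) : x <= 3 ^+ 2 * y -> elen e ^+ 2 * x <= 3 ^+ 2 * (elen e ^+ 2 * y).
  by move=> xy; rewrite mulrCA ler_wpM2l ?sqr_ge0.
have near_snd : enorm (z - (koch_child (digit t) e).2) <= 3 * enorm (z - z').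
  apply: sq; rewrite -(frame_10 (koch_child _ _)) frame_child zE z'E !sqr_enorm_frame.
  exact: scaled.
have near_fst : enorm (z' - (koch_child (digit t') e).1) <= 3 * enorm (z - z').
  apply: sq; rewrite -(frame_00 (koch_child _ _)) frame_child zE z'E !sqr_enorm_frame.
  exact: scaled.
have := koch_param_snd s et; have := koch_param_fst s' et'.
rewrite !elen_child powR_div3_koch_dim ?enorm_ge0// => h' h.
have {}h := le_trans h (pow_le _ near_snd); have {}h' := le_trans h' (pow_le _ near_fst).
have jR : (digit t')%:R = (digit t)%:R + 1 :> R by rewrite jE -natr1.
by move: h h'; rewrite jR; set P := (15 * _) `^ d; lra.
Qed.

(** Transporting a cover of the Koch curve by the parametrization gives a cover
    of [0, 1] by sets whose lengths are controlled by koch_param_two. *)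
Lemma hausdorff_content_koch_ge e (delta : R) :
  ((elen e `^ d / (4 * 15 `^ d))%:E <= hausdorff_content d delta (koch e))%E.
Proof.
have p15 : 0 < 15 `^ d :> R by rewrite powR_gt0.
have [e0|e_neq0] := eqVneq (elen e) 0.
  rewrite e0 powR0 ?gt_eqF ?koch_dim_gt0// mul0r.
  by apply: le_ereal_inf_tmp => _ [F _ <-]; apply: nneseries_ge0 => *; exact: poweR_ge0.
have D0 : 0 < elen e `^ d by rewrite powR_gt0// lt_neqAle eq_sym e_neq0 elen_ge0.
apply: le_ereal_inf_tmp => _ [F [eF _] <-].
have [[k Fk]|Ffin] := pselect (exists k, diam (F k) = +oo%E).
  rewrite (@eseries_pinfty _ (fun k => poweR (diam (F k)) d) xpredT k)//.
  - exact: leey.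
  - by move=> n _; rewrite -ltNye; apply: lt_le_trans (poweR_ge0 _ _).
  - by rewrite Fk poweRyr// gt_eqF// koch_dim_gt0.
pose dm k := fine (diam (F k)).
have dmE k : diam (F k) = (dm k)%:E.
  rewrite fineK// ge0_fin_numE ?diam_ge0// ltey; apply/eqP => Fk.
  by apply: Ffin; exists k.
have dm0 k : 0 <= dm k by rewrite -lee_fin -dmE diam_ge0.
have [gamma gammaP] : {gamma : R -> R * R & forall t, koch e (gamma t) /\ koch_param e t (gamma t)}.
  apply: (@choice _ _ (fun t z => koch e z /\ koch_param e t z)) => t.
  by have [z ez tz] := koch_param_exists e t; exists z.
(* By koch_param_two the parameters of the points of F k are r k apart at most. *)
pose r k := 2 * (15 * dm k) `^ d / elen e `^ d.
have r0 k : 0 <= r k by rewrite divr_ge0 ?mulr_ge0 ?powR_ge0.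
have near t t' k : 0 <= t -> t <= t' -> t' <= 1 -> F k (gamma t) -> F k (gamma t') ->
    t' - t <= r k.
  move=> t0 tt' t1 Ft Ft'; rewrite ler_pdivlMr//.
  apply: le_trans (koch_param_two t0 tt' t1 (gammaP t).2 (gammaP t').2) _.
  rewrite ler_wpM2l//; apply: ge0_ler_powR; rewrite ?(ltW koch_dim_gt0)// ?nnegrE ?mulr_ge0 ?enorm_ge0//.
  by rewrite ler_wpM2l// -lee_fin -dmE; exact: enorm_le_diam.
have [m mP] : {m : nat -> R & forall k t, 0 <= t <= 1 -> F k (gamma t) ->
    m k - r k <= t <= m k + r k}.
  apply: (@choice _ _ (fun k m => forall t, 0 <= t <= 1 -> F k (gamma t) ->
    m - r k <= t <= m + r k)) => k.
  have [[m [m01 Fm]]|Fk0] := pselect (exists m, 0 <= m <= 1 /\ F k (gamma m)); last first.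
    by exists 0 => t t01 Ft; exfalso; apply: Fk0; exists t.
  exists m => t t01 Ft; have [tm|/ltW mt] := leP t m.
    by have := near t m k _ tm _ Ft Fm; have := r0 k; lra.
  by have := near m t k _ mt _ Fm Ft; have := r0 k; lra.
pose J k : set (measurableTypeR R) := `[m k - r k, m k + r k]%classic.
have cover : `[0, 1]%classic `<=` \bigcup_k J k.
  move=> t; rewrite /= in_itv/= => t01.
  have [k _ Fk] := eF _ (gammaP t).1.
  by exists k => //; rewrite /J /= in_itv/=; exact: mP.
have mJ k : measurable (J k) by exact: measurable_itv.
have mI : measurable (`[0, 1]%classic : set (measurableTypeR R)) by exact: measurable_itv.
have len01 : (@lebesgue_measure R) `[0, 1]%classic = 1%E.
  by rewrite lebesgue_measure_itv/= lte_fin ltr01 oppr0 adde0.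
have le1 : (1 <= \sum_(k <oo) (@lebesgue_measure R) (J k))%E.
  by rewrite -len01; exact: measure_sigma_subadditive.
have c0 : 0 < 4 * 15 `^ d / elen e `^ d by rewrite divr_gt0 ?mulr_gt0.
rewrite -invf_div -[leLHS]mule1 lee_pdivrMl//.
rewrite -nneseriesZl; last by move=> *; exact: poweR_ge0.
apply: le_trans le1 _; apply: lee_nneseries => [k _ _|k _]; first exact: measure_ge0.
rewrite lebesgue_measure_itv/= lte_fin; case: ifPn => _; last first.
  by rewrite mule_ge0 ?poweR_ge0// lee_fin ltW.
rewrite dmE poweR_EFin -?EFinN -?EFinD lee_fin /r powRM//.
by lra.
Qed.

Lemma hausdorff_koch_gt0 e : elen e != 0 -> (0 < hausdorff d (koch e))%E.
Proof.
move=> e0; apply: (@lt_le_trans _ _ (elen e `^ d / (4 * 15 `^ d))%:E).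
  rewrite lte_fin divr_gt0 ?mulr_gt0 ?powR_gt0//.
  by rewrite lt_neqAle eq_sym e0 elen_ge0.
apply: le_trans (hausdorff_content_koch_ge e 1) _.
by apply: ereal_sup_ubound; exists 1 => //; exact: ltr01.
Qed.

Lemma hausdorff_koch_lty e : (hausdorff d (koch e) < +oo)%E.
Proof.
apply: (@le_lt_trans _ _ (elen e `^ d)%:E); last exact: ltry.
apply: ge_ereal_sup => _ [delta /= delta0 <-].
apply: (@hausdorff_content_koch (Num.bound (elen e / delta))) => //.
rewrite -ler_pdivrMr//; apply: le_trans (ltW (archi_boundP _)) _.
  by rewrite divr_ge0 ?elen_ge0// ltW.
by rewrite -natrX ler_nat ltnW// ltn_expl.
Qed.

End KochDimension.

(** * The inside of the snowflake *)

Section Snowflake.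
Context {R : realType}.
Implicit Types (a b u v z : R * R) (e : (R * R) * (R * R)) (c : R * R) (i j : nat).

Definition snow a b : set (R * R) :=
  koch (a, b) `|` koch (b, apex a b) `|` koch (apex a b, a).

Lemma snowflakeE a b : snowflake a b = snow a b.
Proof.
apply/seteqP; split=> [z [[i ilt] _]|z [[]|]].
- by case: i ilt => [|[|[|i]]] // ilt; rewrite /snowflake_arc /=; [do 2 left|left; right|right].
- by exists ord0.
- by exists (Ordinal (isT : (1 < 3)%N)).
- by exists (Ordinal (isT : (2 < 3)%N)).
Qed.

Lemma closed_snow a b : closed (snow a b).
Proof. by do 2 (apply: closedU; last exact: closed_koch); exact: closed_koch. Qed.

Lemma apex_vec a b : let u := b - a in
  apex a b - b = - rotN60 u /\ a - apex a b = rotN60 u - u.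
Proof.
by split; rewrite /apex rot60E; move: (rotN60 _) => w; apply: plane_ext;
  rewrite !planeE; ring.
Qed.

Lemma apex_apex a b : apex b (apex a b) = a.
Proof.
rewrite {1}/apex (apex_vec a b).1 rot60E -(subr0 (- _)) -sub0r !subr0 sub0r.
rewrite -scaleN1r rotN60Z rotN60_rotN60; move: (rotN60 _) => w.
by apply: plane_ext; rewrite !planeE; ring.
Qed.

Lemma snow_rot a b : snow b (apex a b) = snow a b.
Proof. by rewrite /snow apex_apex setUC setUA. Qed.

Lemma elen_rot a b : elen (b, apex a b) = elen (a, b).
Proof. by rewrite /elen/= (apex_vec a b).1 enormN enorm_rotN60. Qed.

Lemma frame_rot a b c :
  frame (b, apex a b) c = frame (a, b) (1 + c.2, - c.1 - c.2).
Proof.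
rewrite /frame /= (apex_vec a b).1 -[- rotN60 _]scaleN1r rotN60Z rotN60_rotN60.
by move: (rotN60 _) => w; apply: plane_ext; rewrite !planeE; ring.
Qed.

Lemma frame_rot2 a b c :
  frame (apex a b, a) c = frame (a, b) (1 - c.1 - c.2, c.1 - 1).
Proof.
have := frame_rot b (apex a b) c; rewrite apex_apex => ->; rewrite frame_rot /=.
by congr frame; apply: plane_ext => /=; ring.
Qed.

(** The edges of the n-th polygonal approximation. *)
Inductive snow_edge a b : nat -> (R * R) * (R * R) -> Prop :=
| snow_edge0 : snow_edge a b 0 (a, b)
| snow_edge1 : snow_edge a b 0 (b, apex a b)
| snow_edge2 : snow_edge a b 0 (apex a b, a)
| snow_edgeS n i e : snow_edge a b n e -> snow_edge a b n.+1 (koch_child i e).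

Lemma snow_edgeSP a b n e : snow_edge a b n.+1 e ->
  exists i e', snow_edge a b n e' /\ e = koch_child i e'.
Proof. by move=> abe; inversion abe as [| | |? i e' abe']; exists i, e'. Qed.

Lemma snow_edge_len a b n e : snow_edge a b n e -> elen e = elen (a, b) / 3 ^+ n.
Proof.
elim=> [|||{}n i {}e _ eE]; rewrite ?expr0 ?divr1 ?elen_rot//.
  by have := elen_rot b (apex a b); rewrite apex_apex elen_rot.
by rewrite elen_child eE exprSr invfM mulrA.
Qed.

Lemma snow_edge_koch a b n e : snow_edge a b n e -> koch e `<=` snow a b.
Proof.
elim=> [|||{}n i {}e _ IHe] z ez; [by do 2 left|by left; right|by right|].
by apply: IHe; apply/koch_childP; exists i.
Qed.

Lemma snow_edge_exists a b n z : snow a b z -> exists2 e, snow_edge a b n e & koch e z.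
Proof.
elim: n => [|n IHn] abz; last first.
  have [e abe /koch_childP[i iz]] := IHn abz.
  by exists (koch_child i e) => //; exact: snow_edgeS.
case: abz => [[]|] abz; [exists (a, b)|exists (b, apex a b)|exists (apex a b, a)] => //.
- exact: snow_edge0.
- exact: snow_edge1.
- exact: snow_edge2.
Qed.

Lemma child_coord_meet i j e c c' : htri c -> htri c' ->
  child_coord i c = child_coord j c' ->
  [\/ koch_child i e = koch_child j e, c = (0, 0) | c = (1, 0)].
Proof.
case: c c' => x y [x' y'] [/= ? ? ?] [/= ? ? ?].
by case: i => [|[|[|i]]]; case: j => [|[|[|j]]] //= [h1 h2];
  by [constructor 1|constructor 2; congr pair; lra|constructor 3; congr pair; lra].
Qed.

Lemma snow_root_meet a b c c' : htri c -> htri c' ->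
  [/\ c = (1 + c'.2, - c'.1 - c'.2) -> c = (1, 0) /\ c' = (0, 0),
      c = (1 - c'.1 - c'.2, c'.1 - 1) -> c = (0, 0) /\ c' = (1, 0) &
      (1 + c.2, - c.1 - c.2) = (1 - c'.1 - c'.2, c'.1 - 1) -> c = (1, 0) /\ c' = (0, 0)].
Proof.
case: c c' => x y [x' y'] [/= ? ? ?] [/= ? ? ?].
by split => -[h1 h2]; split; congr pair; lra.
Qed.

(** The hats of the edges of a given level only meet at their vertices. *)
Lemma snow_hat_koch a b n e z : elen (a, b) != 0 -> snow_edge a b n e ->
  snow a b z -> hat e z -> koch e z.
Proof.
move=> ab0; elim=> [|||{}n i {}e abe IHe] abz.
- move=> [c Tc zE]; case: abz => [[//|]|] /koch_hat[c' Tc' z'E].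
  + move: zE z'E => -> ; rewrite frame_rot => /(frame_inj ab0) cc'.
    have [/(_ cc')[-> _] _ _] := snow_root_meet a b Tc Tc'.
    by rewrite frame_10; exact: koch_snd.
  + move: zE z'E => -> ; rewrite frame_rot2 => /(frame_inj ab0) cc'.
    have [_ /(_ cc')[-> _] _] := snow_root_meet a b Tc Tc'.
    by rewrite frame_00; exact: koch_fst.
- move=> [c Tc zE]; case: abz => [[|//]|] /koch_hat[c' Tc' z'E].
  + move: z'E zE => -> ; rewrite frame_rot => /(frame_inj ab0) cc'.
    have [/(_ cc')[-> _] _ _] := snow_root_meet a b Tc' Tc.
    by rewrite frame_10; exact: (@koch_fst _ (b, apex a b)).
  + move: zE z'E => -> ; rewrite frame_rot2 {1}frame_rot => /(frame_inj ab0) cc'.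
    have [_ _ /(_ cc')[-> _]] := snow_root_meet a b Tc Tc'.
    by rewrite frame_10; exact: koch_snd.
- move=> [c Tc zE]; case: abz => [[|]|//] /koch_hat[c' Tc' z'E].
  + move: z'E zE => -> ; rewrite frame_rot2 => /(frame_inj ab0) cc'.
    have [_ /(_ cc')[-> _] _] := snow_root_meet a b Tc' Tc.
    by rewrite frame_00; exact: (@koch_snd _ (apex a b, a)).
  + move: z'E zE => -> ; rewrite frame_rot2 {1}frame_rot => /(frame_inj ab0) cc'.
    have [_ _ /(_ cc')[-> _]] := snow_root_meet a b Tc' Tc.
    by rewrite frame_10; exact: (@koch_fst _ (apex a b, a)).
- move=> iz; have /koch_childP[j jz] := IHe abz (hat_child iz).
  have [c' Tc' z'E] := koch_hat jz; case: iz => c Tc zE.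
  have e0 : elen e != 0.
    by rewrite (snow_edge_len abe) mulf_neq0// invr_neq0// expf_neq0// pnatr_eq0.
  have := z'E; rewrite {1}zE !frame_child => /(frame_inj e0) cc'.
  have [->//|c0|c1] := child_coord_meet e Tc Tc' cc'.
    by rewrite zE c0 frame_00; exact: koch_fst.
  by rewrite zE c1 frame_10; exact: koch_snd.
Qed.

Lemma frame_segment e c c' (t : R) :
  frame e c + t *: (frame e c' - frame e c) = frame e (c + t *: (c' - c)).
Proof.
rewrite /frame; move: (rotN60 _) => w; apply: plane_ext; rewrite !planeE; ring.
Qed.

(** The three gaps of a hat: the two triangles that it leaves outside the curve
    and the triangle added on the middle third of its base. *)
Definition left_gap : set (R * R) :=
  [set c | [/\ c.2 <= c.1, 3^-1 < c.1 + 2 * c.2 & 2 * c.1 + c.2 < 2 / 3]].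
Definition right_gap : set (R * R) :=
  [set c | [/\ c.1 + 2 * c.2 <= 1, c.1 - c.2 < 2 / 3 & 4 / 3 < 2 * c.1 + c.2]].
Definition mid_gap : set (R * R) :=
  [set c | [/\ 0 <= c.2, 3^-1 < c.1 & c.1 + c.2 < 2 / 3]].

(** In a hat the snowflake consists of the curve of that hat, which is contained
    in the four hats of the children, and these do not meet the gaps. *)
Lemma gap_not_snow a b n e c : elen (a, b) != 0 -> snow_edge a b n e ->
  (left_gap `|` right_gap `|` mid_gap) c -> ~ snow a b (frame e c).
Proof.
move=> ab0 abe gap ec; have e0 : elen e != 0.
  by rewrite (snow_edge_len abe) mulf_neq0// invr_neq0// expf_neq0// pnatr_eq0.
have Tc : htri c by case: c gap {ec} => x y /= [[[]|[]]|[]] /= *; split=> /=; lra.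
have /koch_childP[i /koch_hat[c' Tc' ]] := snow_hat_koch ab0 abe ec (ex_intro2 _ _ c Tc erefl).
rewrite frame_child => /(frame_inj e0).
case: c c' gap Tc Tc' {ec} => x y [x' y'] gap [/= ? ? ?] [/= ? ? ?].
by case: i => [|[|[|i]]] /= [h1 h2]; case: gap => /= [[[]|[]]|[]] /= *; lra.
Qed.

Section Domain.
Variables (Om : set (R * R)).

Lemma snowflake_domain_rot a b :
  snowflake_domain a b Om -> snowflake_domain b (apex a b) Om.
Proof. by case=> oO bO cO dO; split; rewrite // snowflakeE snow_rot -snowflakeE. Qed.

Section Base.
Variables (a b : R * R).
Hypothesis ab0 : elen (a, b) != 0.
Hypothesis OmP : snowflake_domain a b Om.

Let open_Om : open Om. Proof. by case: OmP. Qed.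
Let boundary_Om : boundary Om = snow a b.
Proof. by case: OmP => _ _ _ ->; exact: snowflakeE. Qed.

Lemma domain_not_snow z : Om z -> ~ snow a b z.
Proof.
rewrite -boundary_Om => Oz [_]; apply.
by move: open_Om; rewrite openE => /(_ _ Oz).
Qed.

Lemma frame_segment_domain e c c' :
  (forall t, 0 <= t <= 1 -> ~ snow a b (frame e (c + t *: (c' - c)))) ->
  Om (frame e c) <-> Om (frame e c').
Proof.
move=> off; split; apply: segment_avoid_boundary => // t t01;
  rewrite boundary_Om frame_segment; first exact: off.
have -> : c' + t *: (c - c') = c + (1 - t) *: (c' - c).
  by apply: plane_ext; rewrite !planeE; ring.
by apply: off; lra.
Qed.

(** Far away on the half-line the points are outside the domain, which is bounded,
    and no boundary point separates them from the origin of the half-line. *)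
Lemma ray_not_domain e c v : elen e != 0 -> qform v = 1 ->
  (forall t, 0 <= t -> ~ snow a b (frame e (c + t *: v))) -> ~ Om (frame e c).
Proof.
move=> e0 v1 off Oc; have e_gt0 : 0 < elen e by rewrite lt_neqAle eq_sym e0 elen_ge0.
case: OmP => _ /bounded_enormP[M M0 OM] _ _.
pose t : R := (2 * M + 1) / elen e; have t0 : 0 <= t by rewrite divr_ge0//; lra.
have Oct : Om (frame e (c + t *: v)).
  apply: (@frame_segment_domain e c (c + t *: v) _).1 Oc => r r01.
  rewrite [c + t *: v]addrC addrK scalerA; apply: off.
  by rewrite mulr_ge0//; lra.
have : enorm (frame e (c + t *: v) - frame e c) <= 2 * M.
  by have := OM _ Oct; have := OM _ Oc; have := ler_enormD (frame e (c + t *: v)) (- frame e c);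
     rewrite enormN; lra.
rewrite enorm_frame [c + _]addrC addrK.
have -> : qform (t *: v) = t ^+ 2.
  rewrite -[RHS]mulr1 -v1 /qform !planeE; ring.
by rewrite sqrtr_sqr ger0_norm// /t mulrC divfK//; lra.
Qed.

(** Outside the hats of the three sides a half-line pointing away from the
    triangle never meets the snowflake. *)
Lemma above_not_domain c : ~ snow a b (frame (a, b) c) ->
  c.1 <= c.2 \/ 1 <= c.1 + 2 * c.2 -> ~ Om (frame (a, b) c).
Proof.
move=> abc; suff out v : qform v = 1 ->
    (forall t, 0 < t -> ~ snow a b (frame (a, b) (c + t *: v))) -> ~ Om (frame (a, b) c).
  have hatE w : snow a b (frame (a, b) w) -> w.2 <= w.1 /\ w.1 + 2 * w.2 <= 1.
    move=> [[]|] /koch_hat[[x y] [/= ? ? ?]]; rewrite ?frame_rot ?frame_rot2 => /(frame_inj ab0) -> /=; lra.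
  by case=> cP; [apply: (out (-1, 1))|apply: (out (1, 0))];
    rewrite /qform /=; try (by lra); move=> t t0 /hatE; rewrite !planeE /=; lra.
move=> v1 off; apply: (ray_not_domain ab0 v1) => t.
by rewrite le_eqVlt => /predU1P[<-|]; [rewrite scale0r addr0|exact: off].
Qed.

(** The center of the triangle on the left of the edge. *)
Definition center : R * R := (2 / 3, - 3^-1).

Lemma below_domain c : ~ snow a b (frame (a, b) c) ->
  c.2 <= 0 -> c.1 <= 1 -> 0 <= c.1 + c.2 ->
  Om (frame (a, b) c) <-> Om (frame (a, b) center).
Proof.
move=> abc c2 c1 c12; apply: frame_segment_domain => t /andP[].
rewrite le_eqVlt => /predU1P[<- _|t0 t1]; first by rewrite scale0r addr0.
have hatE w : snow a b (frame (a, b) w) -> ~ [/\ w.2 < 0, w.1 < 1 & 0 < w.1 + w.2].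
  move=> [[]|] /koch_hat[[x y] [/= ? ? ?]]; rewrite ?frame_rot ?frame_rot2 => /(frame_inj ab0) -> /= []; lra.
move=> /hatE; apply; rewrite !planeE /center /=; split; nra.
Qed.

End Base.

Lemma center_rot a b : frame (b, apex a b) center = frame (a, b) center.
Proof. by rewrite frame_rot /center; congr frame; apply: plane_ext => /=; lra. Qed.

Section Levels.
Variables (a b : R * R).
Hypothesis ab0 : elen (a, b) != 0.
Hypothesis OmP : snowflake_domain a b Om.

Let bc0 : elen (b, apex a b) != 0. Proof. by rewrite elen_rot. Qed.
Let ca0 : elen (apex a b, a) != 0.
Proof. by have := elen_rot b (apex a b); rewrite apex_apex => ->. Qed.
Let bcP := snowflake_domain_rot OmP.
Let caP : snowflake_domain (apex a b) a Om.
Proof. by have := snowflake_domain_rot bcP; rewrite apex_apex. Qed.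
Let snow_bc : snow b (apex a b) = snow a b := snow_rot a b.
Let snow_ca : snow (apex a b) a = snow a b.
Proof. by have := snow_rot b (apex a b); rewrite apex_apex snow_rot. Qed.

Let root_rect (P : (R * R) * (R * R) -> Prop) :
  (forall a' b', elen (a', b') != 0 -> snowflake_domain a' b' Om ->
    snow a' b' = snow a b -> frame (a', b') center = frame (a, b) center ->
    P (a', b')) -> forall e, snow_edge a b 0 e -> P e.
Proof.
move=> H e; move m0 : 0%N => m me; case: me m0 => // _.
- exact: H.
- by apply: H => //; exact: center_rot.
- by apply: H => //; have := center_rot b (apex a b); rewrite apex_apex center_rot.
Qed.

Let gap_segment n e c c' : snow_edge a b n e -> ~ snow a b (frame e c) ->
  (forall t : R, 0 < t -> t <= 1 ->
    (left_gap `|` right_gap `|` mid_gap) (c + t *: (c' - c))) ->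
  Om (frame e c) <-> Om (frame e c').
Proof.
move=> abe ec gap; apply: (frame_segment_domain OmP) => t /andP[].
rewrite le_eqVlt => /predU1P[<- _|t0 t1]; first by rewrite scale0r addr0.
exact: gap_not_snow ab0 abe (gap t t0 t1).
Qed.

(* The midpoints of the parts of the two sides of the parent hat that bound its
   outer gaps. *)
Let m_left : R * R := (6^-1, 6^-1).
Let m_right : R * R := (2 / 3, 6^-1).

Let to_left n e c : snow_edge a b n e -> ~ snow a b (frame e c) ->
  c.2 <= c.1 -> 3^-1 <= c.1 + 2 * c.2 -> 2 * c.1 + c.2 <= 2 / 3 ->
  Om (frame e c) <-> Om (frame e m_left).
Proof.
move=> abe ec h1 h2 h3; apply: (gap_segment abe ec) => t t0 t1.
by left; left; rewrite /left_gap /mkset !planeE /=; split; nra.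
Qed.

Let to_right n e c : snow_edge a b n e -> ~ snow a b (frame e c) ->
  c.1 + 2 * c.2 <= 1 -> c.1 - c.2 <= 2 / 3 -> 4 / 3 <= 2 * c.1 + c.2 ->
  Om (frame e c) <-> Om (frame e m_right).
Proof.
move=> abe ec h1 h2 h3; apply: (gap_segment abe ec) => t t0 t1.
by left; right; rewrite /right_gap /mkset !planeE /=; split; nra.
Qed.

Let to_base n e c : snow_edge a b n e -> ~ snow a b (frame e c) ->
  0 <= c.2 -> 3^-1 <= c.1 -> c.1 + c.2 <= 2 / 3 ->
  Om (frame e c) <-> Om (frame e (2^-1, 0)).
Proof.
move=> abe ec h1 h2 h3; apply: (gap_segment abe ec) => t t0 t1.
by right; rewrite /mid_gap /mkset !planeE /=; split; nra.
Qed.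

(** A side of a hat either lies on a side of the parent hat or faces one of
    its outer gaps, whose third side is on a side of the parent hat. *)
Lemma side_not_domain n e c : snow_edge a b n e -> htri c ->
  c.1 = c.2 \/ c.1 + 2 * c.2 = 1 -> ~ snow a b (frame e c) -> ~ Om (frame e c).
Proof.
move: n e c; elim=> [|n IHn] e c abe.
  move: e abe c; apply: root_rect => a' b' a'b'0 Om' <- _ c _ cP ec.
  by apply: (above_not_domain a'b'0 Om' ec); case: cP => ->; [left|right].
have [i [{}e [{}abe ->]]] := snow_edgeSP abe => Tc cP ec; move: (child_coord_htri i Tc) ec; rewrite !frame_child => Tc'.
have left_out c' : snow_edge a b n e -> ~ snow a b (frame e c') ->
    c'.2 <= c'.1 -> 3^-1 <= c'.1 + 2 * c'.2 -> 2 * c'.1 + c'.2 <= 2 / 3 ->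
    ~ Om (frame e c').
  move=> _ ec' h1 h2 h3; rewrite (to_left abe ec' h1 h2 h3).
  apply: IHn => //; [by split => /=; lra|by left|].
  by apply: gap_not_snow ab0 abe _; left; left; split => /=; lra.
have right_out c' : snow_edge a b n e -> ~ snow a b (frame e c') ->
    c'.1 + 2 * c'.2 <= 1 -> c'.1 - c'.2 <= 2 / 3 -> 4 / 3 <= 2 * c'.1 + c'.2 ->
    ~ Om (frame e c').
  move=> _ ec' h1 h2 h3; rewrite (to_right abe ec' h1 h2 h3).
  apply: IHn => //; [by split => /=; lra|by right => /=; lra|].
  by apply: gap_not_snow ab0 abe _; left; right; split => /=; lra.
case: c Tc cP Tc' => x y [/= y0 yx xy] cP Tc' ec.
case: i cP Tc' ec => [|[|[|i]]] /= [xyE|xyE] Tc' ec.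
- by apply: IHn => //=; left; lra.
- by apply: left_out => //=; lra.
- by apply: left_out => //=; lra.
- by apply: IHn => //=; left; lra.
- by apply: IHn => //=; right; lra.
- by apply: right_out => //=; lra.
- by apply: right_out => //=; lra.
- by apply: IHn => //=; right; lra.
Qed.

(** The base of a hat either lies on the base of the parent hat or is a side of
    its mid_gap, whose third side is on the base of the parent hat. *)
Lemma base_domain n e (x : R) : snow_edge a b n e -> 0 <= x <= 1 ->
  ~ snow a b (frame e (x, 0)) ->
  Om (frame e (x, 0)) <-> Om (frame (a, b) center).
Proof.
move: n e x; elim=> [|n IHn] e x abe x01.
  move: e abe; apply: root_rect => a' b' a'b'0 Om' <- <- ec.
  by apply: (below_domain a'b'0 Om' ec) => /=; lra.
have [i [{}e [{}abe ->]]] := snow_edgeSP abe; rewrite !frame_child => ec.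
have mid : Om (frame e (2^-1, 0)) <-> Om (frame (a, b) center).
  apply: IHn => //; first by lra.
  by apply: gap_not_snow ab0 abe _; right; split => /=; lra.
case: i ec => [|[|[|i]]] /= ec.
- by rewrite mul0r; rewrite mul0r in ec; apply: IHn => //; lra.
- by apply: iff_trans (to_base abe ec _ _ _) mid => /=; lra.
- by apply: iff_trans (to_base abe ec _ _ _) mid => /=; lra.
- by rewrite mul0r; rewrite mul0r in ec; apply: IHn => //; lra.
Qed.

(** The gap under the bump is connected to the base of the hat. *)
Lemma bump_domain n e c : snow_edge a b n e -> ~ snow a b (frame e c) ->
  0 <= c.2 -> 3^-1 <= c.1 -> c.1 + c.2 <= 2 / 3 ->
  Om (frame e c) <-> Om (frame (a, b) center).
Proof.
move=> abe ec h1 h2 h3; apply: iff_trans (to_base abe ec h1 h2 h3) _.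
apply: (base_domain abe); first by lra.
by apply: gap_not_snow ab0 abe _; right; split => /=; lra.
Qed.

(** A hat is the union of the hats of its children and of its three gaps; the outer
    gaps are never in the domain, and the third one is so only together with the
    center. *)
Let hat_child_cover n e c : snow_edge a b n e -> htri c -> Om (frame e c) ->
  ~ Om (frame (a, b) center) -> exists i, hat (koch_child i e) (frame e c).
Proof.
move=> abe Tc ec ncenter; have nc := domain_not_snow OmP ec.
have sub i c' : htri c' -> c = child_coord i c' ->
    exists i, hat (koch_child i e) (frame e c).
  by move=> Tc' ->; exists i, c' => //; rewrite frame_child.
have out w : Om (frame e c) <-> Om w -> ~ Om w -> False by move=> <-; exact.
have nleft : ~ Om (frame e m_left).
  apply: (side_not_domain abe); [by split => /=; lra|by left|].
  by apply: gap_not_snow ab0 abe _; left; left; split => /=; lra.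
have nright : ~ Om (frame e m_right).
  apply: (side_not_domain abe); [by split => /=; lra|by right => /=; lra|].
  by apply: gap_not_snow ab0 abe _; left; right; split => /=; lra.
case: Tc => h1 h2 h3.
have [x1|/ltW x1] := leP (c.1 + 2 * c.2) 3^-1.
  apply: (sub 0%N (3 * c.1, 3 * c.2)); first by split => /=; lra.
  by apply: plane_ext => /=; lra.
have [x2|/ltW x2] := leP (2 * c.1 + c.2) (2 / 3).
  by exfalso; apply: out nleft; exact: to_left abe nc _ _ _.
have [x3|/ltW x3] := leP c.1 3^-1.
  apply: (sub 1%N (3 * c.2 - 1 + 3 * c.1, 1 - 3 * c.1)); first by split => /=; lra.
  by apply: plane_ext => /=; lra.
have [x4|/ltW x4] := leP (c.1 + c.2) (2 / 3).
  by exfalso; apply: out ncenter; exact: bump_domain abe nc _ _ _.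
have [x5|/ltW x5] := leP (2 * c.1 + c.2) (4 / 3).
  apply: (sub 2 (1 - 3 * c.2, 3 * c.1 + 3 * c.2 - 2)); first by split => /=; lra.
  by apply: plane_ext => /=; lra.
have [x6|/ltW x6] := leP (c.1 - c.2) (2 / 3).
  by exfalso; apply: out nright; exact: to_right abe nc _ _ _.
apply: (sub 3 (3 * c.1 - 2, 3 * c.2)); first by split => /=; lra.
by apply: plane_ext => /=; lra.
Qed.

Let above_hat a' b' c : elen (a', b') != 0 -> snowflake_domain a' b' Om ->
  0 <= c.2 -> Om (frame (a', b') c) -> htri c.
Proof.
move=> a'b'0 Om' c2 a'b'c; have nc := domain_not_snow Om' a'b'c.
have [c12|/ltW c12] := leP c.2 c.1; last first.
  by exfalso; apply: (above_not_domain a'b'0 Om' nc) => //; left.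
have [c1|/ltW c1] := leP (c.1 + 2 * c.2) 1; first by split.
by exfalso; apply: (above_not_domain a'b'0 Om' nc) => //; right.
Qed.

(** Otherwise every point of the domain would lie in a hat of every level, hence
    on the curve. *)
Lemma center_domain : Om !=set0 -> Om (frame (a, b) center).
Proof.
move=> [z Oz]; apply: contrapT => ncenter.
have root : exists2 e, snow_edge a b 0 e & hat e z.
  have [c zE] := frame_surj z ab0; have := Oz; rewrite zE => Oc.
  have nc := domain_not_snow OmP Oc.
  have [c2|c2] := leP 0 c.2.
    by exists (a, b); [exact: snow_edge0|exists c => //; exact: above_hat c2 Oc].
  have [c1|c1] := leP 1 c.1.
    have cE : frame (a, b) c = frame (b, apex a b) (- c.2 - (c.1 - 1), c.1 - 1).
      by rewrite frame_rot; congr frame; apply: plane_ext => /=; ring.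
    exists (b, apex a b); first exact: snow_edge1.
    by rewrite cE; eexists; [|reflexivity]; apply: (above_hat bc0 bcP) => /=; [lra|rewrite -cE].
  have [c12|c12] := leP 0 (c.1 + c.2).
    by case: ncenter; apply/(below_domain ab0 OmP nc) => //; exact: ltW.
  have cE : frame (a, b) c = frame (apex a b, a) (c.2 + 1, - c.1 - c.2).
    by rewrite frame_rot2; congr frame; apply: plane_ext => /=; ring.
  exists (apex a b, a); first exact: snow_edge2.
  by rewrite cE; eexists; [|reflexivity]; apply: (above_hat ca0 caP) => /=; [lra|rewrite -cE].
have level n : exists2 e, snow_edge a b n e & hat e z.
  elim: n => // n [e abe [c Tc zE]]; have := Oz; rewrite zE => ec.
  have [i iz] := hat_child_cover abe Tc ec ncenter.
  by exists (koch_child i e) => //; exact: snow_edgeS.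
apply: (domain_not_snow OmP Oz); rewrite (closure_id (snow a b)).1; last exact: closed_snow.
apply/closure_eballP => r r0.
have [e abe ez] := level (Num.bound (elen (a, b) / r)).
exists e.1; first exact: (snow_edge_koch abe (@koch_fst _ e)).
apply: le_lt_trans (hat_diam ez (hat_fst e)) _.
rewrite (snow_edge_len abe) ltr_pdivrMr ?exprn_gt0// mulrC -ltr_pdivrMr//.
apply: lt_le_trans (archi_boundP _) _; first by rewrite divr_ge0 ?elen_ge0 ?ltW.
by rewrite -natrX ler_nat ltnW// ltn_expl.
Qed.

End Levels.

End Domain.

End Snowflake.

(** * Measure density of the domain *)

Section PlaneMeasure.
Context {R : realType}.
Implicit Types (x y z : R * R) (A : set (R * R)).

Definition box z (h : R) : set (mplane R) :=
  `]z.1 - h, z.1 + h[%classic `*` `]z.2 - h, z.2 + h[%classic.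

Lemma boxP z (h : R) y : box z h y <-> `|z.1 - y.1| < h /\ `|z.2 - y.2| < h.
Proof. by rewrite /box /= !in_itv/= !ltr_distlC. Qed.

Lemma measurable_box z (h : R) : measurable (box z h).
Proof. by apply: measurableX; exact: measurable_itv. Qed.

Lemma lebesgue2_box z (h : R) : 0 <= h -> lebesgue2 (box z h) = (4 * h ^+ 2)%:E.
Proof.
move=> h0; have len (t : R) : (@lebesgue_measure R) `]t - h, t + h[%classic = (2 * h)%:E.
  rewrite lebesgue_measure_itv/= lte_fin; case: ifPn => [_|]; first by congr EFin; ring.
  by rewrite -leNgt => ?; congr EFin; lra.
transitivity ((2 * h)%:E * (2 * h)%:E)%E; last by rewrite -EFinM; congr EFin; ring.
rewrite -{1}(len z.1) -(len z.2).
by apply: product_measure1E; exact: measurable_itv.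
Qed.

Lemma box_eball z (h : R) : box z h `<=` eball z (2 * h).
Proof.
move=> y /boxP[z1 z2]; rewrite /eball /=; apply: le_lt_trans (enorm_le_sum _) _.
by rewrite mulr_natl mulr2n; exact: ltrD.
Qed.

Lemma eball_box z (h : R) : eball z h `<=` box z h.
Proof.
move=> y zy; apply/boxP; split; apply: le_lt_trans zy.
  exact: (le_enorm1 (z - y)).
exact: (le_enorm2 (z - y)).
Qed.

(** An open set is a countable union of squares with rational centers. *)
Lemma open_measurable_plane A : open A -> measurable (A : set (mplane R)).
Proof.
move=> oA; pose B (i : rat * rat * nat) := box (ratr i.1.1, ratr i.1.2) (i.2.+1%:R^-1).
have -> : A = \bigcup_(i in [set i | B i `<=` A]) B i.
  apply/seteqP; split=> [z Az|z [i iA iz]]; last exact: iA.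
  have [r r0 rA] := (open_eballP A).1 oA z Az.
  pose n := Num.bound (4 / r); pose h : R := n.+1%:R^-1.
  have h0 : 0 < h by rewrite invr_gt0 ltr0n.
  have hr : 4 * h <= r.
    rewrite /h -ler_pdivlMr ?invr_gt0 ?ltr0n// invrK mulrC -ler_pdivrMr//.
    apply: le_trans (ltW (archi_boundP _)) _; first by rewrite divr_ge0// ltW.
    by rewrite ler_nat.
  have rat_near (t : R) : exists q : rat, `|ratr q - t| < h.
    have [q] := @rat_in_itvoo R (t - h) (t + h) ltac:(lra).
    by rewrite in_itv/= => qt; exists q; rewrite ltr_distl.
  have [q1 q1z] := rat_near z.1; have [q2 q2z] := rat_near z.2.
  exists (q1, q2, n); last by apply/boxP.
  move=> y /boxP[/= q1y q2y]; apply: rA; rewrite /eball /=.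
  apply: le_lt_trans (enorm_le_sum _) _; apply: lt_le_trans hr.
  have -> : 4 * h = (h + h) + (h + h) by ring.
  apply: ltrD; rewrite /=.
    by apply: le_lt_trans (ler_distD (ratr q1) _ _) _; rewrite ltrD// distrC.
  by apply: le_lt_trans (ler_distD (ratr q2) _ _) _; rewrite ltrD// distrC.
rewrite bigcup_mkcond; apply: countable_bigcupT_measurable => // i.
by case: ifP => // _; exact: measurable_box.
Qed.

Lemma closed_measurable_plane A : closed A -> measurable (A : set (mplane R)).
Proof.
move=> cA; rewrite -[A]setCK; apply: measurableC; apply: open_measurable_plane.
exact: closed_openC.
Qed.

Lemma open_eball z (r : R) : open (eball z r).
Proof.
apply/open_eballP => y zy; exists (r - enorm (z - y)); first by rewrite subr_gt0.
move=> w yw; apply: le_lt_trans (enormB_triangle y z w) _.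
by move: yw; rewrite /eball /=; lra.
Qed.

Lemma measurable_eball z (r : R) : measurable (eball z r : set (mplane R)).
Proof. by apply: open_measurable_plane; exact: open_eball. Qed.

Lemma lebesgue2_eball_ge y (r : R) A : 0 <= r -> measurable (A : set (mplane R)) ->
  eball y r `<=` A -> ((r ^+ 2)%:E <= lebesgue2 (A : set (mplane R)))%E.
Proof.
move=> r0 mA rA; apply: (@le_trans _ _ (lebesgue2 (box y (r / 2)))).
  by rewrite lebesgue2_box ?divr_ge0// lee_fin; lra.
apply: le_measure; rewrite ?inE//; first exact: measurable_box.
apply: subset_trans rA; apply: subset_trans (@box_eball y (r / 2)) _.
by rewrite mulrC divfK.
Qed.

Lemma lebesgue2_bounded A : bounded_set A -> measurable (A : set (mplane R)) ->
  (lebesgue2 (A : set (mplane R)) < +oo)%E.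
Proof.
move=> /bounded_enormP[M M0 AM] mA.
apply: (@le_lt_trans _ _ (lebesgue2 (box 0 (M + 1)))).
  apply: le_measure; rewrite ?inE//; first exact: measurable_box.
  move=> z Az; apply: eball_box; rewrite /eball /= sub0r enormN.
  by apply: le_lt_trans (AM z Az) _; rewrite ltrDl.
by rewrite lebesgue2_box ?ltry// addr_ge0// ltW.
Qed.

Section Density.
Variables (a b : R * R) (Om : set (R * R)).
Hypothesis ab0 : elen (a, b) != 0.
Hypothesis OmP : snowflake_domain a b Om.

Lemma domain_nonempty : Om !=set0.
Proof.
have [_ _ _ dO] := OmP; have : boundary Om a.
  by rewrite dO snowflakeE; do 2 left; exact: (@koch_fst _ (a, b)).
by case=> [aO _]; have [z [Oz _]] := aO _ (filterT : nbhs a setT); exists z.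
Qed.

Let L := elen (a, b).
Let L0 : 0 < L. Proof. by rewrite lt_neqAle eq_sym ab0 elen_ge0. Qed.

(** A point of the curve lies on the arc of an edge of comparable length, and
    the triangle added on the middle third of that edge is in the domain. *)
Let corkscrew_curve z (r : R) : snow a b z -> 0 < r -> r <= L ->
  exists y, eball y (r / 60) `<=` eball z r `&` Om.
Proof.
move=> abz r0 rL.
have nex : exists n, L / 3 ^+ n < r.
  exists (Num.bound (L / r)); rewrite ltr_pdivrMr ?exprn_gt0// mulrC -ltr_pdivrMr//.
  apply: lt_le_trans (archi_boundP _) _; first by rewrite divr_ge0 ?ltW.
  by rewrite -natrX ler_nat ltnW// ltn_expl.
case: (ex_minnP nex) => -[|n] nr nmin.
  by move: nr rL; rewrite expr0 divr1; lra.
have {nmin} rn : r <= L / 3 ^+ n.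
  by rewrite leNgt; apply/negP => /nmin; rewrite ltnn.
have [e abe ez] := snow_edge_exists n.+1 abz.
have eL := snow_edge_len abe; rewrite -/L in eL.
have er : r / 3 <= elen e < r.
  by rewrite eL nr exprSr invfM mulrA ler_pM2r ?invr_gt0//= andbT.
have e0 : elen e != 0 by rewrite gt_eqF//; lra.
(* The centroid of the triangle with vertices (1/3, 0), (2/3, 0), (1/3, 1/3). *)
pose m : R * R := (4 / 9, 9^-1); exists (frame e m) => y.
have [c ->] := frame_surj y e0; rewrite /eball /= => mc.
have q : qform (m - c) < 20^-1 ^+ 2.
  rewrite ltNge; apply/negP => /(enorm_frame_ge e (_ : 0 <= 20^-1)).
  by move=> /(_ ltac:(lra)); lra.
have small (t : R) : 3 / 4 * t ^+ 2 <= qform (m - c) -> - 9^-1 < t < 9^-1.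
  by move=> tq; rewrite -ltr_norml -(@ltr_pXn2r _ 2)// ?nnegrE// real_normK ?num_real//; lra.
have /andP[c1l c1r] := small _ (qform_ge_fst (m - c)).
have /andP[c2l c2r] := small _ (qform_ge_snd (m - c)).
have /andP[c3l c3r] : - 9^-1 < (m - c).1 + (m - c).2 < 9^-1.
  apply: small; have -> : qform (m - c) = 3 / 4 * ((m - c).1 + (m - c).2) ^+ 2 +
    (((m - c).1 - (m - c).2) / 2) ^+ 2 by rewrite /qform; field.
  by rewrite lerDl sqr_ge0.
rewrite /m /= in c1l c1r c2l c2r c3l c3r.
have gap : mid_gap c by split => /=; lra.
have nc := gap_not_snow ab0 abe (or_intror gap).
split.
  apply: le_lt_trans (hat_diam (koch_hat ez) (ex_intro2 _ _ c _ erefl)) _.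
    by split => /=; lra.
  by lra.
case: gap => g1 g2 g3; apply/(bump_domain ab0 OmP abe nc) => //; try exact: ltW.
exact: center_domain OmP domain_nonempty.
Qed.

(** Far from the boundary a ball around x is in the domain; otherwise x is moved
    to a point of the boundary. *)
Lemma corkscrew x (r : R) : closure Om x -> 0 < r -> r <= L ->
  exists y, eball y (r / 120) `<=` eball x r `&` Om.
Proof.
move=> Ox r0 rL; have [oO _ _ dO] := OmP.
have [[z abz xz]|far] := pselect (exists2 z, snow a b z & enorm (x - z) < r / 2).
  have [|y yz] := @corkscrew_curve z (r / 2) abz (divr_gt0 r0 (ltr0n _ 2)) _; first by lra.
  exists y => w; have -> : r / 120 = r / 2 / 60 by field.
  move=> /yz[zw Ow]; split => //; rewrite /eball /=.
  by apply: le_lt_trans (enormB_triangle z x w) _; move: zw; rewrite /eball /=; lra.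
have Omx : Om x.
  apply: contrapT => nOx; apply: far; exists x.
    by rewrite -snowflakeE -dO; split => // /interior_subset.
  by rewrite subrr enorm0; lra.
exists x => y; rewrite /eball /= => xy; split; first by lra.
apply: (segment_avoid_boundary oO _ Omx) => t /andP[t0 t1].
rewrite dO snowflakeE => abt; apply: far; exists (x + t *: (y - x)) => //.
rewrite opprD addrA subrr sub0r enormN enormZ ger0_norm// enormC.
by have : t * enorm (x - y) <= enorm (x - y) by [rewrite ler_piMl ?enorm_ge0]; lra.
Qed.

Lemma domain_density : exists k R0 : R, [/\ 0 < k, 0 < R0,
  forall x, closure Om x -> Om `<=` eball x R0 &
  forall x r, closure Om x -> 0 < r -> r <= R0 ->
    ((k * r ^+ 2)%:E <= lebesgue2 (eball x r `&` Om : set (mplane R)))%E].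
Proof.
have [oO /bounded_enormP[M M0 OM] _ _] := OmP.
pose R0 := Num.max L (2 * M + 1).
have LR0 : L <= R0 by rewrite le_max lexx.
have R00 : 0 < R0 := lt_le_trans L0 LR0.
(* Radii up to R0, larger than the edge, are first shrunk by the factor L / R0. *)
exists ((L / R0 / 120) ^+ 2), R0; split => //.
- by rewrite exprn_gt0// !divr_gt0.
- move=> x Ox y Oy; have [w Ow xw] := (closure_eballP Om x).1 Ox 1 ltr01.
  have yw : enorm (w - y) <= 2 * M.
    by have := OM _ Ow; have := OM _ Oy; have := ler_enormD w (- y); rewrite enormN; lra.
  rewrite /eball /= lt_max; apply/orP; right.
  by apply: le_lt_trans (enormB_triangle w x y) _; lra.
- move=> x r Ox r0 rR0; pose r' := r * (L / R0).
  have r'0 : 0 < r' by rewrite mulr_gt0 ?divr_gt0.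
  have r'L : r' <= L by rewrite /r' mulrA ler_pdivrMr// mulrC ler_pM2l.
  have LR : L / R0 <= 1 by rewrite ler_pdivrMr// mul1r.
  have r'r : r' <= r by rewrite /r' ler_piMr// ltW.
  have [y yx] := corkscrew Ox r'0 r'L.
  have -> : (L / R0 / 120) ^+ 2 * r ^+ 2 = (r' / 120) ^+ 2 by rewrite /r'; field; rewrite gt_eqF.
  apply: (@lebesgue2_eball_ge y); first by rewrite divr_ge0// ltW.
    by apply: measurableI; [exact: measurable_eball|exact: open_measurable_plane].
  by move=> w /yx[xw Ow]; split => //; apply: lt_le_trans r'r.
Qed.

End Density.

End PlaneMeasure.

(** * Limits from dyadic oscillations *)

Section DyadicOscillation.
Context {R : realType}.
Variables (F : R -> R) (C alpha R0 : R).
Hypotheses (C0 : 0 <= C) (alpha0 : 0 < alpha) (R00 : 0 < R0).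
Hypothesis dyadic : forall r r', 0 < r -> r <= R0 -> r / 2 <= r' -> r' <= r ->
  `|F r - F r'| <= C * r `^ alpha.

Let q : R := 2^-1 `^ alpha.

Let q_ge0 : 0 <= q. Proof. exact: powR_ge0. Qed.

Let q_lt1 : q < 1.
Proof.
have -> : 1 = 1 `^ alpha :> R by rewrite powR1.
apply: gt0_ltr_powR => //; rewrite ?nnegrE//.
by lra.
Qed.

(** The constant obtained by summing the geometric series of the oscillations
    between consecutive dyadic scales. *)
Definition dyadic_const : R := C / (1 - q).

Let K0 : 0 <= dyadic_const.
Proof. by rewrite divr_ge0// subr_ge0 ltW. Qed.

Lemma dyadic_oscillation r r' : 0 < r' -> r' <= r -> r <= R0 ->
  `|F r - F r'| <= dyadic_const * r `^ alpha.
Proof.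
move=> r'0 r'r rR0; have r0 : 0 < r := lt_le_trans r'0 r'r.
have [n] : exists n, r / 2 ^+ n.+1 <= r'.
  exists (Num.bound (r / r')); rewrite ler_pdivrMr ?exprn_gt0// mulrC -ler_pdivrMr//.
  apply: le_trans (ltW (archi_boundP _)) _; first by rewrite divr_ge0 ?ltW.
  by rewrite -natrX ler_nat ltnW// ltnW// ltn_expl.
have CK : C + dyadic_const * q = dyadic_const.
  by rewrite /dyadic_const; field; rewrite subr_eq0 eq_sym lt_eqF.
have CK1 : C <= dyadic_const by rewrite -CK lerDl mulr_ge0.
elim: n r r'r rR0 r0 => [|n IHn] r r'r rR0 r0 nr.
  rewrite expr1 in nr; apply: le_trans (dyadic r0 rR0 nr r'r) _.
  by rewrite ler_wpM2r ?powR_ge0.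
have [r2|/ltW r2] := leP (r / 2) r'.
  by apply: le_trans (dyadic r0 rR0 r2 r'r) _; rewrite ler_wpM2r ?powR_ge0.
apply: le_trans (ler_distD (F (r / 2)) _ _) _.
have h1 : `|F r - F (r / 2)| <= C * r `^ alpha by apply: dyadic => //; lra.
have h2 : `|F (r / 2) - F r'| <= dyadic_const * (r / 2) `^ alpha.
  apply: IHn => //; [by lra|by lra|].
  by move: nr; rewrite [in X in X -> _]exprS invfM mulrA.
rewrite powRM ?(ltW r0) ?invr_ge0// -/q in h2.
by rewrite -CK; lra.
Qed.

Lemma dyadic_cvg : exists2 l, F r @[r --> 0^'+] --> l &
  `|F R0 - l| <= dyadic_const * R0 `^ alpha.
Proof.
have cF : cvg (F r @[r --> 0^'+]).
  apply/cauchy_cvgP/cauchy_exP => eps eps0.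
  pose t := eps / 2 / (dyadic_const + 1).
  have t0 : 0 < t by rewrite !divr_gt0// ltr_wpDl.
  pose r1 := Num.min R0 (t `^ alpha^-1).
  have r10 : 0 < r1 by rewrite lt_min R00 powR_gt0.
  have r1R0 : r1 <= R0 by rewrite ge_min lexx.
  have r1t : r1 `^ alpha <= t.
    have -> : t = (t `^ alpha^-1) `^ alpha.
      by rewrite -powRrM mulVf ?gt_eqF// powRr1// ltW.
    apply: ge0_ler_powR; rewrite ?nnegrE ?powR_ge0 ?(ltW alpha0) ?(ltW r10)//.
    by rewrite ge_min lexx orbT.
  exists (F r1); change (\forall r \near 0^'+, ball (F r1) eps (F r)); near=> r.
  have r0 : 0 < r by near: r; exact: nbhs_right_gt.
  have rr1 : r <= r1 by near: r; exact: nbhs_right_le.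
  rewrite /= /ball /=; apply: le_lt_trans (dyadic_oscillation r0 rr1 r1R0) _.
  apply: le_lt_trans (ler_wpM2l K0 r1t) _; rewrite /t mulrA ltr_pdivrMr ?ltr_wpDl//.
  by have := mulr_ge0 K0 (ltW eps0); lra.
have /cvg_ex[l Fl] := cF; exists l => //.
apply/ler_addgt0Pr => eps eps0.
have : \forall r \near 0^'+, `|F r - l| < eps.
  move/cvgrPdist_lt : Fl => /(_ eps eps0); apply: filterS => r.
  by rewrite distrC.
move=> near_l.
have ex : \forall r \near 0^'+, [/\ `|F r - l| < eps, 0 < r & r <= R0].
  near=> r; split; first by near: r.
    by near: r; exact: nbhs_right_gt.
  by near: r; exact: nbhs_right_le.
have [r [rl r0 rR0]] := @filter_ex _ _ (at_right_proper_filter _) _ ex.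
apply: le_trans (ler_distD (F r) _ _) _; apply: lerD; last exact: ltW.
exact: dyadic_oscillation.
Unshelve. all: by end_near. Qed.

End DyadicOscillation.

(** * Slices of the Gagliardo seminorm *)

Section GagliardoSlices.
Context {R : realType}.
Implicit Types (x y z : R * R) (Om : set (R * R)) (u : R * R -> R) (s p : R).

Lemma measurable_fun_powR d (T : measurableType d) (D : set T) (f : T -> R) p :
  measurable_fun D f -> measurable_fun D (fun t => f t `^ p).
Proof. exact: (@measurableT_comp _ _ _ _ _ _ (@powR R ^~ p)). Qed.

Lemma measurable_fun_norm_powR d (T : measurableType d) (D : set T) (f : T -> R) p :
  measurable_fun D f -> measurable_fun D (fun t => `|f t| `^ p).
Proof.
move=> mf; apply: measurable_fun_powR.
exact: (@measurableT_comp _ _ _ _ _ _ (@Num.norm R R)).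
Qed.

Lemma measurable_enormB (D : set (mplane R * mplane R)) :
  measurable_fun D (fun w => enorm (w.1 - w.2)).
Proof.
apply: (@measurable_funS _ _ _ _ setT) => //.
pose g (w : mplane R * mplane R) : R := (w.1.1 - w.2.1) ^+ 2 + (w.1.2 - w.2.2) ^+ 2.
have mg : measurable_fun setT g.
  apply: measurable_funD; apply: measurable_funX; apply: measurable_funB.
  - exact: (measurableT_comp measurable_fst measurable_fst).
  - exact: (measurableT_comp measurable_fst measurable_snd).
  - exact: (measurableT_comp measurable_snd measurable_fst).
  - exact: (measurableT_comp measurable_snd measurable_snd).
apply: (@measurableT_comp _ _ _ _ _ _ (@Num.sqrt R)) mg.
by apply: continuous_measurable_fun; exact: sqrt_continuous.
Qed.

Definition gag_kernel s p u x y : R :=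
  `|u x - u y| `^ p / enorm (x - y) `^ (2 + s * p).

Definition gag_slice Om s p u x : \bar R :=
  (\int[lebesgue2]_(y in Om) (gag_kernel s p u x y)%:E)%E.

Lemma gag_kernel_ge0 s p u x y : 0 <= gag_kernel s p u x y.
Proof. by rewrite divr_ge0 ?powR_ge0. Qed.

Section Fixed.
Variables (Om : set (R * R)) (s p : R) (u : R * R -> R).
Hypothesis mOm : measurable (Om : set (mplane R)).
Hypothesis mu : measurable_fun (Om : set (mplane R)) u.

Lemma measurable_gag_kernel :
  measurable_fun (Om `*` Om : set (mplane R * mplane R))
    (fun w => gag_kernel s p u w.1 w.2).
Proof.
have mOO : measurable (Om `*` Om : set (mplane R * mplane R)) by exact: measurableX.
have mfst : measurable_fun (Om `*` Om : set (mplane R * mplane R)) (fun w => u w.1).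
  apply: (measurable_comp mOm _ mu); last exact: measurable_funS measurable_fst.
  by move=> _ [w [Ow _] <-].
have msnd : measurable_fun (Om `*` Om : set (mplane R * mplane R)) (fun w => u w.2).
  apply: (measurable_comp mOm _ mu); last exact: measurable_funS measurable_snd.
  by move=> _ [w [_ Ow] <-].
apply: measurable_funM.
  by apply: measurable_fun_norm_powR; exact: measurable_funB.
under eq_fun do rewrite -powRN.
by apply: measurable_fun_powR; exact: measurable_enormB.
Qed.

Let K : mplane R * mplane R -> \bar R :=
  (fun w => (gag_kernel s p u w.1 w.2)%:E) \_ (Om `*` Om).

Let mK : measurable_fun setT K.
Proof.
apply/(measurable_restrictT _ _).1; first exact: measurableX.
by apply/measurable_EFinP; exact: measurable_gag_kernel.
Qed.

Let K0 w : (0 <= K w)%E.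
Proof. by rewrite /K patchE; case: ifP => // _; rewrite lee_fin gag_kernel_ge0. Qed.

Let K_slice : fubini_F lebesgue2 K = (gag_slice Om s p u) \_ Om.
Proof.
apply/funext => x; rewrite /fubini_F patchE /K; case: ifPn => xO.
  rewrite /gag_slice [RHS]integral_mkcond; apply: eq_integral => y _.
  rewrite !patchE; congr (if _ then _ else _).
  by apply/idP/idP; rewrite !inE /=; [case|move=> yO; split => //; exact: set_mem].
apply: integral0_eq => y _; rewrite patchE ifF//; apply/negbTE.
by apply: contra xO; rewrite !inE => -[].
Qed.

Lemma gagliardo_slice :
  gagliardo Om s p u = (\int[lebesgue2]_(x in Om) gag_slice Om s p u x)%E.
Proof.
rewrite [RHS]integral_mkcond -K_slice /gagliardo [LHS]integral_mkcond.
exact: (fubini_tonelli1 K mK K0).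
Qed.

Lemma measurable_gag_slice : measurable_fun (Om : set (mplane R)) (gag_slice Om s p u).
Proof.
apply/(measurable_restrictT _ _).2 => //.
by rewrite -K_slice; exact: measurable_fun_fubini_tonelli_F.
Qed.

Lemma gag_slice_ge0 x : (0 <= gag_slice Om s p u x)%E.
Proof. by apply: integral_ge0 => y _; rewrite lee_fin gag_kernel_ge0. Qed.

Lemma measurable_gag_kernel2 x : Om x ->
  measurable_fun (Om : set (mplane R)) (gag_kernel s p u x).
Proof.
move=> Ox; apply: (@measurable_comp _ _ _ _ _ _ (Om `*` Om)
  (fun w : mplane R * mplane R => gag_kernel s p u w.1 w.2) Om (fun y => (x, y))).
- exact: measurableX.
- by move=> _ [y Oy <-].
- exact: measurable_gag_kernel.
- apply: (@measurable_funS _ _ _ _ setT) => //.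
  by apply: measurable_fun_pair => //; exact: measurable_cst.
Qed.

End Fixed.
End GagliardoSlices.

(** * Traces and the Morrey inequality *)

Section LocalAverages.
Context {R : realType}.
Implicit Types (x y z : R * R) (u v : R * R -> R).

Definition local_average (Om : set (R * R)) u x (r : R) : R :=
  \int[lebesgue2]_(y in eball x r `&` Om) u y /
  fine (lebesgue2 (eball x r `&` Om)).

Lemma traceE Om u x : trace Om u x = lim (local_average Om u x r @[r --> 0^'+]).
Proof. by []. Qed.

(** Applied with a well chosen a, this pointwise inequality plays the role of the
    inequality of Jensen for averages of t. *)
Lemma le_powR_young (a t p : R) : 1 <= p -> 0 < a -> 0 <= t ->
  t <= a + a `^ (1 - p) * t `^ p.
Proof.
move=> p1 a0 t0; have [ta|/ltW at_] := leP t a.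
  by apply: le_trans ta _; rewrite lerDl mulr_ge0 ?powR_ge0.
have t_gt0 : 0 < t := lt_le_trans a0 at_.
have -> : 1 - p = - (p - 1) by ring.
have -> : t `^ p = t `^ (p - 1) * t.
  by rewrite -{3}(powRr1 t0) -powRD ?subrK// (gt_eqF t_gt0) implybT.
rewrite powRN mulrA; apply: le_trans (_ : 1 * t <= _); first by rewrite mul1r.
apply: (@le_trans _ _ ((a `^ (p - 1))^-1 * t `^ (p - 1) * t)); last first.
  by rewrite lerDr ltW.
rewrite ler_wpM2r// mulrC ler_pdivlMr ?powR_gt0// mul1r.
by apply: ge0_ler_powR; rewrite ?nnegrE ?subr_ge0 ?(ltW a0).
Qed.

Section Average.
Variables (A : set (mplane R)) (v : R * R -> R) (c : R).
Hypotheses (mA : measurable A) (A0 : (0 < lebesgue2 A)%E) (Aoo : (lebesgue2 A < +oo)%E).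
Hypothesis iv : lebesgue2.-integrable A (EFin \o v).

Lemma average_dist :
  ((`|(\int[lebesgue2]_(y in A) v y) / fine (lebesgue2 A) - c| * fine (lebesgue2 A))%:E
   <= \int[lebesgue2]_(y in A) (`|v y - c|)%:E)%E.
Proof.
have m0 : 0 < fine (lebesgue2 A) by rewrite fine_gt0// A0.
have ic : lebesgue2.-integrable A (EFin \o cst c).
  apply: measurable_bounded_integrable => //.
  by exists `|c|; split; [exact: num_real|move=> M cM t _; exact: ltW].
rewrite -{2}(gtr0_norm m0) -normrM mulrBl divfK ?gt_eqF//.
rewrite -(Rintegral_cst lebesgue2 mA c) -(RintegralB mA iv ic).
have ivc : lebesgue2.-integrable A (EFin \o (fun y => v y - c)).
  exact: (integrableB mA iv ic).
rewrite EFin_normr_Rintegral//; apply: le_abse_integral => //.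
exact: measurable_int ivc.
Qed.
End Average.

Section Morrey.
Variables (Om : set (R * R)) (s p k R0 : R).
Hypotheses (p1 : 1 < p) (sp2 : 2 < s * p) (k0 : 0 < k) (R00 : 0 < R0).
Hypotheses (oOm : open Om) (bOm : bounded_set Om).
Hypothesis Om_sub : forall x, closure Om x -> Om `<=` eball x R0.
Hypothesis dens : forall x (r : R), closure Om x -> 0 < r -> r <= R0 ->
  ((k * r ^+ 2)%:E <= lebesgue2 (eball x r `&` Om : set (mplane R)))%E.

Let p0 : 0 < p. Proof. exact: lt_trans ltr01 p1. Qed.

Lemma measurable_domain : measurable (Om : set (mplane R)).
Proof. exact: open_measurable_plane. Qed.

Lemma domain_measure_lty : (lebesgue2 (Om : set (mplane R)) < +oo)%E.
Proof. exact: lebesgue2_bounded bOm measurable_domain. Qed.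

Let A x r : set (mplane R) := eball x r `&` Om.

Let mA x r : measurable (A x r).
Proof. by apply: measurableI; [exact: measurable_eball|exact: measurable_domain]. Qed.

Let A_sub x r : A x r `<=` Om. Proof. exact: subIsetr. Qed.

Let A_lty x r : (lebesgue2 (A x r) < +oo)%E.
Proof.
apply: le_lt_trans domain_measure_lty; apply: le_measure; rewrite ?inE//.
exact: measurable_domain.
Qed.

Let A_ge x r : closure Om x -> 0 < r -> r <= R0 -> k * r ^+ 2 <= fine (lebesgue2 (A x r)).
Proof.
move=> Ox r0 rR0; rewrite -lee_fin fineK; first exact: dens.
by rewrite ge0_fin_numE.
Qed.

Let A_gt0 x r : closure Om x -> 0 < r -> r <= R0 -> (0 < lebesgue2 (A x r))%E.
Proof.
move=> Ox r0 rR0; apply: lt_le_trans (dens Ox r0 rR0).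
by rewrite lte_fin mulr_gt0// exprn_gt0.
Qed.

Lemma Lp_integrable u : measurable_fun (Om : set (mplane R)) u ->
  (\int[lebesgue2]_(x in Om) (`|u x| `^ p)%:E < +oo)%E ->
  lebesgue2.-integrable Om (EFin \o u).
Proof.
move=> mu up; apply/integrableP; split; first exact/measurable_EFinP.
have mOm := measurable_domain.
apply: (@le_lt_trans _ _ (\int[lebesgue2]_(x in Om) (1%:E + (`|u x| `^ p)%:E))%E).
  apply: ge0_le_integral => //.
  - by apply/measurable_EFinP; apply: (@measurableT_comp _ _ _ _ _ _ (@Num.norm R R)).
  - apply: emeasurable_funD; first exact: measurable_cst.
    by apply/measurable_EFinP; exact: measurable_fun_norm_powR.
  - move=> x _; rewrite -EFinD lee_fin /=.
    have := @le_powR_young 1 `|u x| p (ltW p1) ltr01 (normr_ge0 _).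
    by rewrite powR1 mul1r.
rewrite ge0_integralD//; last by apply/measurable_EFinP; exact: measurable_fun_norm_powR.
rewrite integral_cst// mul1e lte_add_pinfty//.
exact: domain_measure_lty.
Qed.

Lemma sobolev_integrable u : sobolev Om s p u -> lebesgue2.-integrable Om (EFin \o u).
Proof. by case=> mu up _; exact: Lp_integrable. Qed.

Let iA u x r : sobolev Om s p u -> lebesgue2.-integrable (A x r) (EFin \o u).
Proof.
move=> Wu; apply: integrableS (sobolev_integrable Wu) => //.
exact: measurable_domain.
Qed.

(** The kernel of the seminorm is at least (2 r)^(-2 - s p) |u x - u y|^p on the
    ball, so a bound on the slice at x bounds the mean of |u x - u y|^p. *)
Lemma average_near_point u x z r (H a : R) : sobolev Om s p u ->
  closure Om z -> 0 < r -> r <= R0 -> Om x -> enorm (z - x) <= r -> 0 < a ->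
  0 <= H -> (gag_slice Om s p u x <= H%:E)%E ->
  `|local_average Om u z r - u x| <=
    a + a `^ (1 - p) * (2 * r) `^ (2 + s * p) * H / (k * r ^+ 2).
Proof.
move=> Wu Oz r0 rR0 Ox zx a0 H0 slH; have [mu _ _] := Wu.
have mOm := measurable_domain.
have beta0 : 0 <= 2 + s * p by rewrite addr_ge0 ?ltW ?(lt_trans _ sp2).
pose B := a `^ (1 - p) * (2 * r) `^ (2 + s * p).
have B0 : 0 <= B by rewrite mulr_ge0 ?powR_ge0.
have pointwise y : A z r y -> `|u y - u x| <= a + B * gag_kernel s p u x y.
  move=> [zy Oy]; apply: le_trans (le_powR_young (ltW p1) a0 (normr_ge0 _)) _.
  rewrite lerD2l /B -mulrA ler_wpM2l ?powR_ge0// distrC /gag_kernel.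
  have [xy|xy] := eqVneq (enorm (x - y)) 0.
    move/eqP: xy; rewrite enorm_eq0 subr_eq0 => /eqP ->.
    by rewrite subrr normr0 powR0 ?gt_eqF ?mul0r ?mulr0.
  rewrite mulrCA -[leLHS]mulr1 ler_wpM2l ?powR_ge0//.
  rewrite ler_pdivlMr ?powR_gt0 ?lt_neqAle 1?eq_sym ?xy ?enorm_ge0//.
  rewrite mul1r; apply: ge0_ler_powR; rewrite ?nnegrE ?enorm_ge0 ?mulr_ge0 ?(ltW r0)//.
  apply: le_trans (enormB_triangle z x y) _; rewrite enormC.
  by move: zy; rewrite /eball /=; lra.
have := @average_dist (A z r) u (u x) (mA z r) (A_gt0 Oz r0 rR0) (A_lty z r) (iA z r Wu).
have mslice : measurable_fun (A z r) (gag_kernel s p u x).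
  exact: (measurable_funS mOm (@A_sub z r) (measurable_gag_kernel2 s p mOm mu Ox)).
have : (\int[lebesgue2]_(y in A z r) (`|u y - u x|)%:E <=
    (a * fine (lebesgue2 (A z r)) + B * H)%:E)%E.
  apply: (@le_trans _ _ (\int[lebesgue2]_(y in A z r) (a%:E + (B * gag_kernel s p u x y)%:E))%E).
    apply: ge0_le_integral => //.
    - apply/measurable_EFinP; apply: (@measurableT_comp _ _ _ _ _ _ (@Num.norm R R)) => //.
      apply: measurable_funB => //; exact: (measurable_funS mOm (@A_sub z r) mu).
    - apply: emeasurable_funD; first exact: measurable_cst.
      by apply/measurable_EFinP; apply: measurable_funM.
  rewrite ge0_integralD//; last 3 first.
  - by move=> y _; rewrite lee_fin ltW.
  - by move=> y _; rewrite lee_fin mulr_ge0 ?gag_kernel_ge0.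
  - by apply/measurable_EFinP; apply: measurable_funM.
  rewrite integral_cst// EFinD EFinM fineK ?ge0_fin_numE// leeD2l//.
  under eq_integral do rewrite EFinM.
  have kerE0 y : A z r y -> (0 <= (gag_kernel s p u x y)%:E)%E.
    by move=> _; rewrite lee_fin gag_kernel_ge0.
  have mkerE : measurable_fun (A z r) (fun y => (gag_kernel s p u x y)%:E).
    exact/measurable_EFinP.
  rewrite ge0_integralZl ?lee_fin//.
  rewrite (EFinM B H) lee_wpmul2l ?lee_fin//; apply: le_trans slH.
  apply: ge0_subset_integral => //.
  - by apply/measurable_EFinP; exact: measurable_gag_kernel2.
  - by move=> y _; rewrite lee_fin gag_kernel_ge0.
move=> h1 h2; have := le_trans h2 h1; rewrite lee_fin.
have mge := A_ge Oz r0 rR0; have kr : 0 < k * r ^+ 2 by rewrite mulr_gt0// exprn_gt0.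
have m0 := lt_le_trans kr mge.
rewrite -ler_pdivlMr// => /le_trans; apply; rewrite mulrDl mulfK ?gt_eqF// lerD2l.
rewrite -/B; apply: ler_wpM2l; first exact: mulr_ge0.
by rewrite lef_pV2 ?posrE.
Qed.

(** Otherwise the integral of the slices over the ball would be twice as large as
    the seminorm, by the measure density. *)
Lemma slice_average_le u z r (rho : R) : sobolev Om s p u -> closure Om z ->
  0 < r -> r <= R0 -> 0 < rho -> (gagliardo Om s p u <= (rho `^ p)%:E)%E ->
  exists2 x, A z r x & (gag_slice Om s p u x <= (2 * rho `^ p / (k * r ^+ 2))%:E)%E.
Proof.
move=> [mu _ _] Oz r0 rR0 rho0 Gu; apply: contrapT => nex.
have mOm := measurable_domain.
have kr : 0 < k * r ^+ 2 by rewrite mulr_gt0// exprn_gt0.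
have rp : 0 < rho `^ p by rewrite powR_gt0.
pose c := 2 * rho `^ p / (k * r ^+ 2).
have c0 : 0 <= c by apply: divr_ge0; [rewrite mulr_ge0// ltW|rewrite ltW].
have lt_slice x : A z r x -> (c%:E <= gag_slice Om s p u x)%E.
  by move=> Ax; rewrite leNgt; apply/negP => sx; apply: nex; exists x => //; exact: ltW.
have mslice := measurable_gag_slice s p mOm mu.
have : ((c * (k * r ^+ 2))%:E <= (rho `^ p)%:E)%E.
  apply: le_trans Gu; rewrite (gagliardo_slice s p mOm mu).
  apply: (@le_trans _ _ (\int[lebesgue2]_(x in A z r) c%:E)%E).
    by rewrite integral_cst// EFinM lee_wpmul2l ?lee_fin ?dens.
  apply: (@le_trans _ _ (\int[lebesgue2]_(x in A z r) gag_slice Om s p u x)%E).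
    apply: ge0_le_integral => //.
    exact: (measurable_funS mOm (@A_sub z r) mslice).
  by apply: ge0_subset_integral => // x _; exact: gag_slice_ge0.
by rewrite lee_fin /c divfK ?gt_eqF//; lra.
Qed.

Let alpha : R := s - 2 / p.

Let alphap : alpha * p = s * p - 2.
Proof. by rewrite /alpha; field; rewrite gt_eqF. Qed.

Let alpha0 : 0 < alpha.
Proof. by rewrite -(pmulr_lgt0 _ p0) alphap subr_gt0. Qed.

(** Homogeneity: alpha = s - 2 / p is the Hoelder exponent of the embedding. *)
Let scaling (rho r : R) : 0 < rho -> 0 < r ->
  (rho * r `^ alpha) `^ (1 - p) * (2 * r) `^ (2 + s * p) * rho `^ p =
  2 `^ (2 + s * p) * (rho * r `^ alpha) * r ^+ 4.
Proof.
move=> rho0 r0; rewrite !powRM ?powR_ge0 ?(ltW rho0) ?(ltW r0)// -powRrM.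
have rhoE : rho `^ (1 - p) * rho `^ p = rho.
  by rewrite -powRD ?(gt_eqF rho0) ?implybT// subrK powRr1// ltW.
have rE : r `^ (alpha * (1 - p)) * r `^ (2 + s * p) = r `^ alpha * r ^+ 4.
  rewrite -powRD ?(gt_eqF r0) ?implybT// -(powR_mulrn 4 (ltW r0)) -powRD ?(gt_eqF r0) ?implybT//.
  by congr (_ `^ _); rewrite mulrBr alphap mulr1; ring.
transitivity ((rho `^ (1 - p) * rho `^ p) *
  (r `^ (alpha * (1 - p)) * r `^ (2 + s * p)) * 2 `^ (2 + s * p)); first by ring.
by rewrite rhoE rE; ring.
Qed.

Let C1 : R := 2 + 40 * 2 `^ (2 + s * p) / k ^+ 2.

(** Both averages are compared with the value at one point x of the smaller ball
    whose slice is controlled. *)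
Let average_oscillation u z (rho r r' : R) : sobolev Om s p u -> closure Om z ->
  0 < rho -> (gagliardo Om s p u <= (rho `^ p)%:E)%E ->
  0 < r -> r <= R0 -> r / 2 <= r' -> r' <= r ->
  `|local_average Om u z r - local_average Om u z r'| <= C1 * rho * r `^ alpha.
Proof.
move=> Wu Oz rho0 Gu r0 rR0 rr' r'r.
have r'0 : 0 < r' by lra.
have r'R0 := le_trans r'r rR0.
have [x Ax] := slice_average_le Wu Oz r'0 r'R0 rho0 Gu.
set H := _ / _ => slH.
have rp : 0 < rho `^ p by rewrite powR_gt0.
have kr' : 0 < k * r' ^+ 2 by rewrite mulr_gt0// exprn_gt0.
have H0 : 0 <= H by apply: divr_ge0; [rewrite mulr_ge0// ltW|rewrite ltW].
pose a := rho * r `^ alpha; have a0 : 0 < a by rewrite mulr_gt0 ?powR_gt0.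
have zx' : enorm (z - x) <= r' by case: Ax => /ltW.
have zx : enorm (z - x) <= r := le_trans zx' r'r.
have Ox : Om x by case: Ax.
have h := average_near_point Wu Oz r0 rR0 Ox zx a0 H0 slH.
have h' := average_near_point Wu Oz r'0 r'R0 Ox zx' a0 H0 slH.
apply: le_trans (ler_distD (u x) _ _) _; rewrite [X in _ + X]distrC.
apply: le_trans (lerD h h') _.
have sq : r ^+ 2 <= 4 * r' ^+ 2.
  have -> : 4 * r' ^+ 2 = (2 * r') ^+ 2 by ring.
  by rewrite ler_pXn2r ?nnegrE ?mulr_ge0 ?(ltW r0) ?(ltW r'0)//; lra.
have krE : (k * r' ^+ 2)^-1 <= 4 / (k * r ^+ 2).
  rewrite -[leLHS]mul1r ler_pdivrMr// mulrAC ler_pdivlMr ?mulr_gt0 ?exprn_gt0//.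
  by rewrite mul1r [X in _ <= X]mulrCA ler_pM2l.
have Hle : H <= 8 * rho `^ p / (k * r ^+ 2).
  have -> : 8 * rho `^ p / (k * r ^+ 2) = 2 * rho `^ p * (4 / (k * r ^+ 2)) by ring.
  by apply: ler_wpM2l krE; rewrite mulr_ge0// ltW.
have rbeta : (2 * r') `^ (2 + s * p) <= (2 * r) `^ (2 + s * p).
  apply: ge0_ler_powR; rewrite ?nnegrE ?mulr_ge0 ?(ltW r0) ?(ltW r'0) ?ler_pM2l//.
  by rewrite addr_ge0 ?ltW ?(lt_trans _ sp2).
pose B := a `^ (1 - p) * (2 * r) `^ (2 + s * p).
have B0 : 0 <= B by rewrite mulr_ge0 ?powR_ge0.
have -> : C1 * rho * r `^ alpha = a + a + 5 * (B * (8 * rho `^ p / (k * r ^+ 2)) / (k * r ^+ 2)).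
  have -> : B * (8 * rho `^ p / (k * r ^+ 2)) / (k * r ^+ 2) =
    8 * (B * rho `^ p) / (k ^+ 2 * r ^+ 4) by field; rewrite !gt_eqF.
  by rewrite /B scaling// -/a /C1 -mulrA -/a; field; rewrite !gt_eqF.
have t1 : B * H / (k * r ^+ 2) <= B * (8 * rho `^ p / (k * r ^+ 2)) / (k * r ^+ 2).
  rewrite ler_wpM2r ?invr_ge0 ?mulr_ge0 ?exprn_ge0 ?(ltW k0) ?(ltW r0)//.
  exact: ler_wpM2l.
have t2 : a `^ (1 - p) * (2 * r') `^ (2 + s * p) * H / (k * r' ^+ 2) <=
    4 * (B * (8 * rho `^ p / (k * r ^+ 2)) / (k * r ^+ 2)).
  apply: (@le_trans _ _ (B * (8 * rho `^ p / (k * r ^+ 2)) * (4 / (k * r ^+ 2)))); last first.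
    by rewrite le_eqVlt; apply/orP; left; apply/eqP; ring.
  apply: ler_pM => //; first by apply: mulr_ge0 => //; rewrite mulr_ge0 ?powR_ge0.
    by rewrite invr_ge0 ltW.
  apply: ler_pM => //; first by rewrite mulr_ge0 ?powR_ge0.
  by rewrite ler_wpM2l ?powR_ge0.
by move: t1 t2; rewrite /B; lra.
Qed.

Definition morrey_const : R := dyadic_const C1 alpha * R0 `^ alpha.

Definition domain_mean u : R := \int[lebesgue2]_(y in Om) u y / fine (lebesgue2 Om).

Let average_R0 u x : closure Om x -> local_average Om u x R0 = domain_mean u.
Proof. by move=> Ox; rewrite /local_average (setIidr (Om_sub Ox)). Qed.

Let C10 : 0 <= C1.
Proof. by rewrite addr_ge0// divr_ge0 ?mulr_ge0 ?powR_ge0 ?exprn_ge0// ltW. Qed.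

(** At radius R0 the ball contains the domain, so the local average is the mean;
    summing the oscillations over dyadic radii gives the limit and the estimate. *)
Lemma trace_cvg_rho u x (rho : R) : sobolev Om s p u -> closure Om x ->
  0 < rho -> (gagliardo Om s p u <= (rho `^ p)%:E)%E ->
  local_average Om u x r @[r --> 0^'+] --> trace Om u x /\
  `|domain_mean u - trace Om u x| <= morrey_const * rho.
Proof.
move=> Wu Ox rho0 Gu.
have [l Fl] := @dyadic_cvg _ (local_average Om u x) (C1 * rho) alpha R0
  (mulr_ge0 C10 (ltW rho0)) alpha0 R00
  (fun r r' => average_oscillation Wu Ox rho0 Gu).
rewrite average_R0// => ml.
have -> : trace Om u x = l by rewrite traceE; exact: cvg_lim Fl.
split => //; apply: le_trans ml _.
by rewrite /morrey_const /dyadic_const le_eqVlt; apply/orP; left; apply/eqP; ring.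
Qed.

Lemma gagliardo_ge0 u : (0 <= gagliardo Om s p u)%E.
Proof. by apply: integral_ge0 => z _; rewrite lee_fin divr_ge0 ?powR_ge0. Qed.

Lemma gagliardo_le_powR u : sobolev Om s p u ->
  exists2 rho : R, 0 < rho & (gagliardo Om s p u <= (rho `^ p)%:E)%E.
Proof.
case=> _ _ Gu; have Gfin : gagliardo Om s p u \is a fin_num.
  by rewrite ge0_fin_numE ?gagliardo_ge0.
have G0 : 0 <= fine (gagliardo Om s p u) by rewrite fine_ge0 ?gagliardo_ge0.
exists ((fine (gagliardo Om s p u) + 1) `^ p^-1); first by rewrite powR_gt0// ltr_wpDl.
rewrite -powRrM mulVf ?gt_eqF// powRr1 ?addr_ge0//.
by rewrite -{1}(fineK Gfin) lee_fin lerDl.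
Qed.

Lemma trace_cvg u x : sobolev Om s p u -> closure Om x ->
  local_average Om u x r @[r --> 0^'+] --> trace Om u x.
Proof.
move=> Wu Ox; have [rho rho0 Gu] := gagliardo_le_powR Wu.
by have [] := trace_cvg_rho Wu Ox rho0 Gu.
Qed.

Lemma powR_near0 (beta t : R) : 0 < beta -> 0 < t ->
  \forall r \near 0^'+, r `^ beta <= t.
Proof.
move=> beta0 t0; near=> r.
have r0 : 0 < r by near: r; exact: nbhs_right_gt.
have rt : r <= t `^ beta^-1 by near: r; apply: nbhs_right_le; rewrite powR_gt0.
have -> : t = (t `^ beta^-1) `^ beta.
  by rewrite -powRrM mulVf ?gt_eqF// powRr1// ltW.
by apply: ge0_ler_powR; rewrite ?nnegrE ?powR_ge0 ?(ltW beta0) ?(ltW r0).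
Unshelve. all: by end_near. Qed.

(** If the slice at x is finite, averages around x itself converge to the value
    there, at the rate r^s. *)
Lemma trace_eq_slice u x : sobolev Om s p u -> Om x ->
  (gag_slice Om s p u x < +oo)%E -> trace Om u x = u x.
Proof.
move=> Wu Ox slx; have Ocx : closure Om x := subset_closure Ox.
have [mu _ _] := Wu.
have s0 : 0 < s by rewrite -(pmulr_lgt0 _ p0) (lt_trans _ sp2).
have slfin : gag_slice Om s p u x \is a fin_num by rewrite ge0_fin_numE// gag_slice_ge0.
pose H := fine (gag_slice Om s p u x).
have H0 : 0 <= H by rewrite fine_ge0// gag_slice_ge0.
pose C := 1 + 2 `^ (2 + s * p) * H / k.
have C0 : 0 < C by rewrite ltr_wpDr// divr_ge0 ?mulr_ge0 ?powR_ge0// ltW.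
rewrite traceE; apply: cvg_lim => //; apply/cvgrPdist_le => eps eps0.
have : \forall r \near 0^'+, r `^ s <= eps / C by apply: powR_near0 => //; exact: divr_gt0.
move=> small; near=> r.
have r0 : 0 < r by near: r; exact: nbhs_right_gt.
have rR0 : r <= R0 by near: r; exact: nbhs_right_le.
have rs : r `^ s <= eps / C by near: r.
have a0 : 0 < r `^ s by rewrite powR_gt0.
rewrite distrC.
have := @average_near_point u x x r H (r `^ s) Wu Ocx r0 rR0 Ox.
rewrite subrr enorm0 => /(_ (ltW r0) a0 H0); rewrite fineK// => /(_ (lexx _))/le_trans; apply.
suff -> : r `^ s + r `^ s `^ (1 - p) * (2 * r) `^ (2 + s * p) * H / (k * r ^+ 2) = r `^ s * C.
  by rewrite -ler_pdivlMr.
have rE : r `^ s `^ (1 - p) * (2 * r) `^ (2 + s * p) = 2 `^ (2 + s * p) * r `^ s * r ^+ 2.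
  rewrite powRM ?(ltW r0)// -powRrM mulrCA -powRD ?(gt_eqF r0) ?implybT//.
  rewrite -mulrA -(powR_mulrn 2 (ltW r0)) -powRD ?(gt_eqF r0) ?implybT//.
  by congr (_ * _ `^ _); ring.
by rewrite rE /C; field; rewrite !gt_eqF.
Unshelve. all: by end_near. Qed.

Lemma trace_ae u : sobolev Om s p u ->
  {ae lebesgue2, forall x, Om x -> trace Om u x = u x}.
Proof.
move=> Wu; have [mu _ Gu] := Wu; have mOm := measurable_domain.
have islice : lebesgue2.-integrable Om (gag_slice Om s p u).
  apply/integrableP; split; first exact: measurable_gag_slice.
  under eq_integral do rewrite gee0_abs ?gag_slice_ge0//.
  by rewrite -gagliardo_slice.
have := integrable_ae mOm islice; apply: filterS => x fin Ox.
by apply: trace_eq_slice => //; rewrite ltey_eq fin.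
Qed.

Let measurable_average_ge0 (h : mplane R -> \bar R) r :
  measurable_fun Om h -> (forall y, 0 <= h y)%E ->
  measurable_fun setT (fun x : mplane R => (\int[lebesgue2]_(y in A x r) h y)%E).
Proof.
move=> mh h0; have mOm := measurable_domain.
pose D : set (mplane R * mplane R) := [set w | enorm (w.1 - w.2) < r] `&` (setT `*` Om).
have mD : measurable D.
  apply: measurableI; last exact: measurableX.
  have := @measurable_enormB R setT measurableT _ (measurable_itv `]-oo, r[%R).
  by rewrite setTI; congr measurable; apply/seteqP; split => w; rewrite /= in_itv/=.
have msnd : measurable_fun D (snd : mplane R * mplane R -> mplane R).
  exact: measurable_funS measurable_snd.
have sub : (snd : mplane R * mplane R -> mplane R) @` D `<=` Om.
  by move=> _ [w [_ [_ Ow]] <-].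
have mhD : measurable_fun D (fun w : mplane R * mplane R => h w.2).
  exact: (measurable_comp mOm sub mh msnd).
pose J : mplane R * mplane R -> \bar R := (fun w => h w.2) \_ D.
have mJ : measurable_fun setT J by exact: ((measurable_restrictT _ mD).1 mhD).
have J0 w : (0 <= J w)%E by rewrite /J patchE; case: ifP.
have -> : (fun x : mplane R => (\int[lebesgue2]_(y in A x r) h y)%E) = fubini_F lebesgue2 J.
  apply/funext => x; rewrite /fubini_F [LHS]integral_mkcond; apply: eq_integral => y _.
  rewrite /J !patchE; congr (if _ then _ else _).
  by apply/idP/idP; rewrite !inE /=; [move=> [? ?]; split|move=> [? [_ ?]]; split].
exact: measurable_fun_fubini_tonelli_F.
Qed.

Lemma measurable_local_average u r : measurable_fun (Om : set (mplane R)) u ->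
  measurable_fun (setT : set (mplane R)) (fun x : mplane R => local_average Om u x r).
Proof.
move=> mu; have mOm := measurable_domain.
have mint : measurable_fun (setT : set (mplane R))
    (fun x : mplane R => (\int[lebesgue2]_(y in A x r) (u y)%:E)%E).
  have mE : measurable_fun (Om : set (mplane R)) (EFin \o u) by exact/measurable_EFinP.
  have -> : (fun x : mplane R => (\int[lebesgue2]_(y in A x r) (u y)%:E)%E) =
      ((fun x : mplane R => \int[lebesgue2]_(y in A x r) (EFin \o u)^\+ y) \-
       (fun x : mplane R => \int[lebesgue2]_(y in A x r) (EFin \o u)^\- y))%E.
    by apply/funext => x /=; rewrite integralE.
  apply: emeasurable_funB; apply: measurable_average_ge0 => //.
  - exact: measurable_funepos.
  - exact: measurable_funeneg.
have mden : measurable_fun (setT : set (mplane R)) (fun x : mplane R => lebesgue2 (A x r)).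
  have := @measurable_average_ge0 (cst 1%E) r (@measurable_cst _ _ _ _ _ _) (fun=> lee01).
  by under eq_fun do rewrite integral_cst// mul1e.
apply: measurable_funM.
  exact: (@measurableT_comp _ _ _ _ _ _ (@fine R)).
have -> : (fun x : mplane R => (fine (lebesgue2 (A x r)))^-1) = (fun x : mplane R => fine (lebesgue2 (A x r)) `^ (-1)).
  by apply/funext => x; rewrite powR_inv1// fine_ge0.
apply: measurable_fun_powR.
exact: (@measurableT_comp _ _ _ _ _ _ (@fine R)).
Qed.

Lemma measurable_trace u : sobolev Om s p u ->
  measurable_fun (closure Om : set (mplane R)) (trace Om u).
Proof.
move=> Wu; have [mu _ _] := Wu.
have mcl : measurable (closure Om : set (mplane R)).
  by apply: closed_measurable_plane; exact: closed_closure.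
apply: (@measurable_fun_cvg _ _ _ _ (fun n (x : mplane R) => local_average Om u x n.+1%:R^-1)).
  move=> n; apply: measurable_funS (measurable_local_average _ mu) => //.
move=> x Ox; have /cvg_at_rightP := trace_cvg Wu Ox; apply; split => [n|].
  by rewrite invr_gt0 ltr0n.
exact: cvg_harmonic.
Qed.

End Morrey.

End LocalAverages.

(** * Uniform convexity *)

Section Clarkson.
Context {R : realType}.
Implicit Types (a b p q x y : R).

Lemma powRD_superadditive q x y : 1 <= q -> 0 <= x -> 0 <= y ->
  x `^ q + y `^ q <= (x + y) `^ q.
Proof.
move=> q1 x0 y0; have q0 : 0 < q := lt_le_trans ltr01 q1.
rewrite -!(mulr_powRB1 _ q0) ?addr_ge0// mulrDl.
by apply: lerD; apply: ler_wpM2l => //; apply: ge0_ler_powR;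
  rewrite ?nnegrE ?subr_ge0 ?addr_ge0 ?lerDl ?lerDr.
Qed.

Lemma powR_midpoint q x y : 1 <= q -> 0 <= x -> 0 <= y ->
  (2^-1 * (x + y)) `^ q <= 2^-1 * (x `^ q + y `^ q).
Proof.
move=> q1 x0 y0; have h0 : (0 : R) <= 2^-1 by lra.
have h1 : (2^-1 : R) <= 1 by lra.
have := @convex_powR R q q1 (Itv01 h0 h1) x y.
rewrite !inE/= !in_itv/= !andbT => /(_ x0 y0); rewrite [X in X `^ q <= _ -> _]convRE [X in _ <= X -> _]convRE /=.
have -> : unstable.onem (2^-1 : R) = 2^-1 by rewrite /unstable.onem; lra.
by rewrite -!mulrDr.
Qed.

(** The parallelogram identity raised to the power p / 2 >= 1: this power is
    superadditive and convex. *)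
Lemma clarkson p a b : 2 <= p ->
  `|2^-1 * (a + b)| `^ p + `|2^-1 * (a - b)| `^ p <=
  2^-1 * (`|a| `^ p + `|b| `^ p).
Proof.
move=> p2; have q1 : 1 <= p / 2 by lra.
have E t : `|t| `^ p = (t ^+ 2) `^ (p / 2).
  rewrite -(real_normK (num_real t)) -powR_mulrn// -powRrM; congr (_ `^ _); lra.
rewrite !E; apply: le_trans (powRD_superadditive q1 _ _) _; rewrite ?sqr_ge0//.
have -> : (2^-1 * (a + b)) ^+ 2 + (2^-1 * (a - b)) ^+ 2 = 2^-1 * (a ^+ 2 + b ^+ 2).
  by field.
by apply: powR_midpoint => //; exact: sqr_ge0.
Qed.

Lemma clarkson_integral d (T : measurableType d) (mu : {measure set T -> \bar R})
    (D : set T) (w f g : T -> R) p : 2 <= p -> measurable D ->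
  measurable_fun D w -> measurable_fun D f -> measurable_fun D g ->
  (forall t, D t -> 0 <= w t) ->
  (\int[mu]_(t in D) (w t * `|2^-1 * (f t + g t)| `^ p)%:E +
   \int[mu]_(t in D) (w t * `|2^-1 * (f t - g t)| `^ p)%:E <=
   2^-1%:E * (\int[mu]_(t in D) (w t * `|f t| `^ p)%:E +
              \int[mu]_(t in D) (w t * `|g t| `^ p)%:E))%E.
Proof.
move=> p2 mD mw mf mg w0.
have mk (h : T -> R) : measurable_fun D h -> measurable_fun D (fun t => (w t * `|h t| `^ p)%:E).
  move=> mh; apply/measurable_EFinP; apply: measurable_funM => //.
  apply: (@measurableT_comp _ _ _ _ _ _ (@powR R ^~ p)) => //.
  exact: (@measurableT_comp _ _ _ _ _ _ (@Num.norm R R)).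
have k0 (h : T -> R) t : D t -> (0 <= (w t * `|h t| `^ p)%:E)%E.
  by move=> Dt; rewrite lee_fin mulr_ge0 ?powR_ge0 ?w0.
have mD2 : measurable_fun D (fun t => 2^-1 * (f t + g t)).
  by apply: measurable_funM => //; apply: measurable_funD.
have mB2 : measurable_fun D (fun t => 2^-1 * (f t - g t)).
  by apply: measurable_funM => //; apply: measurable_funB.
have h0 : (0 <= 2^-1%:E :> \bar R)%E by rewrite lee_fin; lra.
have mkf := mk _ mf; have mkg := mk _ mg; have mkD := mk _ mD2; have mkB := mk _ mB2.
have kf := k0 f; have kg := k0 g; have kD := k0 (fun t => 2^-1 * (f t + g t)).
have kB := k0 (fun t => 2^-1 * (f t - g t)).
rewrite -ge0_integralD// -ge0_integralD// -ge0_integralZl//; last 2 first.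
- exact: emeasurable_funD.
- by move=> t Dt; rewrite adde_ge0 ?kf ?kg.
apply: ge0_le_integral => //.
- by move=> t Dt; rewrite adde_ge0 ?kD ?kB.
- exact: emeasurable_funD.
- by apply: measurable_funeM; exact: emeasurable_funD.
move=> t Dt; rewrite -!EFinD -EFinM lee_fin -!mulrDr mulrCA ler_wpM2l ?w0//.
exact: clarkson.
Qed.

End Clarkson.

Section FatouBound.
Context d (T : measurableType d) (R : realType).

(** The form of the lemma of Fatou for one term of an energy whose other terms
    converge. *)
Lemma fatou_bound (mu : {measure set T -> \bar R}) (D : set T)
    (h : (T -> \bar R)^nat) (g : T -> \bar R) (c : R^nat) (l : R) :
  measurable D -> (forall n, measurable_fun D (h n)) ->
  (forall n t, D t -> 0 <= h n t)%E ->
  (forall t, D t -> h ^~ t @ \oo --> g t) ->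
  (forall n, \int[mu]_(t in D) h n t <= (c n)%:E)%E -> c @ \oo --> l ->
  (\int[mu]_(t in D) g t <= l%:E)%E.
Proof.
move=> mD mh h0 hg hc cl.
have -> : (\int[mu]_(t in D) g t = \int[mu]_(t in D) limn_einf (h ^~ t))%E.
  apply: eq_integral => t; rewrite inE => Dt.
  by have [-> _] := cvg_limn_einf_sup (hg t Dt).
apply: le_trans (fatou mu mD mh h0) _; rewrite limn_einf_lim.
have cl' : (EFin \o c) @ \oo --> l%:E by apply: cvg_EFin => //; near=> n.
rewrite -(cvg_lim _ cl')//; apply: lee_lim.
- exact: is_cvg_einfs.
- by apply/cvg_ex; exists l%:E.
- near=> n; apply: le_trans (hc n); apply: ereal_inf_lbound.
  by exists n => /=; [exact: leqnn|].
Unshelve. all: by end_near. Qed.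

End FatouBound.

(** * Almost everywhere equality and linearity of the trace *)

Section AlmostEverywhere.
Context {R : realType}.

Lemma ae_plane_imply (P Q : mplane R -> Prop) : (forall x, P x -> Q x) ->
  {ae lebesgue2, forall x, P x} -> {ae lebesgue2, forall x, Q x}.
Proof.
by move=> PQ; apply: filterS => //; exact: (ae_filter_ringOfSetsType lebesgue2).
Qed.

Lemma ae_plane_and (P Q : mplane R -> Prop) : {ae lebesgue2, forall x, P x} ->
  {ae lebesgue2, forall x, Q x} -> {ae lebesgue2, forall x, P x /\ Q x}.
Proof.
by move=> aP aQ; apply: filterI => //; exact: (ae_filter_ringOfSetsType lebesgue2).
Qed.

Variables (Om : set (R * R)) (s p : R).
Hypothesis mOm : measurable (Om : set (mplane R)).

(** By Tonelli: where u x = v x, the slices at x have kernels that agree for almost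
    every y, hence are equal. *)
Lemma gagliardo_ae (u v : R * R -> R) :
  measurable_fun (Om : set (mplane R)) u -> measurable_fun (Om : set (mplane R)) v ->
  eq_in Om u v -> gagliardo Om s p u = gagliardo Om s p v.
Proof.
move=> mu mv uv; rewrite (gagliardo_slice s p mOm mu) (gagliardo_slice s p mOm mv).
apply: ge0_ae_eq_integral => //.
- exact: measurable_gag_slice.
- exact: measurable_gag_slice.
- by move=> x _; exact: gag_slice_ge0.
- by move=> x _; exact: gag_slice_ge0.
apply: (ae_plane_imply _ uv) => x uvx Ox; rewrite /gag_slice.
apply: ge0_ae_eq_integral => //.
- by apply/measurable_EFinP; exact: measurable_gag_kernel2.
- by apply/measurable_EFinP; exact: measurable_gag_kernel2.
- by move=> y _; rewrite lee_fin gag_kernel_ge0.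
- by move=> y _; rewrite lee_fin gag_kernel_ge0.
by apply: (ae_plane_imply _ uv) => y uvy Oy; rewrite /gag_kernel uvx// uvy.
Qed.

End AlmostEverywhere.

Section TraceCombination.
Context {R : realType}.
Implicit Types (x y z : R * R) (u v w : R * R -> R).
Variables (Om : set (R * R)) (s p k R0 : R).
Hypotheses (p1 : 1 < p) (sp2 : 2 < s * p) (k0 : 0 < k) (R00 : 0 < R0).
Hypotheses (oOm : open Om) (bOm : bounded_set Om).
Hypothesis Om_sub : forall x, closure Om x -> Om `<=` eball x R0.
Hypothesis dens : forall x (r : R), closure Om x -> 0 < r -> r <= R0 ->
  ((k * r ^+ 2)%:E <= lebesgue2 (eball x r `&` Om : set (mplane R)))%E.

Let avg (A : set (mplane R)) (h : R * R -> R) : R :=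
  \int[lebesgue2]_(y in A) h y / fine (lebesgue2 A).

Let average_combination (A : set (mplane R)) u v w (a b c : R) :
  0 <= c ->  measurable A -> (0 < lebesgue2 A)%E -> (lebesgue2 A < +oo)%E ->
  lebesgue2.-integrable A (EFin \o u) -> lebesgue2.-integrable A (EFin \o v) ->
  lebesgue2.-integrable A (EFin \o w) ->
  {ae lebesgue2, forall x : mplane R, A x -> `|w x - (a * u x + b * v x)| <= c} ->
  `|avg A w - (a * avg A u + b * avg A v)| <= c.
Proof.
move=> c0 mA A0 Aoo iu iv iw near_comb.
have m0 : 0 < fine (lebesgue2 A) by rewrite fine_gt0// A0.
have iau : lebesgue2.-integrable A (EFin \o (fun x => a * u x)) by exact: (integrableZl mA a iu).
have ibv : lebesgue2.-integrable A (EFin \o (fun x => b * v x)) by exact: (integrableZl mA b iv).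
have iab : lebesgue2.-integrable A (EFin \o (fun x => a * u x + b * v x)).
  exact: (integrableD mA iau ibv).
have iwab : lebesgue2.-integrable A (EFin \o (fun x => w x - (a * u x + b * v x))).
  exact: (integrableB mA iw iab).
have -> : avg A w - (a * avg A u + b * avg A v) = avg A (fun x => w x - (a * u x + b * v x)).
  rewrite /avg (RintegralB mA iw iab) (RintegralD mA iau ibv).
  by rewrite (RintegralZl _ mA iu) (RintegralZl _ mA iv); ring.
rewrite /avg normrM normfV (gtr0_norm m0) ler_pdivrMr//.
rewrite -lee_fin EFin_normr_Rintegral//.
apply: le_trans (le_abse_integral _ mA (measurable_int _ iwab)) _.
rewrite EFinM fineK ?ge0_fin_numE// -integral_cst//.
apply: ae_ge0_le_integral => //.
apply: measurableT_comp => //; exact: measurable_int iwab.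
Qed.

(** With c = 0 this is linearity, and with a = 1, b = 0 it says that the trace is a
    contraction for the uniform norm. *)
Lemma trace_combination u v w (a b c : R) : 0 <= c ->
  sobolev Om s p u -> sobolev Om s p v -> sobolev Om s p w ->
  {ae lebesgue2, forall x : mplane R, Om x -> `|w x - (a * u x + b * v x)| <= c} ->
  forall x, closure Om x ->
  `|trace Om w x - (a * trace Om u x + b * trace Om v x)| <= c.
Proof.
move=> c0 Wu Wv Ww near_comb x Ox.
have tcvg h : sobolev Om s p h -> local_average Om h x r @[r --> 0^'+] --> trace Om h x.
  by move=> Wh; exact: (trace_cvg p1 sp2 k0 R00 oOm bOm Om_sub dens Wh Ox).
have lim_comb : `|local_average Om w x r - (a * local_average Om u x r +
    b * local_average Om v x r)| @[r --> 0^'+] -->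
    `|trace Om w x - (a * trace Om u x + b * trace Om v x)|.
  apply: cvg_norm; apply: cvgB; first exact: tcvg.
  by apply: cvgD; apply: cvgMl_tmp; exact: tcvg.
have mOm : measurable (Om : set (mplane R)) := measurable_domain oOm.
apply: (cvgr_to_le lim_comb); near=> r.
have r0 : 0 < r by near: r; exact: nbhs_right_gt.
have rR0 : r <= R0 by near: r; exact: nbhs_right_le.
have mA : measurable (eball x r `&` Om : set (mplane R)).
  by apply: measurableI => //; exact: measurable_eball.
have iA h : sobolev Om s p h -> lebesgue2.-integrable (eball x r `&` Om) (EFin \o h).
  move=> Wh; apply: (integrableS mOm mA (@subIsetr _ _ _)).
  exact: (sobolev_integrable p1 oOm bOm Wh).
apply: average_combination => //.
- apply: lt_le_trans (dens Ox r0 rR0).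
  by rewrite lte_fin mulr_gt0// exprn_gt0.
- apply: le_lt_trans (domain_measure_lty oOm bOm).
  by apply: le_measure; rewrite ?inE.
- exact: iA.
- exact: iA.
- exact: iA.
by apply: (ae_plane_imply _ near_comb) => y wy [_ Oy]; exact: wy.
Unshelve. all: by end_near. Qed.

End TraceCombination.

Section Sequences.
Context {R : realType}.

Lemma cvg_norm_powR (a : R^nat) (l p : R) : 0 < p ->
  a @ \oo --> l -> `|a n| `^ p @[n --> \oo] --> `|l| `^ p.
Proof.
move=> p0 /cvg_norm al; have [l0|l_neq0] := eqVneq l 0; last first.
  have l0 : 0 < `|l| by rewrite normr_gt0.
  apply: (@cvg_comp _ _ _ (fun n => `|a n|) (@powR R ^~ p) _ _ _ al).
  have := @differentiable_continuous R R^o R^o `|l| (@powR R ^~ p); apply.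
  apply/derivable1_diffP.
  by apply: derivable_powR; rewrite in_itv/= andbT.
move: al; rewrite l0 normr0 powR0 ?gt_eqF// => al.
apply/cvgrPdist_le => e e0; have e0' : 0 < e `^ p^-1 by rewrite powR_gt0.
near=> n; rewrite sub0r normrN ger0_norm ?powR_ge0//.
have an : `|a n| <= e `^ p^-1.
  have : `|0 - `|a n| | <= e `^ p^-1 by near: n; move/cvgrPdist_le : al => /(_ _ e0').
  by rewrite sub0r normrN normr_id.
have -> : e = (e `^ p^-1) `^ p by rewrite -powRrM mulVf ?gt_eqF// powRr1// ltW.
by apply: ge0_ler_powR; rewrite ?nnegrE ?powR_ge0 ?(ltW p0).
Unshelve. all: by end_near. Qed.

Lemma cvg_rate (a c : R^nat) : (forall n m, (n <= m)%N -> `|a n - a m| <= c n) ->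
  c @ \oo --> 0 -> a @ \oo --> lim (a @ \oo) /\
  forall n, `|a n - lim (a @ \oo)| <= c n.
Proof.
move=> ac c0.
have ca : cvg (a @ \oo).
  apply/cauchy_cvgP/cauchy_exP => e e0.
  have [n _ cn] : \forall n \near \oo, `|0 - c n| < e by move/cvgrPdist_lt : c0 => /(_ _ e0).
  exists (a n); exists n => //= m nm; rewrite /ball /=.
  apply: le_lt_trans (ac _ _ nm) _; apply: le_lt_trans (ler_norm _) _.
  by have := cn n (leqnn n); rewrite sub0r normrN.
split=> // n.
have lim_dist : `|a n - a m| @[m --> \oo] --> `|a n - lim (a @ \oo)|.
  by apply: cvg_norm; apply: cvgB => //; exact: cvg_cst.
by apply: (cvgr_to_le lim_dist); exists n => // m; exact: ac.
Qed.

End Sequences.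

(** * Existence and uniqueness of the minimizer *)

Section Variational.
Context {R : realType}.
Implicit Types (x y z : R * R) (u v w : R * R -> R).
Variables (Om : set (R * R)) (s p k R0 : R).
Hypotheses (p1 : 1 < p) (p2 : 2 <= p) (sp2 : 2 < s * p) (k0 : 0 < k) (R00 : 0 < R0).
Hypotheses (oOm : open Om) (bOm : bounded_set Om).
Hypothesis Om_sub : forall x, closure Om x -> Om `<=` eball x R0.
Hypothesis dens : forall x (r : R), closure Om x -> 0 < r -> r <= R0 ->
  ((k * r ^+ 2)%:E <= lebesgue2 (eball x r `&` Om : set (mplane R)))%E.
Variables (nu : {measure set (mplane R) -> \bar R}) (b : R * R -> R) (b0 b1 : R).
Notation Gam := (boundary Om : set (mplane R)).
Hypotheses (mGam : measurable Gam) (nuGam_lty : (nu Gam < +oo)%E)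
  (nuGam_gt0 : (0 < nu Gam)%E).
Hypotheses (mb : measurable_fun Gam b) (b00 : 0 < b0)
  (b_bnd : forall x, Gam x -> b0 <= b x <= b1).
Variable f : R * R -> R.
Hypothesis f_L1 : lebesgue2.-integrable Om (fun x => (f x)%:E).

Let p0 : 0 < p. Proof. exact: lt_trans ltr01 p1. Qed.

Let mOm : measurable (Om : set (mplane R)). Proof. exact: measurable_domain. Qed.

Let W := sobolev Om s p.

Let Gam_closure : Gam `<=` closure Om. Proof. exact: subDsetl. Qed.

Let tr_comb := @trace_combination _ Om s p k R0 p1 sp2 k0 R00 oOm bOm Om_sub dens.
Let tr_rho := @trace_cvg_rho _ Om s p k R0 p1 sp2 k0 R00 oOm bOm Om_sub dens.
Let tr_ae := @trace_ae _ Om s p k R0 p1 sp2 k0 R00 oOm bOm dens.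
Let m_tr := @measurable_trace _ Om s p k R0 p1 sp2 k0 R00 oOm bOm Om_sub dens.

Lemma trace_bounded u : W u -> exists M, forall x, closure Om x -> `|trace Om u x| <= M.
Proof.
move=> Wu; have [rho rho0 Gu] := gagliardo_le_powR p1 Wu.
exists (`|domain_mean Om u| + morrey_const s p k R0 * rho) => x Ox.
have [_] := tr_rho Wu Ox rho0 Gu; rewrite -lerBlDl; apply: le_trans.
by rewrite distrC; apply: le_trans (lerB_dist _ _).
Qed.

Definition boundary_term u : \bar R :=
  (\int[nu]_(x in boundary Om) (b x * `|trace Om u x| `^ p)%:E)%E.

Let b_ge0 x : Gam x -> 0 <= b x.
Proof. by move=> /b_bnd/andP[+ _]; exact/le_trans/ltW. Qed.

Let boundary_term_ge0 u : (0 <= boundary_term u)%E.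
Proof.
by apply: integral_ge0 => x Gx; rewrite lee_fin mulr_ge0 ?powR_ge0 ?b_ge0.
Qed.

Let m_trG u : W u -> measurable_fun Gam (trace Om u).
Proof.
move=> Wu; apply: measurable_funS (m_tr Wu) => //.
by apply: closed_measurable_plane; exact: closed_closure.
Qed.

Let m_bdry u : W u -> measurable_fun Gam (fun x => (b x * `|trace Om u x| `^ p)%:E).
Proof.
move=> Wu; apply/measurable_EFinP; apply: measurable_funM => //.
by apply: measurable_fun_norm_powR; exact: m_trG.
Qed.

Lemma boundary_term_lty u : W u -> (boundary_term u < +oo)%E.
Proof.
move=> Wu; have [M trM] := trace_bounded Wu.
apply: (@le_lt_trans _ _ (\int[nu]_(x in Gam) (b1 * M `^ p)%:E)%E).
  apply: ge0_le_integral => //.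
  - by move=> x Gx; rewrite lee_fin mulr_ge0 ?powR_ge0 ?b_ge0.
  - exact: m_bdry.
  move=> x Gx; rewrite lee_fin; have Ox := Gam_closure Gx.
  apply: ler_pM; rewrite ?powR_ge0 ?b_ge0//; first by have /andP[] := b_bnd Gx.
  by apply: ge0_ler_powR; rewrite ?nnegrE ?(ltW p0) ?trM// (le_trans _ (trM _ Ox)).
rewrite integral_cst//; apply: lte_mul_pinfty => //; last first.
have [x Gx] : Gam !=set0.
  by apply/set0P/eqP => G0; move: nuGam_gt0; rewrite G0 measure0 ltxx.
rewrite lee_fin mulr_ge0 ?powR_ge0//; have /andP[bb bb1] := b_bnd Gx.
exact: le_trans (ltW b00) (le_trans bb bb1).
Qed.

Lemma load_integrable u : W u -> lebesgue2.-integrable Om (fun x => (f x * u x)%:E).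
Proof.
move=> Wu; have [mu _ _] := Wu; have [M trM] := trace_bounded Wu.
have mf : measurable_fun (Om : set (mplane R)) f.
  by apply/measurable_EFinP; exact: measurable_int f_L1.
have mfu : measurable_fun (Om : set (mplane R)) (fun x => f x * u x).
  exact: measurable_funM.
apply/integrableP; split; first exact/measurable_EFinP.
apply: (@le_lt_trans _ _ (\int[lebesgue2]_(x in Om) `|M%:E * (f x)%:E|)%E).
  apply: ae_ge0_le_integral => //.
  - by apply: measurableT_comp => //; apply/measurable_EFinP.
  - apply: measurableT_comp => //; apply: measurable_funeM; exact/measurable_EFinP.
  apply: (ae_plane_imply _ (tr_ae Wu)) => x /= ux Ox; rewrite lee_fin !normrM mulrC.
  apply: ler_wpM2r => //; rewrite -(ux Ox); apply: le_trans (ler_norm M).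
  exact/trM/subset_closure.
have /integrableP[_] := integrableZl mOm M f_L1; exact.
Qed.

Let G u := fine (gagliardo Om s p u).
Let Bt u := fine (boundary_term u).
Let F u := \int[lebesgue2]_(x in Om) (f x * u x).

Definition energy_value u : R := p^-1 * G u - F u + p^-1 * Bt u.

Lemma energyE u : W u -> energy Om nu s p f b u = (energy_value u)%:E.
Proof.
move=> Wu; rewrite /energy /energy_value; have [_ _ Gu] := Wu.
have EG : gagliardo Om s p u = (G u)%:E by rewrite fineK// ge0_fin_numE// gagliardo_ge0.
have EB : boundary_term u = (Bt u)%:E.
  by rewrite fineK// ge0_fin_numE// boundary_term_lty.
have EF : (\int[lebesgue2]_(x in Om) (f x * u x)%:E)%E = (F u)%:E.
  by rewrite fineK//; exact: (integrable_fin_num mOm (load_integrable Wu)).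
rewrite EG EF; move: EB; rewrite /boundary_term => ->.
by rewrite -!EFinM -EFinN -!EFinD.
Qed.

Definition half_sum u v x : R := 2^-1 * (u x + v x).
Definition half_diff u v x : R := 2^-1 * (u x - v x).

Let half_measurable u v : measurable_fun (Om : set (mplane R)) u ->
  measurable_fun (Om : set (mplane R)) v ->
  measurable_fun (Om : set (mplane R)) (half_sum u v) /\
  measurable_fun (Om : set (mplane R)) (half_diff u v).
Proof.
move=> mu mv; split; apply: measurable_funM => //.
  exact: measurable_funD.
exact: measurable_funB.
Qed.

Let gagliardo_weight u : gagliardo Om s p u =
  (\int[lebesgue2 \x lebesgue2]_(z in Om `*` Om)
    (enorm (z.1 - z.2) `^ (- (2 + s * p)) * `|u z.1 - u z.2| `^ p)%:E)%E.
Proof. by apply: eq_integral => z _; rewrite powRN mulrC. Qed.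

Let measurable_increment u : measurable_fun (Om : set (mplane R)) u ->
  measurable_fun (Om `*` Om : set (mplane R * mplane R)) (fun z : mplane R * mplane R => u z.1 - u z.2).
Proof.
move=> mu; have mOO : measurable (Om `*` Om : set (mplane R * mplane R)).
  exact: measurableX.
apply: measurable_funB.
  apply: (measurable_comp mOm _ mu); last exact: measurable_funS measurable_fst.
  by move=> _ [w [Ow _] <-].
apply: (measurable_comp mOm _ mu); last exact: measurable_funS measurable_snd.
by move=> _ [w [_ Ow] <-].
Qed.

Lemma gagliardo_midpoint u v : measurable_fun (Om : set (mplane R)) u ->
  measurable_fun (Om : set (mplane R)) v ->
  (gagliardo Om s p (half_sum u v) + gagliardo Om s p (half_diff u v) <=
   2^-1%:E * (gagliardo Om s p u + gagliardo Om s p v))%E.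
Proof.
move=> mu mv; rewrite !gagliardo_weight.
have := @clarkson_integral R _ _ (lebesgue2 \x lebesgue2)%E (Om `*` Om)
  (fun z : mplane R * mplane R => enorm (z.1 - z.2) `^ (- (2 + s * p)))
  _ _ p p2 (measurableX mOm mOm) _ (measurable_increment mu) (measurable_increment mv) _.
have sumE (z : mplane R * mplane R) : half_sum u v z.1 - half_sum u v z.2 =
    2^-1 * ((u z.1 - u z.2) + (v z.1 - v z.2)).
  by rewrite /half_sum; ring.
have diffE (z : mplane R * mplane R) : half_diff u v z.1 - half_diff u v z.2 =
    2^-1 * ((u z.1 - u z.2) - (v z.1 - v z.2)).
  by rewrite /half_diff; ring.
under [X in (_ -> _ -> _) -> (X + _ <= _)%E]eq_integral do rewrite sumE.
under [X in (_ -> _ -> _) -> (_ + X <= _)%E]eq_integral do rewrite diffE.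
apply.
- by apply: measurable_fun_powR; exact: measurable_enormB.
- by move=> z _; exact: powR_ge0.
Qed.

Let half_lt_pinfty (x y a c : \bar R) : (0 <= x)%E -> (0 <= y)%E ->
  (x + y <= 2^-1%:E * (a + c))%E -> (a < +oo)%E -> (c < +oo)%E ->
  (x < +oo)%E /\ (y < +oo)%E.
Proof.
move=> x0 y0 xy aoo coo.
have xyoo : (x + y < +oo)%E.
  apply: le_lt_trans xy _; apply: lte_mul_pinfty; rewrite ?lee_fin ?invr_ge0//.
  exact: lte_add_pinfty.
by split; apply: le_lt_trans xyoo; [exact: leeDl|exact: leeDr].
Qed.

Lemma sobolev_half u v : W u -> W v -> W (half_sum u v) /\ W (half_diff u v).
Proof.
move=> [mu up Gu] [mv vp Gv]; have [ms md] := half_measurable mu mv.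
have [Gs Gd] := half_lt_pinfty (gagliardo_ge0 _ _ _ _) (gagliardo_ge0 _ _ _ _)
  (gagliardo_midpoint mu mv) Gu Gv.
pose Lp (h : R * R -> R) := (\int[lebesgue2]_(x in Om) (`|h x| `^ p)%:E)%E.
have LpE h : Lp h = (\int[lebesgue2]_(x in Om) (cst 1%R x * `|h x| `^ p)%:E)%E.
  by apply: eq_integral => x _; rewrite mul1r.
have Lp0 h : (0 <= Lp h)%E.
  by apply: integral_ge0 => x _; rewrite lee_fin powR_ge0.
have cl : (Lp (half_sum u v) + Lp (half_diff u v) <= 2^-1%:E * (Lp u + Lp v))%E.
  rewrite !LpE; apply: clarkson_integral; rewrite ?mu ?mv//.
have [sp' dp] := half_lt_pinfty (Lp0 _) (Lp0 _) cl up vp.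
by split; [exact: (And3 ms sp' Gs)|exact: (And3 md dp Gd)].
Qed.

Lemma trace_linear u v w (a c : R) : W u -> W v -> W w ->
  (forall x, w x = a * u x + c * v x) ->
  forall x, closure Om x -> trace Om w x = a * trace Om u x + c * trace Om v x.
Proof.
move=> Wu Wv Ww wE x Ox; apply/eqP; rewrite -subr_eq0 -normr_le0.
apply: (tr_comb (lexx 0) Wu Wv Ww _ Ox); apply: aeW => y _.
by rewrite wE subrr normr0.
Qed.

Let trace_half u v : W u -> W v -> forall x, closure Om x ->
  trace Om (half_sum u v) x = 2^-1 * (trace Om u x + trace Om v x) /\
  trace Om (half_diff u v) x = 2^-1 * (trace Om u x - trace Om v x).
Proof.
move=> Wu Wv x Ox; have [Ws Wd] := sobolev_half Wu Wv; split.
  by rewrite mulrDr (@trace_linear u v _ 2^-1 2^-1)// => y; rewrite /half_sum mulrDr.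
rewrite mulrBr (@trace_linear u v _ 2^-1 (- 2^-1)) ?mulNr// => y.
by rewrite /half_diff mulrBr mulNr.
Qed.

Lemma boundary_midpoint u v : W u -> W v ->
  (boundary_term (half_sum u v) + boundary_term (half_diff u v) <=
   2^-1%:E * (boundary_term u + boundary_term v))%E.
Proof.
move=> Wu Wv.
have termE (h : R * R -> R) (g : mplane R -> R) :
    (forall x, Gam x -> trace Om h x = g x) ->
    boundary_term h = (\int[nu]_(x in Gam) (b x * `|g x| `^ p)%:E)%E.
  by move=> hg; apply: eq_integral => x; rewrite inE => /hg ->.
rewrite (termE _ _ (fun x Gx => (trace_half Wu Wv (Gam_closure Gx)).1)).
rewrite (termE _ _ (fun x Gx => (trace_half Wu Wv (Gam_closure Gx)).2)).
exact: (clarkson_integral nu p2 mGam mb (m_trG Wu) (m_trG Wv) (fun x Gx => b_ge0 Gx)).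
Qed.

Let fin_G u : W u -> gagliardo Om s p u = (G u)%:E.
Proof. by move=> [_ _ Gu]; rewrite fineK// ge0_fin_numE// gagliardo_ge0. Qed.

Let fin_B u : W u -> boundary_term u = (Bt u)%:E.
Proof.
by move=> Wu; rewrite fineK// ge0_fin_numE ?boundary_term_ge0// boundary_term_lty.
Qed.

Let half_fine (a c x y : R) : (x%:E + y%:E <= 2^-1%:E * (a%:E + c%:E))%E ->
  x + y <= 2^-1 * (a + c).
Proof. by rewrite -!EFinD -EFinM lee_fin. Qed.

Let midpoint_arith (P Gs Gd Gu Gv Bs Bd Bu Bv Fu Fv : R) : 0 <= P ->
  Gs + Gd <= 2^-1 * (Gu + Gv) -> Bs + Bd <= 2^-1 * (Bu + Bv) ->
  P * Gs - 2^-1 * (Fu + Fv) + P * Bs + P * (Gd + Bd) <=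
  2^-1 * (P * Gu - Fu + P * Bu + (P * Gv - Fv + P * Bv)).
Proof.
move=> P0 hG hB; have := ler_wpM2l P0 (lerD hG hB); lra.
Qed.

(** The load is linear, so only the two convex terms contribute to the gap. *)
Let energy_midpoint u v : W u -> W v ->
  energy_value (half_sum u v) + p^-1 * (G (half_diff u v) + Bt (half_diff u v)) <=
  2^-1 * (energy_value u + energy_value v).
Proof.
move=> Wu Wv; have [Ws Wd] := sobolev_half Wu Wv; have [mu _ _] := Wu; have [mv _ _] := Wv.
have := gagliardo_midpoint mu mv; rewrite (fin_G Ws) (fin_G Wd) (fin_G Wu) (fin_G Wv) => /half_fine hG.
have := boundary_midpoint Wu Wv; rewrite (fin_B Ws) (fin_B Wd) (fin_B Wu) (fin_B Wv) => /half_fine hB.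
have hF : F (half_sum u v) = 2^-1 * (F u + F v).
  rewrite /F -(RintegralD mOm (load_integrable Wu) (load_integrable Wv)).
  rewrite -(RintegralZl _ mOm); last first.
    exact: (integrableD mOm (load_integrable Wu) (load_integrable Wv)).
  by apply: eq_Rintegral => x _; rewrite /half_sum; ring.
rewrite /energy_value hF.
have pV : 0 <= p^-1 by rewrite invr_ge0 ltW.
exact: (@midpoint_arith _ _ _ _ _ _ _ _ _ (F u) (F v) pV hG hB).
Qed.

Let nuGam_fin : 0 < fine (nu Gam).
Proof. by rewrite fine_gt0// nuGam_gt0. Qed.

Definition poincare_const : R :=
  (2 / (b0 * fine (nu Gam))) `^ p^-1 + 2 * morrey_const s p k R0.

(** Otherwise the boundary term would exceed 2 rho^p. *)
Let small_trace_exists u (rho : R) : W u -> 0 < rho ->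
  (boundary_term u <= (rho `^ p)%:E)%E ->
  exists2 x, Gam x & `|trace Om u x| <= (2 / (b0 * fine (nu Gam))) `^ p^-1 * rho.
Proof.
move=> Wu rho0 Bu; apply: contrapT => nex; set K := (_ `^ p^-1) in nex.
have c0 : 0 < b0 * fine (nu Gam) by rewrite mulr_gt0.
have rp : 0 < rho `^ p by rewrite powR_gt0.
have Kp : K `^ p = 2 / (b0 * fine (nu Gam)).
  by rewrite -powRrM mulVf ?gt_eqF// powRr1// divr_ge0// ltW.
have K0 : 0 <= K by exact: powR_ge0.
have large x : Gam x -> b0 * (K * rho) `^ p <= b x * `|trace Om u x| `^ p.
  move=> Gx; have /andP[bb _] := b_bnd Gx.
  apply: ler_pM; rewrite ?powR_ge0 ?(ltW b00)//.
  apply: ge0_ler_powR; rewrite ?nnegrE ?(ltW p0) ?mulr_ge0 ?(ltW rho0)//.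
  by rewrite leNgt; apply/negP => sx; apply: nex; exists x => //; exact: ltW.
have : (2%:E * (rho `^ p)%:E <= (rho `^ p)%:E)%E.
  apply: le_trans Bu.
  apply: (@le_trans _ _ (\int[nu]_(x in Gam) (b0 * (K * rho) `^ p)%:E)%E).
    rewrite integral_cst// -(@fineK _ (nu Gam)) ?ge0_fin_numE// -!EFinM lee_fin.
    rewrite powRM ?(ltW rho0)// Kp le_eqVlt; apply/orP; left; apply/eqP; field.
    by rewrite (gt_eqF b00) (gt_eqF nuGam_fin).
  apply: ge0_le_integral => //.
  - by move=> x _; rewrite lee_fin mulr_ge0 ?powR_ge0 ?(ltW b00).
  - exact: m_bdry.
by rewrite -EFinM lee_fin leNgt => /negP; apply; rewrite ltr_pMl// ltr1n.
Qed.

Let triangle_arith (m t t' e c : R) : `|t| <= c -> `|m - t| <= e -> `|m - t'| <= e ->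
  `|t'| <= c + 2 * e.
Proof. by rewrite !ler_norml => /andP[? ?] /andP[? ?] /andP[? ?]; apply/andP; lra. Qed.

(** The seminorm controls the distance from the trace to the mean, and the boundary
    term controls the trace at one point, hence the mean. *)
Lemma poincare u (rho : R) : W u -> 0 < rho ->
  (gagliardo Om s p u <= (rho `^ p)%:E)%E -> (boundary_term u <= (rho `^ p)%:E)%E ->
  forall x, closure Om x -> `|trace Om u x| <= poincare_const * rho.
Proof.
move=> Wu rho0 Gu Bu x Ox; have [y Gy yle] := small_trace_exists Wu rho0 Bu.
have [_ hx] := tr_rho Wu Ox rho0 Gu.
have [_ hy] := tr_rho Wu (Gam_closure Gy) rho0 Gu.
rewrite /poincare_const mulrDl -mulrA.
exact: triangle_arith yle hy hx.
Qed.

Let load_norm : R := fine (\int[lebesgue2]_(x in Om) `|(f x)%:E|)%E.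

Let load_norm_fin : (\int[lebesgue2]_(x in Om) `|(f x)%:E| = load_norm%:E)%E.
Proof.
rewrite fineK//; have /integrableP[_ foo] := f_L1.
by rewrite ge0_fin_numE// integral_ge0.
Qed.

Let load_bounded (h : R * R -> R) (M : R) : measurable_fun (Om : set (mplane R)) h ->
  0 <= M -> {ae lebesgue2, forall x : mplane R, Om x -> `|h x| <= M} ->
  lebesgue2.-integrable Om (fun x => (f x * h x)%:E) /\
  `|\int[lebesgue2]_(x in Om) (f x * h x)| <= M * load_norm.
Proof.
move=> mh M0 hM.
have mf : measurable_fun (Om : set (mplane R)) f.
  by apply/measurable_EFinP; exact: measurable_int f_L1.
have mfh : measurable_fun (Om : set (mplane R)) (fun x => f x * h x).
  exact: measurable_funM.
have bnd : (\int[lebesgue2]_(x in Om) `|(f x * h x)%:E| <= (M * load_norm)%:E)%E.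
  rewrite EFinM -load_norm_fin -ge0_integralZl//; last first.
    by apply: measurableT_comp => //; exact/measurable_EFinP.
  apply: ae_ge0_le_integral => //.
  - by apply: measurableT_comp => //; apply/measurable_EFinP.
  - by move=> x _; rewrite mule_ge0.
  - by apply: measurable_funeM; apply: measurableT_comp => //; exact/measurable_EFinP.
  apply: (ae_plane_imply _ hM) => x hx Ox; rewrite /= lee_fin normrM mulrC.
  by apply: ler_wpM2r => //; exact: hx.
have ifh : lebesgue2.-integrable Om (fun x => (f x * h x)%:E).
  apply/integrableP; split; first exact/measurable_EFinP.
  exact: le_lt_trans bnd (ltry _).
split=> //; rewrite -lee_fin; apply: le_trans bnd.
rewrite EFin_normr_Rintegral//; apply: le_abse_integral => //.
exact: measurable_int ifh.
Qed.

Variables phi1 phi2 : R * R -> R.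
Hypotheses (phi1_W : W phi1) (phi2_W : W phi2).

Let K := admissible Om s p phi1 phi2.

Hypothesis K_neq0 : K !=set0.

Let K_sobolev u : K u -> W u. Proof. by case. Qed.

Lemma half_sum_admissible u v : K u -> K v -> K (half_sum u v).
Proof.
move=> [Wu u1 u2] [Wv v1 v2]; split; first exact: (sobolev_half Wu Wv).1.
  apply: (ae_plane_imply _ (ae_plane_and u1 v1)) => x [hu hv] Ox.
  by have := hu Ox; have := hv Ox; rewrite /half_sum; lra.
apply: (ae_plane_imply _ (ae_plane_and u2 v2)) => x [hu hv] Ox.
by have := hu Ox; have := hv Ox; rewrite /half_sum; lra.
Qed.

(** The obstacles are bounded because their traces are. *)
Let admissible_bounded : exists2 M, 0 <= M &
  forall u, K u -> {ae lebesgue2, forall x : mplane R, Om x -> `|u x| <= M}.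
Proof.
have [M1 h1] := trace_bounded phi1_W; have [M2 h2] := trace_bounded phi2_W.
exists (`|M1| + `|M2|); first exact: addr_ge0.
move=> u [Wu u1 u2].
have ae1 := ae_plane_and u1 (tr_ae phi1_W); have ae2 := ae_plane_and u2 (tr_ae phi2_W).
apply: (ae_plane_imply _ (ae_plane_and ae1 ae2)) => x [[p1u p1t] [up2 p2t]] Ox.
have := h1 x (subset_closure Ox); rewrite (p1t Ox) => b1x.
have := h2 x (subset_closure Ox); rewrite (p2t Ox) => b2x.
have := p1u Ox; have := up2 Ox; have := ler_norm M1; have := ler_norm M2.
move: b1x b2x; rewrite !ler_norml => /andP[? ?] /andP[? ?] ? ? ? ?.
by have := normr_ge0 M1; have := normr_ge0 M2 => ? ?; apply/andP; lra.
Qed.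

Let G_ge0 u : 0 <= G u. Proof. by rewrite fine_ge0 ?gagliardo_ge0. Qed.

Let Bt_ge0 u : 0 <= Bt u. Proof. by rewrite fine_ge0 ?boundary_term_ge0. Qed.

Let values : set R := [set energy_value u | u in K].

Let values_inf : has_inf values.
Proof.
split; first by case: K_neq0 => u Ku; exists (energy_value u); exists u.
have [M M0 hM] := admissible_bounded; exists (- (M * load_norm)) => _ [u Ku <-].
have [mu _ _] := K_sobolev Ku; have [_] := load_bounded mu M0 (hM u Ku).
rewrite -/(F u) /energy_value ler_norml => /andP[_ Fu].
have pV : 0 <= p^-1 by rewrite invr_ge0 ltW.
have hG := mulr_ge0 pV (G_ge0 u); have hB := mulr_ge0 pV (Bt_ge0 u).
apply: (@le_trans _ _ (- F u)); first by rewrite lerN2.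
by rewrite -{1}[- F u]add0r -[leLHS]addr0; apply: lerD => //; apply: lerD.
Qed.

Let m : R := inf values.

Let m_le u : K u -> m <= energy_value u.
Proof. by move=> Ku; apply: ge_inf; [exact: values_inf.2|exists u]. Qed.

(** The midpoint of two almost minimizers cannot do much better than they do, so by
    uniform convexity the seminorm and the boundary term of half the difference
    are small. *)
Let almost_minimizers_close u v (rho : R) : K u -> K v -> 0 < rho ->
  energy_value u <= m + p^-1 * rho `^ p -> energy_value v <= m + p^-1 * rho `^ p ->
  forall x, closure Om x ->
  `|trace Om u x - trace Om v x| <= 2 * poincare_const * rho.
Proof.
move=> Ku Kv rho0 um vm x Ox.
have Wu := K_sobolev Ku; have Wv := K_sobolev Kv.
have [_ Wd] := sobolev_half Wu Wv.
have mid := energy_midpoint Wu Wv; have mle := m_le (half_sum_admissible Ku Kv).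
have GB : G (half_diff u v) + Bt (half_diff u v) <= rho `^ p.
  have pV : 0 < p^-1 by rewrite invr_gt0.
  rewrite -(ler_pM2l pV); move: mid mle um vm.
  by move: (energy_value u) (energy_value v) (energy_value (half_sum u v))
    (p^-1 * (G _ + _)) => *; lra.
have hG : (gagliardo Om s p (half_diff u v) <= (rho `^ p)%:E)%E.
  by rewrite fin_G// lee_fin; apply: le_trans GB; rewrite lerDl.
have hB : (boundary_term (half_diff u v) <= (rho `^ p)%:E)%E.
  by rewrite fin_B// lee_fin; apply: le_trans GB; rewrite lerDr.
have := poincare Wd rho0 hG hB Ox; rewrite (trace_half Wu Wv Ox).2 normrM.
by rewrite (ger0_norm (_ : 0 <= 2^-1)) ?invr_ge0// ler_pdivrMl// mulrA.
Qed.

(** With an excess of rate n ^ p / p over the infimum, the traces of a minimizing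
    sequence are within a multiple of rate n of each other. *)
Let rate (n : nat) : R := n.+1%:R^-1.

Let rate_gt0 n : 0 < rate n. Proof. by rewrite invr_gt0. Qed.

Let rate_cvg0 : rate @ \oo --> (0 : R). Proof. exact: cvg_harmonic. Qed.

Let gagliardo_arith (q g l e B t : R) : 0 < q ->
  q^-1 * g - l + q^-1 * B <= e + q^-1 * t -> g <= q * e + t + q * l - B.
Proof.
move=> q0 h; have : q * (q^-1 * g - l + q^-1 * B) <= q * (e + q^-1 * t) by rewrite ler_pM2l.
by rewrite !mulrDr mulrN !mulrA mulfV ?gt_eqF// !mul1r; lra.
Qed.

Let energy_arith (q g l e B : R) : 0 < q -> g <= q * e + q * l - B ->
  q^-1 * g - l + q^-1 * B <= e.
Proof.
move=> q0 h; rewrite -(ler_pM2l q0) !mulrDr mulrN !mulrA mulfV ?gt_eqF// !mul1r; lra.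
Qed.

Section Limit.
Variable u_ : nat -> R * R -> R.
Hypothesis u_K : forall n, K (u_ n).
Hypothesis u_min : forall n, energy_value (u_ n) <= m + p^-1 * rate n `^ p.

Let c n : R := 2 * poincare_const * rate n.

Let c_cvg0 : c @ \oo --> (0 : R).
Proof.
by rewrite -(mulr0 (2 * poincare_const)); apply: cvgMl_tmp; exact: rate_cvg0.
Qed.

(** The minimizer: the uniform limit of the traces of a minimizing sequence. *)
Definition trace_limit x : R := lim (trace Om (u_ n) x @[n --> \oo]).
Local Notation v := trace_limit.

Let trace_u_close x n k' : closure Om x -> (n <= k')%N ->
  `|trace Om (u_ n) x - trace Om (u_ k') x| <= c n.
Proof.
move=> Ox nk; apply: almost_minimizers_close => //; apply: le_trans (u_min _) _.
rewrite lerD2l ler_wpM2l ?invr_ge0 ?(ltW p0)//.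
apply: ge0_ler_powR; rewrite ?nnegrE ?(ltW p0) ?(ltW (rate_gt0 _))//.
by rewrite lef_pV2 ?posrE// ler_nat.
Qed.

Let trace_u_cvg x : closure Om x -> trace Om (u_ n) x @[n --> \oo] --> v x.
Proof.
move=> Ox.
by have [] := cvg_rate (fun n k' => trace_u_close Ox (k' := k')) c_cvg0.
Qed.

Let trace_u_rate x n : closure Om x -> `|trace Om (u_ n) x - v x| <= c n.
Proof.
move=> Ox.
by have [_] := cvg_rate (fun n k' => trace_u_close Ox (k' := k')) c_cvg0; exact.
Qed.

Let c_ge0 n : 0 <= c n.
Proof.
have [x Gx] : Gam !=set0.
  by apply/set0P/eqP => G0; move: nuGam_gt0; rewrite G0 measure0 ltxx.
exact: le_trans (trace_u_rate n (Gam_closure Gx)).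
Qed.

Let measurable_limit : measurable_fun (closure Om : set (mplane R)) v.
Proof.
apply: (@measurable_fun_cvg _ _ _ _ (fun n => trace Om (u_ n))) => [n|x Ox].
  exact: (m_tr (K_sobolev (u_K n))).
exact: trace_u_cvg.
Qed.

Let mcl : measurable (closure Om : set (mplane R)).
Proof. by apply: closed_measurable_plane; exact: closed_closure. Qed.

Let measurable_limit_Om : measurable_fun (Om : set (mplane R)) v.
Proof. exact: (measurable_funS mcl (@subset_closure _ Om) measurable_limit). Qed.

Let trace_u_bounded : exists2 M, 0 <= M &
  forall x, closure Om x -> `|v x| <= M /\ forall n, `|trace Om (u_ n) x| <= M.
Proof.
have [M hM] := trace_bounded (K_sobolev (u_K 0%N)).
exists (`|M| + c 0%N); first by rewrite addr_ge0.
move=> x Ox; have M0 := le_trans (hM x Ox) (ler_norm M).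
split=> [|n].
  rewrite -[v x](subKr (trace Om (u_ 0%N) x)).
  by apply: le_trans (ler_normB _ _) _; apply: lerD => //; exact: trace_u_rate.
rewrite -[trace Om (u_ n) x](subKr (trace Om (u_ 0%N) x)).
by apply: le_trans (ler_normB _ _) _; apply: lerD => //; exact: trace_u_close.
Qed.

Let limit_close n : {ae lebesgue2, forall x : mplane R, Om x -> `|u_ n x - v x| <= c n}.
Proof.
apply: (ae_plane_imply _ (tr_ae (K_sobolev (u_K n)))) => x ux Ox.
by rewrite -(ux Ox); apply: trace_u_rate; exact: subset_closure.
Qed.

Let load_cvg : F (u_ n) @[n --> \oo] --> F v.
Proof.
have [M M0 hM] := trace_u_bounded.
have vM : {ae lebesgue2, forall x : mplane R, Om x -> `|v x| <= M}.
  by apply: aeW => x Ox; exact: (hM x (subset_closure Ox)).1.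
have [ifv _] := load_bounded measurable_limit_Om M0 vM.
apply/cvgrPdist_le => e e0.
have e0' : 0 < e / (load_norm + 1).
  by rewrite divr_gt0// ltr_wpDl// /load_norm fine_ge0// integral_ge0.
near=> n.
have cn : c n <= e / (load_norm + 1).
  have : `|0 - c n| <= e / (load_norm + 1).
    by near: n; move/cvgrPdist_le : c_cvg0 => /(_ _ e0').
  by rewrite sub0r normrN ger0_norm.
have Wn := K_sobolev (u_K n); have [mun _ _] := Wn.
have mh : measurable_fun (Om : set (mplane R)) (fun x => u_ n x - v x).
  exact: measurable_funB.
have [_] := load_bounded mh (c_ge0 n) (limit_close n).
rewrite distrC /F -(RintegralB mOm (load_integrable Wn) ifv).
under eq_Rintegral do rewrite mulrBr.
move=> /le_trans; apply; have ln0 : 0 <= load_norm.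
  by rewrite /load_norm fine_ge0// integral_ge0.
apply: le_trans (ler_wpM2r ln0 cn) _.
rewrite mulrAC ler_pdivrMr ?ltr_wpDl// mulrDr mulr1 lerDl; exact: ltW.
Unshelve. all: by end_near. Qed.

Let boundary_limit : \bar R :=
  (\int[nu]_(x in boundary Om) (b x * `|v x| `^ p)%:E)%E.

Let boundary_cvg : boundary_limit \is a fin_num /\
  Bt (u_ n) @[n --> \oo] --> fine boundary_limit.
Proof.
have [M M0 hM] := trace_u_bounded.
have b1_ge0 : 0 <= b1.
  have [x Gx] : Gam !=set0.
    by apply/set0P/eqP => G0; move: nuGam_gt0; rewrite G0 measure0 ltxx.
  have /andP[bb bb1] := b_bnd Gx; exact: le_trans (ltW b00) (le_trans bb bb1).
have mv : measurable_fun Gam v by exact: (measurable_funS mcl Gam_closure measurable_limit).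
have icst : nu.-integrable Gam (cst (b1 * M `^ p)%:E).
  apply/integrableP; split; first exact: measurable_cst.
  under eq_integral do rewrite gee0_abs ?lee_fin ?mulr_ge0 ?powR_ge0//.
  by rewrite integral_cst//; apply: lte_mul_pinfty => //; rewrite lee_fin mulr_ge0 ?powR_ge0.
have := @dominated_convergence _ _ _ nu Gam mGam
  (fun n x => (b x * `|trace Om (u_ n) x| `^ p)%:E) (fun x => (b x * `|v x| `^ p)%:E)
  (cst (b1 * M `^ p)%:E).
case.
- by move=> n; apply: m_bdry; exact: K_sobolev.
- apply/measurable_EFinP; apply: measurable_funM => //.
  exact: measurable_fun_norm_powR.
- apply: aeW => x Gx; apply: cvg_EFin; first by near=> n.
  apply: cvgMl_tmp; apply: cvg_norm_powR => //; apply: trace_u_cvg.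
  exact: Gam_closure.
- exact: icst.
- apply: aeW => x n Gx; rewrite lee_fin ger0_norm ?mulr_ge0 ?powR_ge0 ?b_ge0//.
  have [_ tM] := hM x (Gam_closure Gx); apply: ler_pM; rewrite ?powR_ge0 ?b_ge0//.
    by have /andP[] := b_bnd Gx.
  by apply: ge0_ler_powR; rewrite ?nnegrE ?(ltW p0).
move=> ilim _ cvglim.
have fin_lim : boundary_limit \is a fin_num by exact: (integrable_fin_num mGam ilim).
split=> //; apply: fine_cvg; rewrite fineK//; exact: cvglim.
Unshelve. all: by end_near. Qed.

(** The load and the boundary term converge, so almost minimality bounds the
    seminorms by a convergent sequence. *)
Let gagliardo_bound n : (gagliardo Om s p (trace Om (u_ n)) <=
  (p * m + rate n `^ p + p * F (u_ n) - Bt (u_ n))%:E)%E.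
Proof.
have Wn := K_sobolev (u_K n); have [mun _ _] := Wn.
have mt : measurable_fun (Om : set (mplane R)) (trace Om (u_ n)).
  exact: (measurable_funS mcl (@subset_closure _ Om) (m_tr Wn)).
rewrite (gagliardo_ae s p mOm mt mun (tr_ae Wn)) (fin_G Wn) lee_fin.
have := u_min n; rewrite /energy_value; exact: (gagliardo_arith p0).
Qed.

Let limit_gagliardo : (gagliardo Om s p v <=
  (p * m + p * F v - fine boundary_limit)%:E)%E.
Proof.
have [_ Bcvg] := boundary_cvg.
have kE w (z : mplane R * mplane R) :
    (`|w z.1 - w z.2| `^ p / enorm (z.1 - z.2) `^ (2 + s * p))%:E = (gag_kernel s p w z.1 z.2)%:E.
  by [].
apply: (@fatou_bound _ _ _ _ _
  (fun n (z : mplane R * mplane R) => (gag_kernel s p (trace Om (u_ n)) z.1 z.2)%:E) _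
  (fun n => p * m + rate n `^ p + p * F (u_ n) - Bt (u_ n))).
- exact: measurableX.
- move=> n; apply/measurable_EFinP; apply: measurable_gag_kernel => //.
  exact: (measurable_funS mcl (@subset_closure _ Om) (m_tr (K_sobolev (u_K n)))).
- by move=> n z _; rewrite lee_fin gag_kernel_ge0.
- move=> z [/subset_closure Oz1 /subset_closure Oz2]; apply: cvg_EFin; first by near=> n.
  apply: cvgMr_tmp; apply: cvg_norm_powR => //.
  by apply: cvgB; exact: trace_u_cvg.
- exact: gagliardo_bound.
- apply: cvgB => //; apply: cvgD; last by apply: cvgMl_tmp; exact: load_cvg.
  rewrite -[X in _ --> X]addr0; apply: cvgD; first exact: cvg_cst.
  have := cvg_norm_powR p0 rate_cvg0; rewrite normr0 powR0 ?gt_eqF//.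
  by under eq_fun do rewrite (ger0_norm (ltW (rate_gt0 _))).
Unshelve. all: by end_near. Qed.

Let limit_sobolev : W v.
Proof.
split; first exact: measurable_limit_Om.
  have [M M0 hM] := trace_u_bounded.
  apply: (@le_lt_trans _ _ (\int[lebesgue2]_(x in Om) (M `^ p)%:E)%E).
    apply: ge0_le_integral.
    - exact: mOm.
    - by move=> x _; rewrite lee_fin powR_ge0.
    - by apply/measurable_EFinP; apply: measurable_fun_norm_powR; exact: measurable_limit_Om.
    - exact: measurable_cst.
    move=> x Ox; rewrite lee_fin; apply: ge0_ler_powR; rewrite ?nnegrE ?(ltW p0)//.
    exact: (hM x (subset_closure Ox)).1.
  rewrite integral_cst; last exact: mOm.
  apply: lte_mul_pinfty; rewrite ?lee_fin ?powR_ge0//.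
  exact: domain_measure_lty oOm bOm.
exact: le_lt_trans limit_gagliardo (ltry _).
Qed.

(** The limit is defined from traces; its own trace is the same function because
    the trace is a contraction for the uniform norm. *)
Let trace_of_limit x : closure Om x -> trace Om v x = v x.
Proof.
move=> Ox.
have close n : `|trace Om v x - trace Om (u_ n) x| <= c n.
  have hn : {ae lebesgue2, forall y : mplane R,
      Om y -> `|v y - (1 * u_ n y + 0 * u_ n y)| <= c n}.
    apply: (ae_plane_imply _ (limit_close n)) => y hy Oy.
    by rewrite mul1r mul0r addr0 distrC; exact: hy.
  have := tr_comb (c_ge0 n) (K_sobolev (u_K n)) (K_sobolev (u_K n)) limit_sobolev hn Ox.
  by rewrite mul1r mul0r addr0.
have tcv : trace Om (u_ n) x @[n --> \oo] --> trace Om v x.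
  apply/cvgrPdist_le => e e0; near=> n; apply: le_trans (close n) _.
  apply: le_trans (ler_norm _) _.
  have : `|0 - c n| <= e by near: n; move/cvgrPdist_le : c_cvg0 => /(_ _ e0).
  by rewrite sub0r normrN.
exact: (cvg_unique _ tcv (trace_u_cvg Ox)).
Unshelve. all: by end_near. Qed.

Let limit_admissible : K v.
Proof.
have cv : {ae lebesgue2, forall x : mplane R, forall n, [/\ Om x -> trace Om (u_ n) x = u_ n x,
    Om x -> phi1 x <= u_ n x & Om x -> u_ n x <= phi2 x]}.
  apply: ae_foralln => n; have [Wn n1 n2] := u_K n.
  by apply: (ae_plane_imply _ (ae_plane_and (tr_ae Wn) (ae_plane_and n1 n2))) => x [? []].
split; first exact: limit_sobolev.
  apply: (ae_plane_imply _ cv) => x hx Ox.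
  apply: (cvgr_to_ge (trace_u_cvg (subset_closure Ox))); near=> n.
  by have [tE le1 _] := hx n; rewrite tE ?le1.
apply: (ae_plane_imply _ cv) => x hx Ox.
apply: (cvgr_to_le (trace_u_cvg (subset_closure Ox))); near=> n.
by have [tE _ le2] := hx n; rewrite tE ?le2.
Unshelve. all: by end_near. Qed.

Let limit_energy : energy_value v <= m.
Proof.
have BE : Bt v = fine boundary_limit.
  suff -> : boundary_limit = boundary_term v by [].
  apply: eq_integral => x; rewrite inE => /Gam_closure Ox.
  by rewrite (trace_of_limit Ox).
have := limit_gagliardo; rewrite (fin_G limit_sobolev) lee_fin -BE.
rewrite /energy_value; exact: (energy_arith p0).
Qed.

Lemma limit_minimizes : K v /\ energy_value v <= m.
Proof. exact: (conj limit_admissible limit_energy). Qed.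

End Limit.

Let minimizer u := K u /\ forall v, K v ->
  (energy Om nu s p f b u <= energy Om nu s p f b v)%E.

Let minimizer_value u : minimizer u -> energy_value u <= m.
Proof.
move=> [Ku umin]; apply: lb_le_inf; first exact: values_inf.1.
move=> _ [v Kv <-]; have := umin v Kv.
by rewrite (energyE (K_sobolev Ku)) (energyE (K_sobolev Kv)) lee_fin.
Qed.

Lemma minimizer_exists : exists u, minimizer u.
Proof.
have : forall n, exists u, K u /\ energy_value u <= m + p^-1 * rate n `^ p.
  move=> n; have eps0 : 0 < p^-1 * rate n `^ p by rewrite mulr_gt0 ?invr_gt0 ?powR_gt0.
  have [_ [u Ku <-] /ltW um] := inf_adherent eps0 values_inf.
  by exists u.
move=> /choice[u_ hu]; have uK n := (hu n).1; have umin n := (hu n).2.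
have [Kv vm] := limit_minimizes uK umin.
exists (trace_limit u_); split; first exact: Kv.
move=> w Kw.
rewrite (energyE (K_sobolev Kv)) (energyE (K_sobolev Kw)) lee_fin.
exact: le_trans vm (m_le Kw).
Qed.

Lemma minimizer_unique u w : minimizer u -> minimizer w -> eq_in Om u w.
Proof.
move=> mu mw; have [Ku _] := mu; have [Kw _] := mw.
have Wu := K_sobolev Ku; have Ww := K_sobolev Kw.
have um (rho : R) : energy_value u <= m + p^-1 * rho `^ p.
  by apply: le_trans (minimizer_value mu) _; rewrite lerDl mulr_ge0 ?invr_ge0 ?powR_ge0 ?(ltW p0).
have wm (rho : R) : energy_value w <= m + p^-1 * rho `^ p.
  by apply: le_trans (minimizer_value mw) _; rewrite lerDl mulr_ge0 ?invr_ge0 ?powR_ge0 ?(ltW p0).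
have tr_eq x : closure Om x -> trace Om u x = trace Om w x.
  move=> Ox; apply/eqP; rewrite -subr_eq0 -normr_le0; apply/ler_addgt0Pr => e e0.
  rewrite add0r; pose C := `|2 * poincare_const|.
  have C1 : 0 < C + 1 by rewrite ltr_wpDl ?normr_ge0.
  have rho0 : 0 < e / (C + 1) by rewrite divr_gt0.
  apply: le_trans (almost_minimizers_close Ku Kw rho0 (um _) (wm _) Ox) _.
  apply: le_trans (ler_wpM2r (ltW rho0) (ler_norm _)) _.
  rewrite mulrA ler_pdivrMr// mulrC ler_pM2l//.
  by rewrite -/C lerDl.
apply: (ae_plane_imply _ (ae_plane_and (tr_ae Wu) (tr_ae Ww))) => x [ux wx] Ox.
by rewrite -(ux Ox) -(wx Ox) tr_eq//; exact: subset_closure.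
Qed.

End Variational.

(** * The measure on the snowflake *)

Section ContinuousOnMeasurable.
Context {R : realType}.

Lemma continuous_measurable_plane (D : set (R * R)) (g : R * R -> R) :
  measurable (D : set (mplane R)) -> {within D, continuous g} ->
  measurable_fun (D : set (mplane R)) g.
Proof.
move=> mD /continuousP cg; apply: (measurability _ (RGenOpens.measurableE R)).
move=> _ [_ [x [y ->] <-]].
have /open_subspaceP[V oV VD] := cg _ (@interval_open _ (BRight x) (BLeft y) isT isT).
rewrite setIC -VD; apply: measurableI => //; exact: open_measurable_plane.
Qed.

End ContinuousOnMeasurable.

Section SnowflakeMeasure.
Context {R : realType}.
Variables (a b : R * R).
Hypothesis ab : a <> b.

Let ab0 : elen (a, b) != 0.
Proof. by rewrite /elen enorm_eq0 subr_eq0; apply/eqP => /= ba; exact: ab. Qed.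

Let arc_koch (i : 'I_3) : exists2 e, elen e != 0 & snowflake_arc a b i = koch e.
Proof.
case: i => [[|[|[|i]]]] // ilt; rewrite /snowflake_arc /=.
- by exists (a, b).
- by exists (b, apex a b); rewrite ?elen_rot.
- exists (apex a b, a) => //.
  by have := elen_rot b (apex a b); rewrite apex_apex elen_rot => ->.
Qed.

Let arc_neq0 i : hausdorff koch_dim (snowflake_arc a b i) != 0.
Proof. by have [e e0 ->] := arc_koch i; rewrite gt_eqF// hausdorff_koch_gt0. Qed.

Let arc_lty i : (hausdorff koch_dim (snowflake_arc a b i) < +oo)%E.
Proof. by have [e e0 ->] := arc_koch i; exact: hausdorff_koch_lty. Qed.

Let arc_measure_exists i : exists mu : {measure set (mplane R) -> \bar R},
  forall S, mu S = normalized_hausdorff koch_dim (snowflake_arc a b i) S.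
Proof.
pose mu0 : set (mplane R) -> \bar R := normalized_hausdorff koch_dim (snowflake_arc a b i).
have mu00 : mu0 set0 = 0%E := normalized_hausdorff0 _ koch_dim_gt0.
have mu0_ge0 S : (0 <= mu0 S)%E := normalized_hausdorff_ge0 _ _ koch_dim_gt0.
have mu0_sa : semi_sigma_additive mu0 :=
  normalized_hausdorff_sigma_additive koch_dim_gt0 (arc_neq0 i).
pose mu := HB.pack_for {measure set (mplane R) -> \bar R} mu0
  (isMeasure.Build _ _ _ mu0 mu00 mu0_ge0 mu0_sa).
by exists mu.
Qed.

(** The three arcs have positive finite Hausdorff measure, as sides of equal
    length of the triangle, so their normalized restrictions are measures. *)
Lemma snowflake_measureP : exists mu : {measure set (mplane R) -> \bar R},
  (mu : set (mplane R) -> \bar R) = snowflake_measure a b.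
Proof.
have /choice[mu muE] := arc_measure_exists.
exists (msum (fun n => mu (inord n)) 3).
apply/funext => S; rewrite /= /msum /snowflake_measure; apply: eq_bigr => i _.
by rewrite inord_val muE.
Qed.

Lemma snowflake_measure_ge1 S : snowflake a b `<=` S -> (1 <= snowflake_measure a b S)%E.
Proof.
move=> sS; rewrite /snowflake_measure (bigD1 ord0)//= normalized_hausdorff_self//.
- rewrite leeDl//; apply: sume_ge0 => i _; exact: normalized_hausdorff_ge0 koch_dim_gt0.
- exact: koch_dim_gt0.
- by apply: subset_trans sS => x xi; exists ord0.
Qed.

Lemma snowflake_measure_lty S : snowflake a b `<=` S -> (snowflake_measure a b S < +oo)%E.
Proof.
move=> sS; rewrite /snowflake_measure lte_sum_pinfty// => i _.
rewrite normalized_hausdorff_self ?ltry//; first exact: koch_dim_gt0.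
by apply: subset_trans sS => x xi; exists i.
Qed.

End SnowflakeMeasure.

Theorem theorem2p4 (R : realType) (s p : R)
  (s_gt0 : 0 < s) (s_lt1 : s < 1) (p_gt1 : 1 < p)
  (sp_gt2 : 2 < s * p) (sp_ltp : s * p < p)
  (A B : R * R) (AB : A <> B)
  (Om : set (R * R)) (HOm : snowflake_domain A B Om)
  (f : R * R -> R)
  (f_L1 : lebesgue2.-integrable Om (fun x => (f x)%:E))
  (b : R * R -> R)
  (b_cont : {within closure Om, continuous b})
  (b_gt0 : forall x, closure Om x -> 0 < b x)
  (phi1 phi2 : R * R -> R)
  (phi1_W : sobolev Om s p phi1) (phi2_W : sobolev Om s p phi2)
  (phi12 : le_in Om phi1 phi2)
  (K_neq0 : admissible Om s p phi1 phi2 !=set0) :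
  let J := energy Om (snowflake_measure A B) s p f b in
  let K := admissible Om s p phi1 phi2 in
  let minimizer u := K u /\ forall v, K v -> (J u <= J v)%E in
  exists u, minimizer u /\ forall w, minimizer w -> eq_in Om u w.
Proof.
have AB0 : elen (A, B) != 0.
  by rewrite /elen enorm_eq0 subr_eq0; apply/eqP => /= BA; exact: AB.
have [k [R0 [k0 R00 Om_sub dens]]] := domain_density AB0 HOm.
have [oOm bOm _ bdE] := HOm.
have p2 : 2 <= p := ltW (lt_trans sp_gt2 sp_ltp).
have Gam_sub : boundary Om `<=` closure Om := @subDsetl _ _ _.
have cGam : closed (boundary Om) by rewrite bdE snowflakeE; exact: closed_snow.
have mGam : measurable (boundary Om : set (mplane R)) by exact: closed_measurable_plane.
have kGam : compact (boundary Om).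
  by rewrite bdE snowflakeE; do 2 (apply: compactU; last exact: compact_koch); exact: compact_koch.
have bGam_cont : {within boundary Om, continuous b} := continuous_subspaceW Gam_sub b_cont.
have Gam_neq0 : boundary Om !=set0.
  by exists A; rewrite bdE snowflakeE; do 2 left; exact: (@koch_fst _ (A, B)).
have [x Gx bmin] := compact_EVT_min Gam_neq0 kGam bGam_cont.
have [y Gy bmax] := compact_EVT_max Gam_neq0 kGam bGam_cont.
have b_bnd z : boundary Om z -> b x <= b z <= b y.
  by move=> Gz; rewrite bmin ?inE// bmax ?inE.
have bx0 : 0 < b x by apply/b_gt0/Gam_sub; exact: set_mem.
have mb : measurable_fun (boundary Om : set (mplane R)) b.
  exact: continuous_measurable_plane.
have [mu muE] := snowflake_measureP AB.
have mu_lty : (mu (boundary Om) < +oo)%E.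
  by rewrite muE bdE; exact: snowflake_measure_lty.
have mu_gt0 : (0 < mu (boundary Om))%E.
  rewrite muE bdE; apply: (lt_le_trans lte01).
  exact: snowflake_measure_ge1.
rewrite -muE => J K minimizer.
have [u umin] := minimizer_exists p_gt1 p2 sp_gt2 k0 R00 oOm bOm Om_sub dens mGam mu_lty
  mu_gt0 mb bx0 b_bnd f_L1 phi1_W phi2_W K_neq0.
exists u; split; first exact: umin.
move=> w wmin.
exact: (minimizer_unique p_gt1 p2 sp_gt2 k0 R00 oOm bOm Om_sub dens mGam mu_lty
  mu_gt0 mb bx0 b_bnd f_L1 phi1_W phi2_W K_neq0 umin wmin).
Qed.
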